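(* Let $n\ge1$, $\mathcal C=\mathbb R^n$, let $\mathcal X,\mathcal Y$ be Banach spaces, and let $\mathcal X_i=\operatorname{span}\{x_i\}\subset\mathcal X$, $\mathcal Y_i=\operatorname{span}\{y_i\}\subset\mathcal Y$, $i=1,\dots,n$, be one-dimensional subspaces with $$\mathcal X=\Big(\bigoplus_{i=1}^n\mathcal X_i\Big)\oplus\tilde{\mathcal X},\qquad \mathcal Y=\Big(\bigoplus_{i=1}^n\mathcal Y_i\Big)\oplus\tilde{\mathcal Y},$$ where $\tilde{\mathcal X},\tilde{\mathcal Y}$ are closed subspaces. Put $\hat{\mathcal X}_i=\bigoplus_{j\ne i}\mathcal X_j$, $\hat{\mathcal Y}_i=\bigoplus_{j\neq i}\mathcal Y_j$, and let $P_i$ be the projection of $\mathcal Y$ onto $\mathcal Y_i$ along $\hat{\mathcal Y}_i\oplus\tilde{\mathcal Y}$. Let $F\in C^k(\mathcal X\times\mathcal C,\mathcal Y)$, where $k\ge2$ is an integer, $k=\infty$, or $k=\omega$ (that is, $F$ is analytic), be an operator with the following properties: (i) $F[0,\bm c]=0$ for all $\bm c\in\mathcal C$, and there exists $\bm c^*\in\mathcal C$ such that $D_1F[0,\bm c^*]:\mathcal X\to\mathcal Y$ is a Fredholm operator of index $0$; (ii) the kernel of $D_1F[0,\bm c^*]$ is $n$-dimensional and given by $\bigoplus_{i=1}^n\mathcal X_i$; (iii) if $P_iD_1D_{j+1}F[0,\bm c^*](x_i,c_j-c_j^* )=\nu_{ij}(c_j-c_j^* )y_i$, then the $n\times n$ matrix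 $\bm\nu$ with entries $(\bm\nu)_{i,j}=\nu_{ij}$ is invertible; (iv) for each $i=1,\dots,n$ there exist closed subspaces $\tilde{\mathcal X}_i$ of $\tilde{\mathcal X}$ and $\tilde{\mathcal Y}_i$ of $\tilde{\mathcal Y}$ such that $F(\hat{\mathcal X}_i\oplus\tilde{\mathcal X}_i,\bm c)\subseteq\hat{\mathcal Y}_i\oplus\tilde{\mathcal Y}_i$ for all $\bm c\in\mathcal C$, and $$(I-P_i)D_1F[0,\bm c^*]\big|_{\hat{\mathcal X}_i\oplus\tilde{\mathcal X}_i}:\hat{\mathcal X}_i\oplus\tilde{\mathcal X}_i\to\hat{\mathcal Y}_i\oplus\tilde{\mathcal Y}_i$$ is a Fredholm operator of index $0$ with kernel $\hat{\mathcal X}_i$. Then there exists $\epsilon>0$ such that for every $\bm s=(s_1,\dots,s_n)\in B_\epsilon(0)=\{\bm s\in\mathbb R^n:|\bm s|<\epsilon\}$ the equation $F[x,\bm c]=0$ has a solution $(x[\bm s],\bm c[\bm s])$. Moreover, $(x[\cdot],\bm c[\cdot])\in C^{k-1}(B_\epsilon(0),\mathcal X\times\mathcal C)$ and $$x[\bm s]=\sum_{i=1}^ns_ix_i+o(|\bm s|),\qquad \bm c[\bm s]=\bm c^*+\mathcal O(|\bm s|).$$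
   Context: $D_1F$ denotes the Fréchet derivative of $F[x,\bm c]$ with respect to $x\in\mathcal X$; $D_{j+1}F$ denotes the derivative with respect to the scalar variable $c_j$, $j=1,\dots,n$, where $\bm c=(c_1,\dots,c_n)$; $D_1D_{j+1}F[0,\bm c^*](x_i,c_j-c_j^* )$ is the mixed second derivative applied to $x_i$ and the scalar increment $c_j-c_j^*$. For $k=\infty$ or $k=\omega$, $k-1$ is understood as $k$. When $n=1$, $\hat{\mathcal X}_1=\hat{\mathcal Y}_1=\{0\}$.
   Formalization: The formal theorem adds the hypothesis that the range of D_1F[0,c*] lies in the closed complement Ỹ; without it the claim fails, e.g. n=1, X=Y=R^2, F[(u,v),c]=(v+cu, u^2+v^2), c*=0, x_1=y_1=e_1, X̃=Ỹ=span{e_2}, X̃_1=Ỹ_1={0}. *)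

(* Defs.v *)
From HB Require Import structures.
From mathcomp Require Import all_boot all_order all_algebra.
From mathcomp Require Import all_classical all_reals all_analysis.

Set Implicit Arguments.
Unset Strict Implicit.
Unset Printing Implicit Defensive.
Import Order.TTheory GRing.Theory Num.Theory.
Import numFieldNormedType.Exports.
Local Open Scope classical_set_scope.
Local Open Scope ring_scope.

Section BoundedLinear.
Context {R : realType} (E F : normedModType R).

Definition blin_pred : {pred E -> F} :=
  mem [set f : E -> F | linear f /\ continuous f].

Lemma blin_submod_closed : GRing.submod_closed blin_pred.
Proof.
split=> [|a f g]; rewrite !inE /=.
  split; last exact: cst_continuous.
  by move=> a u v /=; rewrite scaler0 addr0.
move=> [fl fc] [gl gc]; split.
  move=> b u v; rewrite !fctE fl gl !scalerDr !scalerA [b * a]mulrC.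
  by rewrite addrACA.
move=> u; apply: cvgD; last exact: gc.
by apply: cvgZr; exact: fc.
Qed.

HB.instance Definition _ :=
  GRing.isSubmodClosed.Build R (E -> F) blin_pred blin_submod_closed.

Record blin := Blin { blin_fun :> E -> F ; _ : blin_fun \in blin_pred }.

HB.instance Definition _ := [isSub for blin_fun].
HB.instance Definition _ := gen_eqMixin blin.
HB.instance Definition _ := gen_choiceMixin blin.
HB.instance Definition _ := [SubChoice_isSubLmodule of blin by <:].

Definition opnorm (f : blin) : R := sup [set `|f u| | u in [set u | `|u| <= 1]].

Lemma blin_linear (f : blin) : linear f.
Proof. by case: f => f /=; rewrite inE => -[]. Qed.

Lemma blin_continuous (f : blin) : continuous f.
Proof. by case: f => f /=; rewrite inE => -[]. Qed.

Lemma blinZ (f : blin) a u : f (a *: u) = a *: f u.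
Proof.
have f0 : f 0 = 0.
  have /eqP := blin_linear f 1 0 0; rewrite !scale1r addr0.
  by rewrite -subr_eq0 opprD addNKr oppr_eq0 => /eqP.
by rewrite -[a *: u]addr0 blin_linear f0 addr0.
Qed.

Lemma blin_bounded (f : blin) : exists M, forall u, `|u| <= 1 -> `|f u| <= M.
Proof.
pose g : {linear E -> F} :=
  HB.pack (f : E -> F) (GRing.isLinear.Build _ _ _ _ _ (blin_linear f)).
have /bounded_funP/(_ 1) [M Mf] : bounded_near g (nbhs (0 : E)).
  exact/linear_bounded_continuous/blin_continuous.
by exists M.
Qed.

Lemma opnorm_has_sup (f : blin) :
  has_sup [set `|f u| | u in [set u | `|u| <= 1]].
Proof.
split; first by exists `|f 0|, 0 => //=; rewrite normr0.
have [M Mf] := blin_bounded f.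
by exists M => _ [u /= u1 <-]; exact: Mf.
Qed.

Lemma opnorm_le1 (f : blin) u : `|u| <= 1 -> `|f u| <= opnorm f.
Proof.
by move=> u1; apply: ub_le_sup; [case: (opnorm_has_sup f) | exists u].
Qed.

Lemma opnorm_lub (f : blin) M :
  (forall u, `|u| <= 1 -> `|f u| <= M) -> opnorm f <= M.
Proof.
move=> fM; apply: ge_sup; first by case: (opnorm_has_sup f).
by move=> _ [u /= u1 <-]; exact: fM.
Qed.

Lemma opnorm_ge0 f : 0 <= opnorm f.
Proof. by apply: le_trans (@opnorm_le1 f 0 _); rewrite ?normr0. Qed.

Lemma opnormP (f : blin) u : `|f u| <= opnorm f * `|u|.
Proof.
have [->|u0] := eqVneq u 0.
  by rewrite -[0 : E](scale0r 0) blinZ !scale0r !normr0 mulr0.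
have nu : 0 < `|u| by rewrite normr_gt0.
rewrite -ler_pdivrMr // mulrC.
have -> : `|u|^-1 * `|f u| = `|f (`|u|^-1 *: u)|.
  by rewrite blinZ normrZ normfV normr_id.
by apply: opnorm_le1; rewrite normrZ normfV normr_id mulVf // gt_eqF.
Qed.

Lemma opnormD (f g : blin) : opnorm (f + g) <= opnorm f + opnorm g.
Proof.
apply: opnorm_lub => u u1.
by rewrite (le_trans (ler_normD _ _)) // lerD // opnorm_le1.
Qed.

Let opnormZ_le (a : R) (f : blin) : opnorm (a *: f) <= `|a| * opnorm f.
Proof.
by apply: opnorm_lub => u u1; rewrite normrZ ler_wpM2l // opnorm_le1.
Qed.

Lemma opnormZ (a : R) (f : blin) : opnorm (a *: f) = `|a| * opnorm f.
Proof.
apply/eqP; rewrite eq_le opnormZ_le /=.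
have [->|a0] := eqVneq a 0; first by rewrite normr0 mul0r opnorm_ge0.
have := opnormZ_le a^-1 (a *: f); rewrite scalerA mulVf // scale1r normfV.
by rewrite ler_pdivlMl // normr_gt0.
Qed.

Lemma opnorm_eq0 (f : blin) : opnorm f = 0 -> f = 0.
Proof.
move=> f0; apply/val_inj/funext => u /=; apply/eqP.
by rewrite -normr_le0 (le_trans (opnormP f u)) // f0 mul0r.
Qed.

HB.instance Definition _ :=
  Lmodule_isNormed.Build R blin opnormD opnormZ opnorm_eq0.

End BoundedLinear.

Section Smoothness.
Context {R : realType}.

Variant smoothness := Finite of nat | Infinite | Analytic.

Definition at_least_C2 (k : smoothness) : Prop :=
  if k is Finite m then (2 <= m)%N else True.

Definition smoothness_pred (k : smoothness) : smoothness :=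
  if k is Finite m then Finite m.-1 else k.

Fixpoint Ck (m : nat) (E F : normedModType R) (U : set E) (f : E -> F) : Prop :=
  if m is m'.+1 then
    (forall u, U u -> differentiable f u) /\
    exists2 df : E -> blin E F,
      forall u, U u -> blin_fun (df u) = 'd f u &
      Ck m' U df
  else forall u, U u -> {for u, continuous f}.

(* Bounded m-linear maps from E to F, as E -> (E -> ... (E -> F)), with the
   iterated operator norm, which is the usual norm of multilinear maps. *)
Fixpoint mlin (m : nat) (E F : normedModType R) : normedModType R :=
  if m is m'.+1 then blin E (mlin m' E F) else F.

(* The homogeneous polynomial h |-> a (h, ..., h). *)
Fixpoint mdiag (m : nat) (E F : normedModType R) : mlin m E F -> E -> F :=
  match m with
  | 0%N => fun a _ => a
  | m'.+1 => fun (a : blin E (mlin m' E F)) h => mdiag (a h) h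
  end.

(* The coefficients a m are not required to be symmetric: symmetrizing them
   changes neither mdiag (a m) nor the bound. *)
Definition analytic_at (E F : normedModType R) (f : E -> F) (u : E) : Prop :=
  exists2 r : R, 0 < r & exists a : forall m, mlin m E F,
    (exists M : R, forall m, `|a m| * r ^+ m <= M) /\
    forall h : E, `|h| < r ->
      series (fun m => mdiag (a m) h) @ \oo --> f (u + h).

(* U is meant to be open. *)
Definition of_class (k : smoothness) (E F : normedModType R) (U : set E)
    (f : E -> F) : Prop :=
  match k with
  | Finite m => Ck m U f
  | Infinite => forall m, Ck m U f
  | Analytic => forall u, U u -> analytic_at f u
  end.

End Smoothness.

Section Subspaces.
Context {R : realType} {V : normedModType R}.

Definition closed_subspace (U : set V) : Prop :=
  GRing.submod_closed (mem U) /\ closed U.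

Definition span_of n (P : pred 'I_n) (e : 'I_n -> V) : set V :=
  [set v | exists a : 'I_n -> R, v = \sum_(i | P i) a i *: e i].

Definition hat n (e : 'I_n -> V) (i : 'I_n) : set V :=
  span_of (fun j => j != i) e.

Definition addS (U W : set V) : set V := [set u + w | u in U & w in W].

(* For subspaces W and U: U is the internal direct sum of the lines spanned by
   e_1, ..., e_n and of W; uniqueness of the coefficients forces e_i <> 0. *)
Definition direct_sum n (e : 'I_n -> V) (W U : set V) : Prop :=
  [/\ forall i, U (e i), W `<=` U &
      forall v, U v -> exists! p : 'rV[R]_n * V,
        W p.2 /\ v = \sum_i p.1 ord0 i *: e i + p.2].

Definition has_codim (W U : set V) (d : nat) : Prop :=
  exists e : 'I_d -> V, direct_sum e W U.

Definition has_dim (U : set V) (d : nat) : Prop := has_codim [set 0] U d.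

(* This determines P when V is the direct sum of U and W. *)
Definition projection_along (U W : set V) (P : V -> V) : Prop :=
  forall u w, U u -> W w -> P (u + w) = u.

End Subspaces.

Section Fredholm.
Context {R : realType} {E F : normedModType R}.

Definition kernel_on (U : set E) (L : E -> F) : set E :=
  [set u | U u /\ L u = 0].

(* L restricts to a Fredholm operator from the subspace U to the subspace V,
   of index k. *)
Definition fredholm (U : set E) (V : set F) (L : E -> F) (k : int) : Prop :=
  [/\ forall (a : R) u v, U u -> U v -> L (a *: u + v) = a *: L u + L v,
      {within U, continuous L},
      L @` U `<=` V,
      closed (L @` U) &
      exists d d' : nat, [/\ has_dim (kernel_on U L) d,
        has_codim (L @` U) V d' & k = d%:Z - d'%:Z]].

End Fredholm.

Section PartialDerivatives.
Context {R : realType} {X Y : normedModType R} {n : nat}.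
Implicit Types (F : X * 'rV[R]_n -> Y) (x u : X) (c : 'rV[R]_n) (j : 'I_n).

Definition D1 F x c : X -> Y := 'd (fun x' : X => F (x', c)) x.

(* D_{j+1} F [x, c], as a linear map of the scalar increment of c_j. *)
Definition Dparam F j x c : R -> Y :=
  'd (fun r : R => F (x, \row_l (if l == j then r else c ord0 l))) (c ord0 j).

Definition D1Dparam F j x c u (t : R) : Y :=
  'd (fun x' : X => Dparam F j x' c t) x u.

End PartialDerivatives.

Definition eucl_norm {R : realType} {n : nat} (s : 'rV[R]_n) : R :=
  Num.sqrt (\sum_i s ord0 i ^+ 2).

(* Main.v *)
Require Import Defs.
From HB Require Import structures.
From mathcomp Require Import all_boot all_order all_algebra.
From mathcomp Require Import all_classical all_reals all_analysis.
From mathcomp Require Import zify ring lra.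

Set Implicit Arguments.
Unset Strict Implicit.
Unset Printing Implicit Defensive.
Import Order.TTheory GRing.Theory Num.Theory.
Import numFieldNormedType.Exports.
Local Open Scope classical_set_scope.
Local Open Scope ring_scope.

(* Lyapunov-Schmidt reduction followed by division.  Since D_1 F [0, cs] has
   index 0, its range is exactly Yt, so Y splits as y = sum_i lam_i(y) y_i + L(T y)
   with L = D_1 F [0, cs] and T a bounded right inverse into Xt (open mapping
   theorem).  Writing x = sum_i s_i x_i + T y and c = cs + g, the range component
   of the equation is y = y - L(T(F[x, c])), a half contraction in y near 0, which
   gives y = psi(s, g) of the same class as F.  What remains are the n scalar
   equations f_i(s, g) = lam_i(F[x, c]) = 0.  By (iv) the contraction preserves
   Yt_i when s_i = 0, so f_i vanishes on the hyperplane s_i = 0 and Hadamard's lemma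
   gives f_i = s_i g_i at the cost of one derivative.  The map (g_1, ..., g_n)
   vanishes at 0 and its derivative in g at 0 is the matrix nu of (iii), so the
   implicit function theorem yields g = g(s). *)

(** * Module identities by reflection *)

(** Both implicit steps, for [psi] and for g, are written as y = N (h, y) with D_y N (0) = 0;
    continuity of the derivative makes such an N a half contraction in y near 0, so one parametrized
    fixed-point theorem serves twice. The smoothness classes enter through composition, fixed points
    and Hadamard division, each treated by induction on m for C^m, uniformly in the target spaces,
    and by majorized power series for analytic maps. Two obstacles shape the end. When k = 2 the
    quotients g_i are only C^1, so D g_i (0) cannot be computed by differentiating the quotient
    further: f_i = s_i g_i is differentiated in a parameter direction along the line t e_i, which
    gives t D g_i, and the result is divided by t as t tends to 0. Secondly, (iv) concerns subspaces
    whereas [psi] is nonlinear: [psi] is a limit of iterates started at 0, and these stay in Yt_i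
    because index zero of the restricted operator forces T to map Yt_i into the matching subspace of
    Xt. *)

Inductive lmexpr (K V : Type) : Type :=
  | LMzero | LMvar of nat | LMadd of lmexpr K V & lmexpr K V
  | LMopp of lmexpr K V | LMscale of K & lmexpr K V.
Arguments LMzero {K V}.
Arguments LMvar {K V}.

Section LmodReflection.
Context {K : pzRingType} {V : lmodType K}.

Fixpoint lmeval (e : seq V) (t : lmexpr K V) : V :=
  match t with
  | LMzero => 0
  | LMvar i => nth 0 e i
  | LMadd a b => lmeval e a + lmeval e b
  | LMopp a => - lmeval e a
  | LMscale k a => k *: lmeval e a
  end.

(** [eqn] in place of [==] lets [cbn] reduce each coefficient to a plain ring expression. *)
Fixpoint lmcoef (t : lmexpr K V) (i : nat) : K :=
  match t with
  | LMzero => 0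
  | LMvar j => if eqn i j then 1 else 0
  | LMadd a b => lmcoef a i + lmcoef b i
  | LMopp a => - lmcoef a i
  | LMscale k a => k * lmcoef a i
  end.

Lemma lmevalE e t : lmeval e t = \sum_(i < size e) lmcoef t i *: nth 0 e i.
Proof.
elim: t => [|j|a IHa b IHb|a IHa|k a IHa] /=.
- by rewrite big1 // => i _; rewrite scale0r.
- have [je|ej] := ltnP j (size e); last first.
    rewrite nth_default // big1 // => i _; rewrite -[eqn _ _]/(_ == _).
    by rewrite ltn_eqF ?scale0r // (leq_trans (ltn_ord i)).
  rewrite (bigD1 (Ordinal je)) //= -[eqn j j]/(j == j) eqxx scale1r big1 ?addr0 // => i.
  by rewrite -val_eqE /= -[eqn _ _]/(_ == _) => /negPf ->; rewrite scale0r.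
- by rewrite IHa IHb -big_split; apply: eq_bigr => i _; rewrite scalerDl.
- by rewrite IHa -sumrN; apply: eq_bigr => i _; rewrite scaleNr.
- by rewrite IHa scaler_sumr; apply: eq_bigr => i _; rewrite scalerA.
Qed.

Fixpoint lmcheck (t t' : lmexpr K V) (n : nat) : Prop :=
  if n is m.+1 then lmcoef t m = lmcoef t' m /\ lmcheck t t' m else True.

(** Equal coefficients give equal linear combinations, so a module identity splits into one scalar
    identity per atom, within reach of [field] and [ring]. *)
Lemma lmcheckP e t t' : lmcheck t t' (size e) -> lmeval e t = lmeval e t'.
Proof.
rewrite !lmevalE => tt'; apply: eq_bigr => i _; congr (_ *: _).
elim: (size e) tt' (i : nat) (ltn_ord i) => // n IH [tn /IH {}IH] j.
by rewrite ltnS leq_eqVlt => /orP[/eqP ->|/IH].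
Qed.
End LmodReflection.

(** The [match goal] wrapper runs [unify] while a term is being built: if it fails, the search goes
    on with the tail of the list. Atoms are thus identified up to conversion. *)
Ltac lm_index x l :=
  match l with
  | ?y :: ?l' => let _ := match goal with _ => unify x y end in constr:(0%N)
  | _ :: ?l' => let i := lm_index x l' in constr:(i.+1)
  end.

Ltac lm_atoms t l :=
  match t with
  | (?a + ?b)%R => let l1 := lm_atoms a l in lm_atoms b l1
  | (- ?a)%R => lm_atoms a l
  | (?k *: ?a)%R => lm_atoms a l
  | 0%R => l
  | _ => let _ := match goal with _ => let i := lm_index t l in idtac end in l
  | _ => constr:(t :: l)
  end.

Ltac lm_reify K V t l :=
  match t with
  | (?a + ?b)%R => let a' := lm_reify K V a l in let b' := lm_reify K V b l in
      constr:(@LMadd K V a' b')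
  | (- ?a)%R => let a' := lm_reify K V a l in constr:(@LMopp K V a')
  | (?k *: ?a)%R => let a' := lm_reify K V a l in constr:(@LMscale K V k a')
  | 0%R => constr:(@LMzero K V)
  | _ => let i := lm_index t l in constr:(@LMvar K V i)
  end.

Ltac lmod K V :=
  match goal with |- @eq _ ?x ?y =>
    let l0 := lm_atoms x (@nil V) in
    let l := lm_atoms y l0 in
    let x' := lm_reify K V x l in
    let y' := lm_reify K V y l in
    refine (@lmcheckP K V l x' y' _);
    cbn [lmcheck lmcoef size eqn]; repeat split; try (by field); try (by ring)
  end.

Lemma mulr_div_le (R : realFieldType) (a e K : R) : 0 <= e -> 0 < K -> a <= K ->
  a * (e / K) <= e.
Proof. by move=> e0 K0 aK; rewrite mulrA ler_pdivrMr // mulrC ler_wpM2l. Qed.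

(** * Bounded linear maps *)

Section BlinToolkit.
Context {R : realType}.
Implicit Types E F G W : normedModType R.

Lemma blinD E F (f : blin E F) u v : f (u + v) = f u + f v.
Proof. by have := blin_linear f 1 u v; rewrite !scale1r. Qed.

Lemma blin0 E F (f : blin E F) : f 0 = 0.
Proof. by rewrite -[0 in LHS](scale0r (0 : E)) blinZ scale0r. Qed.

Lemma blinN E F (f : blin E F) u : f (- u) = - f u.
Proof. by rewrite -scaleN1r blinZ scaleN1r. Qed.

Lemma blinB E F (f : blin E F) u v : f (u - v) = f u - f v.
Proof. by rewrite blinD blinN. Qed.

Lemma blin_sum E F (f : blin E F) (I : Type) (r : seq I) (P : pred I) (u : I -> E) :
  f (\sum_(i <- r | P i) u i) = \sum_(i <- r | P i) f (u i).
Proof. by elim/big_rec2: _ => [|i y x _ <-]; rewrite ?blin0 ?blinD. Qed.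

Lemma blin_addE E F (f g : blin E F) u : (f + g) u = f u + g u.
Proof. by []. Qed.

Lemma blin_oppE E F (f : blin E F) u : (- f) u = - f u.
Proof. by []. Qed.

Lemma blin_subE E F (f g : blin E F) u : (f - g) u = f u - g u.
Proof. by []. Qed.

Lemma blin_scaleE E F a (f : blin E F) u : (a *: f) u = a *: f u.
Proof. by []. Qed.

Lemma blin_zeroE E F u : (0 : blin E F) u = 0.
Proof. by []. Qed.

Lemma blin_sumE E F (I : Type) (r : seq I) (P : pred I) (f : I -> blin E F) u :
  (\sum_(i <- r | P i) f i) u = \sum_(i <- r | P i) f i u.
Proof. by elim/big_rec2: _ => [|i y x _ <-]. Qed.

Lemma blin_ext E F (f g : blin E F) : (forall u, f u = g u) -> f = g.
Proof. by move=> fg; apply/val_inj/funext. Qed.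

Lemma blin_le E F (f : blin E F) u : `|f u| <= `|f| * `|u|.
Proof. exact: opnormP. Qed.

Lemma blin_norm_le E F (f : blin E F) C :
  0 <= C -> (forall u, `|f u| <= C * `|u|) -> `|f| <= C.
Proof.
move=> C0 fC; apply: opnorm_lub => u u1; apply: le_trans (fC u) _.
by rewrite -[leRHS]mulr1 ler_wpM2l.
Qed.

Lemma mkblin_subproof E F (f : E -> F) (C : R) : linear f ->
  (forall u, `|f u| <= C * `|u|) -> f \in @blin_pred R E F.
Proof.
move=> lf bf; rewrite inE; split=> //.
pose g : {linear E -> F} := HB.pack f (GRing.isLinear.Build _ _ _ _ _ lf).
change (continuous g); apply/linear_bounded_continuous/bounded_funP => r.
exists (`|C| * r) => x xr; apply: le_trans (bf x) _.
by apply: le_trans (ler_wpM2r (normr_ge0 _) (ler_norm C)) _; rewrite ler_wpM2l.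
Qed.

Definition mkblin E F (f : E -> F) (C : R) (lf : linear f)
  (bf : forall u, `|f u| <= C * `|u|) : blin E F := Blin (mkblin_subproof lf bf).

Lemma idb_bound E (u : E) : `|idfun u| <= 1 * `|u|.
Proof. by rewrite mul1r. Qed.

Lemma idb_linear E : linear (@idfun E).
Proof. by []. Qed.

Definition idb E : blin E E := mkblin (@idb_linear E) (@idb_bound E).

Lemma compb_linear E F G (g : blin F G) (f : blin E F) : linear (g \o f).
Proof. by move=> a u v /=; rewrite blin_linear blin_linear. Qed.

Lemma compb_bound E F G (g : blin F G) (f : blin E F) u :
  `|(g \o f) u| <= `|g| * `|f| * `|u|.
Proof.
rewrite -mulrA (le_trans (blin_le _ _)) // ler_wpM2l // blin_le //.
Qed.

Definition compb E F G (g : blin F G) (f : blin E F) : blin E G :=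
  mkblin (compb_linear g f) (compb_bound g f).

Lemma compbE E F G (g : blin F G) (f : blin E F) u : compb g f u = g (f u).
Proof. by []. Qed.

Lemma compb_norm E F G (g : blin F G) (f : blin E F) :
  `|compb g f| <= `|g| * `|f|.
Proof.
by apply: blin_norm_le => [|u]; [rewrite mulr_ge0|exact: compb_bound].
Qed.

Lemma compL_linear1 E F G (g : blin F G) : linear (compb (E := E) g).
Proof. by move=> a f f'; apply: blin_ext => u /=; rewrite blin_linear. Qed.

Definition postb E F G (g : blin F G) : blin (blin E F) (blin E G) :=
  mkblin (@compL_linear1 E F G g) (compb_norm g).

Lemma postb_linear E F G : linear (@postb E F G).
Proof. by move=> a g g'; apply: blin_ext => f; apply: blin_ext. Qed.

Lemma postb_bound E F G (g : blin F G) : `|@postb E F G g| <= 1 * `|g|.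
Proof. by rewrite mul1r; apply: blin_norm_le => // f; exact: compb_norm. Qed.

(** Composition as a curried bounded bilinear map. With [evb] and [flipL] it turns every product
    rule into a case of evaluation [f x (g x)]. *)
Definition compL E F G : blin (blin F G) (blin (blin E F) (blin E G)) :=
  mkblin (@postb_linear E F G) (@postb_bound E F G).

Lemma evb_linear E F (y : E) : linear (fun f : blin E F => f y).
Proof. by []. Qed.

Lemma evb_bound E F (y : E) (f : blin E F) : `|f y| <= `|y| * `|f|.
Proof. by rewrite mulrC blin_le. Qed.

Definition evb E F (y : E) : blin (blin E F) F :=
  mkblin (@evb_linear E F y) (@evb_bound E F y).

Definition flipb E F G (A : blin E (blin F G)) (y : F) : blin E G :=
  compb (evb G y) A.

Lemma flipbE E F G (A : blin E (blin F G)) x y : flipb A y x = A x y.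
Proof. by []. Qed.

Lemma flipb_bound E F G (A : blin E (blin F G)) y : `|flipb A y| <= `|A| * `|y|.
Proof.
apply: blin_norm_le => [|x]; first by rewrite mulr_ge0.
rewrite /= (le_trans (blin_le _ _)) // mulrAC ler_wpM2r //; exact: blin_le.
Qed.

Lemma flipb_linear E F G (A : blin E (blin F G)) : linear (flipb A).
Proof. by move=> a y y'; apply: blin_ext => x /=; rewrite blin_linear. Qed.

Definition flip1 E F G (A : blin E (blin F G)) : blin F (blin E G) :=
  mkblin (flipb_linear A) (flipb_bound A).

Lemma flip1_linear E F G : linear (@flip1 E F G).
Proof. by move=> a A A'; apply: blin_ext => y; apply: blin_ext => x. Qed.

Lemma flip1_bound E F G (A : blin E (blin F G)) : `|flip1 A| <= 1 * `|A|.
Proof. by rewrite mul1r; apply: blin_norm_le => // y; exact: flipb_bound. Qed.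

Definition flipL E F G : blin (blin E (blin F G)) (blin F (blin E G)) :=
  mkblin (@flip1_linear E F G) (@flip1_bound E F G).

Lemma fstb_linear E F : linear (@fst E F).
Proof. by []. Qed.
Lemma fstb_bound E F (p : E * F) : `|p.1| <= 1 * `|p|.
Proof. by rewrite mul1r prod_normE le_max lexx. Qed.
Definition fstb E F : blin (E * F)%type E := mkblin (@fstb_linear E F) (@fstb_bound E F).

Lemma sndb_linear E F : linear (@snd E F).
Proof. by []. Qed.
Lemma sndb_bound E F (p : E * F) : `|p.2| <= 1 * `|p|.
Proof. by rewrite mul1r prod_normE le_max lexx orbT. Qed.
Definition sndb E F : blin (E * F)%type F := mkblin (@sndb_linear E F) (@sndb_bound E F).

Lemma inlb_linear E F : linear (fun x : E => (x, 0 : F)).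
Proof.
move=> a x y; transitivity (a *: x + y, a *: (0 : F) + 0) => //.
by rewrite scaler0 addr0.
Qed.
Lemma inlb_bound E F (x : E) : `|(x, 0 : F)| <= 1 * `|x|.
Proof. by rewrite mul1r prod_normE /= normr0 ge_max lexx normr_ge0. Qed.
Definition inlb E F : blin E (E * F)%type := mkblin (@inlb_linear E F) (@inlb_bound E F).

Lemma inrb_linear E F : linear (fun y : F => (0 : E, y)).
Proof.
move=> a x y; transitivity (a *: (0 : E) + 0, a *: x + y) => //.
by rewrite scaler0 addr0.
Qed.
Lemma inrb_bound E F (y : F) : `|(0 : E, y)| <= 1 * `|y|.
Proof. by rewrite mul1r prod_normE /= normr0 ge_max lexx normr_ge0. Qed.
Definition inrb E F : blin F (E * F)%type := mkblin (@inrb_linear E F) (@inrb_bound E F).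

Lemma pairE E F (x : E) (y : F) : (x, y) = inlb E F x + inrb E F y.
Proof. by rewrite /= /GRing.add /=; congr pair; rewrite ?addr0 ?add0r. Qed.

Lemma norm_pair_le E F (x : E) (y : F) : `|(x, y)| <= `|x| + `|y|.
Proof. by rewrite prod_normE /= ge_max lerDl lerDr !normr_ge0. Qed.

Lemma norm_pair_lt E F (x : E) (y : F) r : (`|(x, y)| < r) = (`|x| < r) && (`|y| < r).
Proof. by rewrite prod_normE /= gt_max. Qed.

Definition seqlim E (u : nat -> E) (l : E) :=
  forall e : R, 0 < e -> exists N, forall n, (N <= n)%N -> `|u n - l| <= e.

Definition seqcauchy E (u : nat -> E) :=
  forall e : R, 0 < e -> exists N, forall p q, (N <= p)%N -> (N <= q)%N -> `|u p - u q| <= e.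

(** Completeness as a property of a normed space: it is inherited by the iterated spaces [blin] and
    [mlin] and by products, where derivatives and Taylor coefficients live. *)
Definition banach E := forall u : nat -> E, seqcauchy u -> exists l, seqlim u l.

Lemma seqlimP E (u : nat -> E) l : seqlim u l <-> u @ \oo --> l.
Proof.
split=> [ul|/cvgrPdist_le ul e e0].
  apply/cvgrPdist_le => e e0; have [N uN] := ul e e0.
  by exists N => // n /= Nn; rewrite distrC; exact: uN.
have [N _ uN] := ul e e0; exists N => n Nn; rewrite distrC; exact: uN.
Qed.

Lemma complete_banach (E : completeNormedModType R) : banach E.
Proof.
move=> u uC; have : cvgn u.
  apply/cauchy_cvgP/cauchy_exP => /= e e0.
  have e20 : 0 < e / 2 by rewrite divr_gt0.
  have [N uN] := uC (e/2) e20.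
  exists (u N); exists N => // n /= Nn; rewrite -ball_normE /=.
  by apply: (le_lt_trans (uN _ _ (leqnn _) Nn)); lra.
by move=> uc; exists (lim (u @ \oo)); apply/seqlimP.
Qed.

Lemma seqlim_le E (u : nat -> E) l c M : seqlim u l ->
  (exists N, forall n, (N <= n)%N -> `|u n - c| <= M) -> `|l - c| <= M.
Proof.
move=> ul [N uM]; apply/ler_addgt0Pr => /= e e0.
have [N' uN] := ul e e0; pose n := maxn N N'.
have -> : l - c = (u n - c) - (u n - l) by lmod R E.
rewrite (le_trans (ler_normB _ _)) // lerD //.
  by apply: uM; rewrite leq_maxl.
by apply: uN; rewrite leq_maxr.
Qed.

Lemma seqlim_unique E (u : nat -> E) l l' : seqlim u l -> seqlim u l' -> l = l'.
Proof.
move=> ul ul'; apply/eqP; rewrite -subr_eq0 -normr_le0.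
apply/ler_addgt0Pr => /= e e0; rewrite add0r.
by apply: seqlim_le ul _; exact: ul'.
Qed.

Lemma seqlimD E (u v : nat -> E) l m : seqlim u l -> seqlim v m ->
  seqlim (fun n => u n + v n) (l + m).
Proof. by move=> /seqlimP ul /seqlimP vm; apply/seqlimP; exact: cvgD. Qed.

Lemma seqlim_blin E F (f : blin E F) (u : nat -> E) l : seqlim u l ->
  seqlim (fun n => f (u n)) (f l).
Proof.
move=> /seqlimP ul; apply/seqlimP.
by apply: continuous_cvg => //; exact: blin_continuous.
Qed.

Lemma seqlimZ E a (u : nat -> E) l : seqlim u l ->
  seqlim (fun n => a *: u n) (a *: l).
Proof. by move=> /seqlimP ul; apply/seqlimP; exact: cvgZr. Qed.

Lemma banach_blin E F : banach F -> banach (blin E F).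
Proof.
move=> bF u uC.
have uCx x : seqcauchy (fun n => u n x).
  move=> e e0; have x0 : 0 < `|x| + 1 by rewrite ltr_wpDl.
  have [N uN] := uC (e / (`|x| + 1)) (divr_gt0 e0 x0).
  exists N => p q Np Nq; rewrite -blin_subE (le_trans (blin_le _ _)) //.
  rewrite (le_trans (ler_wpM2r (normr_ge0 _) (uN _ _ Np Nq))) //.
  by rewrite -mulrA ler_piMr ?(ltW e0) // mulrC ler_pdivrMr // mul1r lerDl.
have [g gP] : {g : E -> F & forall x, seqlim (fun n => u n x) (g x)}.
  exact: (@choice _ _ (fun x l => seqlim (fun n => u n x) l) (fun x => bF _ (uCx x))).
have lg : linear g.
  move=> a x y; apply: (seqlim_unique (gP _)).
  have -> : (fun n => u n (a *: x + y)) = (fun n => a *: u n x + u n y).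
    by apply/funext => n; rewrite blin_linear.
  by apply: seqlimD => //; exact: seqlimZ.
have gle e : 0 < e -> exists N, forall n, (N <= n)%N -> forall x, `|u n x - g x| <= e * `|x|.
  move=> e0; have [N uN] := uC e e0; exists N => n Nn x.
  rewrite distrC; apply: seqlim_le (gP x) _; exists N => p Np.
  by rewrite -blin_subE (le_trans (blin_le _ _)) // ler_wpM2r // uN.
have [N1 uN1] := gle 1 ltr01.
have bg x : `|g x| <= (`|u N1| + 1) * `|x|.
  have -> : g x = u N1 x - (u N1 x - g x) by rewrite opprB addrCA subrr addr0.
  rewrite mulrDl (le_trans (ler_normB _ _)) // lerD ?blin_le //; exact: uN1.
exists (mkblin lg bg) => e e0; have [N uN] := gle e e0.
by exists N => n Nn; apply: blin_norm_le (ltW e0) _ => x; exact: uN.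
Qed.

Lemma summable_cauchy E (u : nat -> E) M :
  (forall n, \sum_(i < n) `|u i| <= M) -> seqcauchy (fun n => \sum_(i < n) u i).
Proof.
move=> uM e e0.
pose s n := \sum_(i < n) `|u i|.
have sm : {homo s : m n / (m <= n)%N >-> m <= n}.
  by apply: homo_leq => // [y x z|n]; [exact: le_trans|rewrite /s big_ord_recr lerDl].
have : cvgn s.
  by apply: nondecreasing_is_cvgn => //; exists M => _ [n _ <-]; exact: uM.
move=> /seqlimP sl; have e20 : 0 < e / 2 by rewrite divr_gt0.
have [N sN] := sl _ e20.
have H p q : (N <= p)%N -> (p <= q)%N -> `|\sum_(i < q) u i - \sum_(i < p) u i| <= e.
  move=> Np pq; have Nq := leq_trans Np pq; move: Nq; rewrite -(subnKC pq).
  move: (q - p)%N => d Nq; rewrite big_split_ord /= addrAC subrr add0r.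
  rewrite (le_trans (ler_norm_sum _ _ _)) //.
  have -> : \sum_(i < d) `|u (p + i)%N| = s (p + d)%N - s p.
    by rewrite /s big_split_ord /= addrAC subrr add0r.
  have := sN _ Np; have := sN _ Nq.
  rewrite !ler_norml => /andP[_ h1] /andP[h2 _]; lra.
exists N => p q Np Nq; have [pq|/ltnW qp] := leqP p q; last exact: H.
by rewrite distrC; exact: H.
Qed.

Lemma banach_summable E : banach E -> forall (u : nat -> E) M,
  (forall n, \sum_(i < n) `|u i| <= M) ->
  exists l, seqlim (fun n => \sum_(i < n) u i) l.
Proof. by move=> bE u M uM; apply: bE; exact: summable_cauchy uM. Qed.

End BlinToolkit.

(** * Differential calculus of class C^k *)

Section FrechetDerivative.
Context {R : realType}.
Implicit Types E F G W : normedModType R.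

(** The Fréchet derivative with explicit epsilon and delta and a bounded linear [L]; [fder_diff] and
    [diff_fder] translate to and from [differentiable] and ['d]. *)
Definition fder E F (f : E -> F) (u : E) (L : blin E F) :=
  forall e : R, 0 < e -> exists2 d : R, 0 < d &
    forall k, `|k| < d -> `|f (u + k) - f u - L k| <= e * `|k|.

Definition econt E F (f : E -> F) (u : E) :=
  forall e : R, 0 < e -> exists2 d : R, 0 < d &
    forall k, `|k| < d -> `|f (u + k) - f u| <= e.

Lemma econtP E F (f : E -> F) u : econt f u <-> {for u, continuous f}.
Proof.
split=> [fu|/cvgrPdist_le fu e e0].
  apply/cvgrPdist_le => e e0; have [d d0 fd] := fu e e0.
  apply/nbhs_ballP; exists d => // v; rewrite -ball_normE /= => uv.
  rewrite distrC; have -> : v = u + (v - u) by rewrite addrC subrK.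
  by apply: fd; rewrite distrC.
have /nbhs_ballP[d d0 fd] := fu e e0; exists d => // k kd.
by rewrite distrC; apply: fd; rewrite -ball_normE /= opprD addNKr normrN.
Qed.

Lemma near0P E (P : set E) : (\forall k \near (0 : E), P k) <->
  exists2 d : R, 0 < d & forall k, `|k| < d -> P k.
Proof.
split=> [/nbhs_ballP[d d0 Pd]|[d d0 Pd]].
  by exists d => // k kd; apply: Pd; rewrite -ball_normE /= sub0r normrN.
by apply/nbhs_ballP; exists d => // k; rewrite -ball_normE /= sub0r normrN => /Pd.
Qed.

Lemma fder_diff E F (f : E -> F) u L : fder f u L ->
  differentiable f u /\ 'd f u = L :> (E -> F).
Proof.
move=> fL.
pose g : {linear E -> F} :=
  HB.pack (L : E -> F) (GRing.isLinear.Build _ _ _ _ _ (blin_linear L)).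
have gc : continuous g by exact: blin_continuous.
have fg : f \o shift u = cst (f u) + g +o_ (0 : E) id.
  apply/eqaddoP => e e0; apply/near0P; have [d d0 fd] := fL e e0.
  exists d => // k kd; have := fd k kd.
  by rewrite !fctE /= [k + u]addrC opprD addrA.
have dg := diff_unique gc fg; split=> //.
by apply/diff_locallyP; rewrite dg.
Qed.

Lemma diff_fder E F (f : E -> F) u (L : blin E F) : differentiable f u ->
  'd f u = L :> (E -> F) -> fder f u L.
Proof.
move=> /diff_locally + dL e e0; rewrite dL => /eqaddoP/(_ e e0)/near0P[d d0 fd].
by exists d => // k kd; have := fd k kd; rewrite !fctE /= [k + u]addrC opprD addrA.
Qed.

Lemma fder_unique E F (f : E -> F) u L L' : fder f u L -> fder f u L' -> L = L'.
Proof.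
move=> /fder_diff[_ fL] /fder_diff[_ fL']; apply: blin_ext => x.
by rewrite -[LHS]/((L : E -> F) x) -fL fL'.
Qed.

Lemma fder_lip E F (f : E -> F) u L : fder f u L ->
  exists2 d : R, 0 < d & forall k, `|k| < d -> `|f (u + k) - f u| <= (`|L| + 1) * `|k|.
Proof.
move=> fL; have [d d0 fd] := fL 1 ltr01; exists d => // k kd.
have -> : f (u + k) - f u = (f (u + k) - f u - L k) + L k by rewrite subrK.
rewrite mulrDl [leRHS]addrC (le_trans (ler_normD _ _)) // lerD //.
  exact: fd.
exact: blin_le.
Qed.

Lemma lip_econt E F (f : E -> F) u C d : 0 <= C -> 0 < d ->
  (forall k, `|k| < d -> `|f (u + k) - f u| <= C * `|k|) -> econt f u.
Proof.
move=> C0 d0 fd e e0; have C1 : 0 < C + 1 by rewrite ltr_wpDl.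
exists (Num.min d (e / (C + 1))); first by rewrite lt_min d0 divr_gt0.
move=> k; rewrite lt_min => /andP[kd]; rewrite ltr_pdivlMr // => /ltW ke.
apply: le_trans (fd k kd) _; apply: le_trans ke.
by rewrite mulrDr mulr1 mulrC lerDl.
Qed.

Lemma fder_econt E F (f : E -> F) u L : fder f u L -> econt f u.
Proof. by move=> /fder_lip[d d0 fd]; apply: (lip_econt _ d0 fd); rewrite addr_ge0. Qed.

Lemma econt_comp E F G (g : F -> G) (f : E -> F) u :
  econt f u -> econt g (f u) -> econt (g \o f) u.
Proof.
move=> fu gu e e0; have [d d0 gd] := gu e e0.
have d20 : 0 < d / 2 by rewrite divr_gt0.
have [d' d'0 fd] := fu _ d20; exists d' => // k /fd kd /=.
rewrite -[f (u + k)](subrK (f u)) [_ + f u]addrC.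
by apply: gd; apply: le_lt_trans kd _; lra.
Qed.

Lemma fder_ext E F (f g : E -> F) u L d : 0 < d ->
  (forall k, `|k| < d -> f (u + k) = g (u + k)) -> fder f u L -> fder g u L.
Proof.
move=> d0 fg fL e e0; have [d' d'0 fd] := fL e e0.
exists (Num.min d d'); first by rewrite lt_min d0.
move=> k; rewrite lt_min => /andP[kd kd']; rewrite -fg // -[in g u](addr0 u) -fg ?normr0 //.
by rewrite addr0; exact: fd.
Qed.

Lemma fder_cst E F (c : F) (u : E) : fder (fun=> c) u 0.
Proof. by move=> e e0; exists 1 => // k _; rewrite blin_zeroE subrr subr0 normr0 mulr_ge0 // ltW. Qed.

Lemma fder_blin E F (L : blin E F) u : fder L u L.
Proof.
move=> e e0; exists 1 => // k _; rewrite blinD [L u + _]addrC addrK subrr normr0.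
by rewrite mulr_ge0 // ltW.
Qed.

Lemma fderD E F (f g : E -> F) u L M : fder f u L -> fder g u M ->
  fder (fun x => f x + g x) u (L + M).
Proof.
move=> fL gM e e0; have e20 : 0 < e / 2 by rewrite divr_gt0.
have [d d0 fd] := fL _ e20; have [d' d'0 gd] := gM _ e20.
exists (Num.min d d'); first by rewrite lt_min d0.
move=> k; rewrite lt_min => /andP[kd kd'].
have -> : f (u + k) + g (u + k) - (f u + g u) - (L + M) k =
   (f (u + k) - f u - L k) + (g (u + k) - g u - M k).
  by rewrite blin_addE; lmod R F.
rewrite (le_trans (ler_normD _ _)) // [e]splitr mulrDl lerD //; [exact: fd|exact: gd].
Qed.

Lemma fder_comp E F G (g : F -> G) (f : E -> F) u L M :
  fder f u L -> fder g (f u) M -> fder (g \o f) u (compb M L).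
Proof.
move=> fL gM e e0.
have [d1 d10 f1] := fder_lip fL.
pose C := `|L| + 1; have C0 : 0 < C by rewrite ltr_wpDl.
have e1 : 0 < e / 2 / C by rewrite !divr_gt0.
have M0 : 0 < `|M| + 1 by rewrite ltr_wpDl.
have e2 : 0 < e / 2 / (`|M| + 1) by rewrite !divr_gt0.
have [d2 d20 g2] := gM _ e1; have [d3 d30 f3] := fL _ e2.
exists (Num.min d1 (Num.min d3 (d2 / C))).
  by rewrite !lt_min d10 d30 divr_gt0.
move=> k; rewrite !lt_min => /and3P[kd1 kd3]; rewrite ltr_pdivlMr // => kd2.
have fk := f1 k kd1; have fk3 := f3 k kd3.
set w := f (u + k) - f u in fk fk3.
have -> : (g \o f) (u + k) - (g \o f) u - compb M L k =
   (g (f u + w) - g (f u) - M w) + M (w - L k).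
  have -> : f u + w = f (u + k) by rewrite addrC subrK.
  by rewrite [M (w - _)]blinB compbE /=; lmod R G.
rewrite (le_trans (ler_normD _ _)) // [e in leRHS]splitr mulrDl lerD //.
  apply: le_trans (g2 w _) _; first by rewrite (le_lt_trans fk) // mulrC.
  by apply: le_trans (ler_wpM2l (ltW e1) fk) _; rewrite mulrA mulfVK // gt_eqF.
apply: le_trans (blin_le _ _) _.
apply: le_trans (ler_wpM2l _ fk3) _ => //.
by rewrite mulrA ler_wpM2r // mulr_div_le ?lerDl // divr_ge0 // ltW.
Qed.

Lemma fder_post E F G (T : blin F G) (f : E -> F) u L :
  fder f u L -> fder (fun x => T (f x)) u (compb T L).
Proof. by move=> fL; apply: (fder_comp fL (fder_blin T (f u))). Qed.

Lemma econtW E F (f : E -> F) u : econt f u -> exists2 d, 0 < d &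
  forall k, `|k| < d -> `|f (u + k)| <= `|f u| + 1.
Proof.
move=> fu; have [d d0 fd] := fu 1 ltr01; exists d => // k kd.
by rewrite -[f (u + k)](subrK (f u)) addrC (le_trans (ler_normD _ _)) // lerD // fd.
Qed.

Lemma fder_eval E X W (f : E -> blin X W) (g : E -> X) u L M :
  fder f u L -> fder g u M ->
  fder (fun x => f x (g x)) u (flipb L (g u) + compb (f u) M).
Proof.
move=> fL gM e e0.
have [d1 d10 g1] := econtW (fder_econt gM).
set C := `|g u| + 1 in g1; have C0 : 0 < C by rewrite ltr_wpDl.
set D := `|L| + 1; have D0 : 0 < D by rewrite ltr_wpDl.
set K := `|f u| + 1; have K0 : 0 < K by rewrite ltr_wpDl.
have e30 : 0 < e / 3 by rewrite divr_gt0.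
have e1 : 0 < e / 3 / C by rewrite !divr_gt0.
have e2 : 0 < e / 3 / D by rewrite !divr_gt0.
have e3 : 0 < e / 3 / K by rewrite !divr_gt0.
have [d2 d20 f2] := fL _ e1; have [d3 d30 g3] := fder_econt gM e2.
have [d4 d40 g4] := gM _ e3.
exists (Num.min (Num.min d1 d2) (Num.min d3 d4)).
  by rewrite !lt_min d10 d20 d30 d40.
move=> k; rewrite !lt_min => /andP[/andP[kd1 kd2] /andP[kd3 kd4]].
have -> : f (u + k) (g (u + k)) - f u (g u) - (flipb L (g u) + compb (f u) M) k =
   (f (u + k) - f u - L k) (g (u + k)) + (L k (g (u + k) - g u)
     + f u (g (u + k) - g u - M k)).
  by rewrite !blin_subE blin_addE compbE flipbE !blinB; lmod R W.
have -> : e * `|k| = e / 3 * `|k| + (e / 3 * `|k| + e / 3 * `|k|) by field.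
rewrite (le_trans (ler_normD _ _)) // lerD //.
  rewrite (le_trans (blin_le _ _)) //.
  apply: le_trans (ler_pM _ _ (f2 k kd2) (g1 k kd1)) _ => //.
  by rewrite mulrAC mulfVK // gt_eqF.
rewrite (le_trans (ler_normD _ _)) // lerD //.
  rewrite (le_trans (blin_le _ _)) //.
  apply: le_trans (ler_pM _ _ (blin_le L k) (g3 k kd3)) _ => //.
  by rewrite mulrAC ler_wpM2r // mulr_div_le ?ltW // ltrDl.
rewrite (le_trans (blin_le _ _)) //.
apply: le_trans (ler_wpM2l _ (g4 k kd4)) _ => //.
by rewrite mulrA ler_wpM2r // mulr_div_le ?ltW // ltrDl.
Qed.

End FrechetDerivative.

(** * Stability of C^m under linear maps, evaluation and composition *)

Section CkCalculus.
Context {R : realType}.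
Implicit Types E F G W : normedModType R.

Lemma CkSP m E F (U : set E) (f : E -> F) : Ck m.+1 U f <->
  exists2 df : E -> blin E F, forall u, U u -> fder f u (df u) & Ck m U df.
Proof.
split=> [[fd [df dfE df_Ck]]|[df dfE df_Ck]].
  by exists df => // u Uu; apply: diff_fder; [exact: fd|rewrite dfE].
split=> [u Uu|]; first by have [] := fder_diff (dfE u Uu).
by exists df => // u Uu; have [_ ->] := fder_diff (dfE u Uu).
Qed.

Lemma Ck_econt m E F (U : set E) (f : E -> F) u : Ck m U f -> U u -> econt f u.
Proof.
case: m => [fC Uu|m /CkSP[df dfE _] /dfE]; first exact/econtP/fC.
exact: fder_econt.
Qed.

Lemma econt_Ck E F (U : set E) (f : E -> F) : (forall u, U u -> econt f u) -> Ck 0 U f.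
Proof. by move=> fU u /fU /econtP. Qed.

Lemma CkW m E F (U : set E) (f : E -> F) : Ck m.+1 U f -> Ck m U f.
Proof.
elim: m F f => [|m IH] F f.
  by move=> fC; apply: econt_Ck => u; exact: Ck_econt fC.
by move=> /CkSP[df dfE df_Ck]; apply/CkSP; exists df => //; exact: IH.
Qed.

Lemma Ck_le m p E F (U : set E) (f : E -> F) : (p <= m)%N -> Ck m U f -> Ck p U f.
Proof. by move=> /subnKC <-; elim: (m - p)%N => [|d IH]; rewrite ?addn0 // addnS => /CkW. Qed.

Lemma Ck_sub m E F (U V : set E) (f : E -> F) : U `<=` V -> Ck m V f -> Ck m U f.
Proof.
move=> UV; elim: m F f => [|m IH] F f; first by move=> fV u /UV /fV.
by move=> /CkSP[df dfE df_Ck]; apply/CkSP; exists df; [move=> u /UV /dfE|exact: IH].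
Qed.

Definition eopen E (U : set E) := forall u, U u -> exists2 d : R, 0 < d &
  forall k, `|k| < d -> U (u + k).

Lemma eopen_ball0 E r : eopen [set v : E | `|v| < r].
Proof.
move=> v /= vr; exists (r - `|v|); first by rewrite subr_gt0.
move=> k kr /=; rewrite (le_lt_trans (ler_normD _ _)) //; lra.
Qed.

Lemma eopenT E : eopen [set: E].
Proof. by move=> u _; exists 1. Qed.

Lemma econt_ext E F (f g : E -> F) u d : 0 < d ->
  (forall k, `|k| < d -> f (u + k) = g (u + k)) -> econt f u -> econt g u.
Proof.
move=> d0 fg fL e e0; have [d' d'0 fd] := fL e e0.
exists (Num.min d d'); first by rewrite lt_min d0.
move=> k; rewrite lt_min => /andP[kd kd']; rewrite -fg // -[in g u](addr0 u) -fg ?normr0 //.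
by rewrite addr0; exact: fd.
Qed.

Lemma Ck_ext m E F (U : set E) (f g : E -> F) : eopen U ->
  (forall u, U u -> f u = g u) -> Ck m U f -> Ck m U g.
Proof.
move=> oU fg; have nfg u : U u -> exists2 d, 0 < d & forall k, `|k| < d -> f (u + k)
  = g (u + k).
  by move=> /oU[d d0 Ud]; exists d => // k /Ud /fg.
case: m => [fC|m /CkSP[df dfE df_Ck]].
  apply: econt_Ck => u Uu; have [d d0 ud] := nfg u Uu.
  by apply: (econt_ext d0 ud); exact: Ck_econt fC Uu.
apply/CkSP; exists df => // u Uu; have [d d0 ud] := nfg u Uu.
by apply: (fder_ext d0 ud); exact: dfE.
Qed.

Lemma Ck_cst m E F (U : set E) (c : F) : Ck m U (fun _ : E => c).
Proof.
elim: m F c => [|m IH] F c.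
  by apply: econt_Ck => u _; apply: fder_econt (fder_cst c u).
by apply/CkSP; exists (fun=> 0) => // u _; exact: fder_cst.
Qed.

Lemma Ck_blin m E F (U : set E) (L : blin E F) : Ck m U L.
Proof.
case: m => [|m]; first by apply: econt_Ck => u _; apply: fder_econt (fder_blin L u).
by apply/CkSP; exists (fun=> L); [move=> u _; exact: fder_blin|exact: Ck_cst].
Qed.

Lemma CkD m E F (U : set E) (f g : E -> F) : Ck m U f -> Ck m U g ->
  Ck m U (fun x => f x + g x).
Proof.
elim: m F f g => [|m IH] F f g.
  by move=> fC gC u Uu; apply: cvgD; [exact: fC|exact: gC].
move=> /CkSP[df dfE df_Ck] /CkSP[dg dgE dg_Ck]; apply/CkSP.
exists (fun x => df x + dg x); last exact: IH.
by move=> u Uu; apply: fderD; [exact: dfE|exact: dgE].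
Qed.

Lemma Ck_post m E F G (U : set E) (T : blin F G) (f : E -> F) : Ck m U f ->
  Ck m U (fun x => T (f x)).
Proof.
elim: m F G T f => [|m IH] F G T f.
  move=> fC; apply: econt_Ck => u Uu; apply: (@econt_comp _ _ _ _ T f).
    exact: Ck_econt fC Uu.
  exact: fder_econt (fder_blin T _).
move=> /CkSP[df dfE df_Ck]; apply/CkSP.
exists (fun x => postb E T (df x)); last exact: IH.
by move=> u Uu; apply: fder_post; exact: dfE.
Qed.

(** The derivative is a sum of two maps of the same form, [flipL] of [df] evaluated at [g] and
    [compL] of [f] evaluated at [dg], so the induction on m closes once the spaces are
    generalized. *)
Lemma Ck_eval m E X W (U : set E) (f : E -> blin X W) (g : E -> X) :
  Ck m U f -> Ck m U g -> Ck m U (fun x => f x (g x)).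
Proof.
elim: m X W f g => [|m IH] X W f g.
  move=> fC gC; apply: econt_Ck => u Uu e e0.
  have fu := Ck_econt fC Uu; have gu := Ck_econt gC Uu.
  have [d1 d10 g1] := econtW gu.
  set C := `|g u| + 1 in g1; have C0 : 0 < C by rewrite ltr_wpDl.
  set K := `|f u| + 1; have K0 : 0 < K by rewrite ltr_wpDl.
  have e20 : 0 < e / 2 by rewrite divr_gt0.
  have e1 : 0 < e / 2 / C by rewrite !divr_gt0.
  have e2 : 0 < e / 2 / K by rewrite !divr_gt0.
  have [d2 d20 f2] := fu _ e1; have [d3 d30 g3] := gu _ e2.
  exists (Num.min d1 (Num.min d2 d3)); first by rewrite !lt_min d10 d20 d30.
  move=> k; rewrite !lt_min => /and3P[kd1 kd2 kd3].
  have -> : f (u + k) (g (u + k)) - f u (g u) =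
     (f (u + k) - f u) (g (u + k)) + f u (g (u + k) - g u).
    by rewrite !blin_subE !blinB; lmod R W.
  rewrite (le_trans (ler_normD _ _)) // [e]splitr lerD //.
    rewrite (le_trans (blin_le _ _)) //.
    apply: le_trans (ler_pM _ _ (f2 k kd2) (g1 k kd1)) _ => //.
    by rewrite mulfVK // gt_eqF.
  rewrite (le_trans (blin_le _ _)) //.
  apply: le_trans (ler_wpM2l _ (g3 k kd3)) _ => //.
  by rewrite mulr_div_le ?ltW // ltrDl.
move=> fC gC; have [df dfE df_Ck] := (CkSP _ _ _).1 fC.
have [dg dgE dg_Ck] := (CkSP _ _ _).1 gC; apply/CkSP.
exists (fun x => flipL E X W (df x) (g x) + compL E X W (f x) (dg x)).
  by move=> u Uu; apply: fder_eval; [exact: dfE|exact: dgE].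
apply: CkD; apply: IH => //.
- exact: Ck_post.
- exact: CkW.
- by apply: Ck_post; exact: CkW.
Qed.

(** The derivative is the product of [dg (f x)] and [df x]: the first factor is C^m by the induction
    hypothesis, and [Ck_eval] treats the product. *)
Lemma Ck_comp m E F G (U : set E) (V : set F) (f : E -> F) (g : F -> G) :
  (forall u, U u -> V (f u)) -> Ck m U f -> Ck m V g -> Ck m U (g \o f).
Proof.
move=> UV; elim: m G g => [|m IH] G g.
  move=> fC gC; apply: econt_Ck => u Uu; apply: econt_comp.
    exact: Ck_econt fC Uu.
  by apply: Ck_econt gC _; exact: UV.
move=> fC gC; have [df dfE df_Ck] := (CkSP _ _ _).1 fC.
have [dg dgE dg_Ck] := (CkSP _ _ _).1 gC; apply/CkSP.
exists (fun x => compL E F G (dg (f x)) (df x)).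
  by move=> u Uu; apply: fder_comp; [exact: dfE|apply: dgE; exact: UV].
apply: Ck_eval => //; apply: Ck_post; apply: (IH _ dg) => //.
exact: CkW.
Qed.

Lemma Ck_pair m E F G (U : set E) (f : E -> F) (g : E -> G) :
  Ck m U f -> Ck m U g -> Ck m U (fun x => (f x, g x)).
Proof.
move=> fC gC.
have -> : (fun x => (f x, g x)) = (fun x => inlb F G (f x) + inrb F G (g x)).
  by apply/funext => x; exact: pairE.
by apply: CkD; exact: Ck_post.
Qed.

End CkCalculus.

(** * Integrals over the unit interval and Hadamard's lemma *)

Section MeanValue.
Context {R : realType}.
Implicit Types E F G W Z : normedModType R.

Lemma lineb_linear E (v : E) : linear (fun t : R^o => t *: v).
Proof. by move=> a s t; rewrite scalerDl scalerA. Qed.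

Lemma lineb_bound E (v : E) (t : R^o) : `|t *: v| <= `|v| * `|t|.
Proof. by rewrite normrZ mulrC. Qed.

Definition lineb E (v : E) : blin R^o E := mkblin (@lineb_linear E v) (@lineb_bound E v).

Lemma linebE E (v : E) t : lineb v t = t *: v.
Proof. by []. Qed.

(** Continuous induction with slack e: the supremum s of the points t with |f t - f 0| <= (K + e) t
    is such a point by continuity, and if s < 1, differentiability at s produces a larger one. *)
Lemma mvi_curve Z (f : R^o -> Z) (L : R -> blin R^o Z) (K : R) :
  (forall t : R, 0 <= t <= 1 -> fder f t (L t)) ->
  (forall t : R, 0 <= t <= 1 -> `|L t 1| <= K) -> `|f 1 - f 0| <= K.
Proof.
move=> fL LK; apply/ler_addgt0Pr => /= e e0.
have K0 : 0 <= K by apply: le_trans (LK 0 _) => //; rewrite lexx ler01.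
pose K' := K + e; have K'0 : 0 < K' by rewrite ltr_wpDl.
pose S := [set t : R | 0 <= t <= 1 /\ `|f t - f 0| <= K' * t].
have S0 : S 0 by split; rewrite ?lexx ?ler01 // subrr normr0 mulr0.
have S1 t : S t -> t <= 1 by case=> /andP[].
have hS : has_sup S by split; [exists 0|exists 1 => t /S1].
pose s := sup S.
have s0 : 0 <= s by apply: ub_le_sup => //; case: hS.
have s1 : s <= 1 by apply: ge_sup => //; case: hS.
have Ss : S s.
  split; first by rewrite s0.
  apply/ler_addgt0Pr => /= e' e'0.
  have [d d0 fd] := fder_econt (fL s (introT andP (conj s0 s1))) e'0.
  have [t St ts] := sup_adherent d0 hS.
  have tles : t <= s by apply: ub_le_sup => //; case: hS.
  have [_ St'] := St.
  have ft : `|f t - f s| <= e'.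
    have := fd (t - s); rewrite [s + _]addrC subrK; apply.
    by rewrite distrC ger0_norm ?subr_ge0 //; move: ts; rewrite -/s; lra.
  have -> : f s - f 0 = (f t - f 0) - (f t - f s) by lmod R Z.
  rewrite (le_trans (ler_normB _ _)) // lerD //.
  by apply: le_trans St' _; rewrite ler_wpM2l // ltW.
have [s_eq1|s_neq1] := eqVneq s 1.
  by case: Ss => _; rewrite s_eq1 mulr1.
have s_lt1 : s < 1 by rewrite lt_neqAle s_neq1.
have [d d0 fd] := fL s (introT andP (conj s0 s1)) e e0.
pose k := Num.min (d / 2) (1 - s).
have k0 : 0 < k by rewrite lt_min divr_gt0 // subr_gt0.
have kd : `|k : R^o| < d.
  by rewrite gtr0_norm // gt_min; apply/orP; left; lra.
have k1 : s + k <= 1.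
  have : k <= 1 - s by rewrite ge_min lexx orbT.
  by lra.
suff : S (s + k).
  by move=> Ssk; have : s + k <= s by [apply: ub_le_sup => //; case: hS]; lra.
split; first by rewrite k1 andbT addr_ge0 // ltW.
have := fd k kd.
have -> : f (s + k) - f 0 = (f (s + k) - f s - L s k) + ((f s - f 0) + L s k) by lmod R Z.
move=> fk; rewrite (le_trans (ler_normD _ _)) //.
have Lk : `|L s k| <= K * k.
  rewrite -[k in L s k]mulr1 -[k * 1]/(k *: (1 : R^o)) blinZ normrZ gtr0_norm // mulrC.
  by rewrite ler_wpM2r ?(ltW k0) //; apply: LK; rewrite s0.
have [_ Sf] := Ss; rewrite gtr0_norm // in fk.
have := ler_normD (f s - f 0) (L s k); rewrite /K' in Sf *.
move: fk Lk Sf; set a := `|_|; set b := `|_|; set c := `|_|; set g := `|_|.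
by move=> *; have -> : (K + e) * (s + k) = e * k + ((K + e) * s + K * k); [ring|lra].
Qed.

Lemma mvi E F (f : E -> F) (df : E -> blin E F) u k (K : R) :
  (forall t : R, 0 <= t <= 1 -> fder f (u + t *: k) (df (u + t *: k))) ->
  (forall t : R, 0 <= t <= 1 -> `|df (u + t *: k) k| <= K) ->
  `|f (u + k) - f u| <= K.
Proof.
move=> fd dK; pose g (t : R^o) : F := f (u + t *: k).
have -> : f (u + k) - f u = g 1 - g 0 by rewrite /g scale1r scale0r addr0.
apply: (@mvi_curve _ g (fun t => compb (df (u + t *: k)) (lineb k))) => t t01.
  apply: (@fder_comp _ _ _ _ f (fun t : R^o => u + t *: k)); last exact: fd.
  rewrite -[lineb k]add0r; apply: fderD; first exact: fder_cst.
  exact: (fder_blin (lineb k)).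
by rewrite compbE linebE scale1r dK.
Qed.

Lemma mvi_lin E F (f : E -> F) (df : E -> blin E F) u k (L : blin E F) (K : R) :
  (forall t : R, 0 <= t <= 1 -> fder f (u + t *: k) (df (u + t *: k))) ->
  (forall t : R, 0 <= t <= 1 -> `|df (u + t *: k) - L| <= K) ->
  `|f (u + k) - f u - L k| <= K * `|k|.
Proof.
move=> fd dK.
have -> : f (u + k) - f u - L k = (f (u + k) + (- L) (u + k)) - (f u + (- L) u).
  by rewrite !blin_oppE blinD; lmod R F.
apply: (@mvi _ _ (fun x => f x + (- L) x) (fun x => df x + (- L)) u k) => t t01.
  by apply: fderD; [exact: fd|exact: fder_blin].
by apply: le_trans (blin_le _ _) _; rewrite ler_wpM2r // dK.
Qed.

End MeanValue.

(** * Compactness of the unit interval *)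

Section UnitInterval.
Context {R : realType}.
Implicit Types E F G W Z : normedModType R.

(** A Lebesgue number principle: for a property stable under shrinking the radius, radii valid
    locally yield one radius valid on all of [0, 1]. *)
Lemma unit_cover (Q : R -> R -> Prop) :
  (forall t d d' : R, Q t d -> 0 < d' -> d' <= d -> Q t d') ->
  (forall t : R, 0 <= t <= 1 -> exists2 d : R, 0 < d &
     forall s : R, 0 <= s <= 1 -> `|s - t| < d -> Q s d) ->
  exists2 d : R, 0 < d & forall t : R, 0 <= t <= 1 -> Q t d.
Proof.
move=> Qle Qloc.
have /compact_near_coveringP cpt := @segment_compact R 0 1.
have H : forall x : R, `[0, 1]%classic x ->
   \forall x' \near x & i \near 0^'+, 0 <= x' <= 1 -> Q x' i.
  move=> x; rewrite /= in_itv /= => /Qloc[d d0 Qd].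
  exists (ball x d, [set i | 0 < i < d]).
    split; first exact: nbhsx_ballx.
    by apply: filterS2 (nbhs_right_gt 0) (nbhs_right_lt d0) => i /= -> ->.
  move=> [s i] [/= xs /andP[i0 id]] s01; apply: Qle i0 (ltW id).
  by apply: Qd => //; move: xs; rewrite -ball_normE /= distrC.
have K : \forall d \near (0 : R)^'+, `[0, 1]%classic `<=` (fun t => 0 <= t <= 1 -> Q t d).
  by apply: cpt H.
have : \forall d \near (0 : R)^'+, 0 < d /\ `[0, 1]%classic `<=` (fun t =>
  0 <= t <= 1 -> Q t d).
  by apply: filterS2 (nbhs_right_gt 0) K.
move=> /filter_ex[d [d0 dQ]]; exists d => // t t01.
by apply: dQ => //; rewrite /= in_itv.
Qed.

(** [Ck 0 unitI f] asks for continuity of [f], as a map on the whole line, at the points of the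
    closed interval, hence on both sides of 0 and of 1. *)
Definition unitI : set R^o := [set t : R | 0 <= t <= 1].

(** A bound is the inverse of a radius: [unit_cover] for the property |f t| d <= 1 gives a common d,
    and 1 / d bounds f. *)
Lemma unit_bounded Z (f : R^o -> Z) : Ck 0 unitI f ->
  exists2 M : R, 0 < M & forall t : R, 0 <= t <= 1 -> `|f t| <= M.
Proof.
move=> fC.
have [t d d' /= td d'0 dd'|t t01|d d0 fd] := @unit_cover (fun t d => `|f t| * d <= 1).
- by apply: le_trans td; rewrite ler_wpM2l.
- have [d d0 fd] := econtW (Ck_econt fC t01).
  have K0 : 0 < `|f t| + 1 by rewrite ltr_wpDl.
  exists (Num.min d (`|f t| + 1)^-1); first by rewrite lt_min d0 invr_gt0.
  move=> s s01; rewrite lt_min => /andP[st _].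
  have := fd (s - t) st; rewrite addrC subrK => fs.
  apply: (@le_trans _ _ ((`|f t| + 1) * (`|f t| + 1)^-1)); last by rewrite mulfV // gt_eqF.
  by apply: ler_pM => //; rewrite ?ge_min ?lexx ?orbT // le_min !ltW // invr_gt0.
- by exists d^-1; rewrite ?invr_gt0 // => t t01; rewrite -[d^-1]mul1r ler_pdivlMr // fd.
Qed.

Lemma unit_ucont Z (f : R^o -> Z) : Ck 0 unitI f -> forall e, 0 < e ->
  exists2 d : R, 0 < d & forall s t : R, 0 <= s <= 1 -> 0 <= t <= 1 -> `|s - t| < d ->
    `|f s - f t| <= e.
Proof.
move=> fC e e0; have e20 : 0 < e / 2 by rewrite divr_gt0.
have [t d d' /= td d'0 dd'|t t01|d d0 fd] := @unit_cover (fun t d =>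
  forall s : R, 0 <= s <= 1 -> `|s - t| < d -> `|f s - f t| <= e).
- by move=> s s01 st; apply: td => //; exact: lt_le_trans st dd'.
- have [d d0 fd] := Ck_econt fC t01 e20.
  exists (d / 2); first by rewrite divr_gt0.
  move=> s s01 st s' s'01 s's.
  have -> : f s' - f s = (f (t + (s' - t)) - f t) - (f (t + (s - t)) - f t).
    by rewrite !(addrC t) !subrK; lmod R Z.
  rewrite (le_trans (ler_normB _ _)) // [e]splitr lerD // fd //; last by lra.
  have := ler_distD s s' t; move: st s's; rewrite /=; lra.
- by exists d => // s t s01 t01; exact: fd.
Qed.

(** E need not be locally compact; uniformity comes from compactness of the curve [a] alone and
    holds in a tube around it. *)
Lemma unit_tube E Z (phi : E -> Z) (a : R^o -> E) : Ck 0 unitI a ->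
  (forall t : R, 0 <= t <= 1 -> econt phi (a t)) -> forall e, 0 < e ->
  exists2 d : R, 0 < d & forall t k, 0 <= t <= 1 -> `|k| < d ->
    `|phi (a t + k) - phi (a t)| <= e.
Proof.
move=> aC phiC e e0; have e20 : 0 < e / 2 by rewrite divr_gt0.
have [t d d' /= td d'0 dd'|t t01|d d0 fd] := @unit_cover (fun t d =>
  forall k, `|k| < d -> `|phi (a t + k) - phi (a t)| <= e).
- by move=> k kd'; apply: td; exact: lt_le_trans kd' dd'.
- have [d d0 fd] := phiC t t01 _ e20; have d20 : 0 < d / 4 by rewrite divr_gt0.
  have [d' d'0 ad] := Ck_econt aC t01 d20.
  exists (Num.min (d / 4) d'); first by rewrite lt_min d20.
  move=> s s01; rewrite lt_min => /andP[_ st] k; rewrite lt_min => /andP[kd _].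
  have := ad (s - t) st; rewrite (addrC t) subrK => as_at.
  have -> : phi (a s + k) - phi (a s) = (phi (a t + (a s - a t + k)) - phi (a t))
      - (phi (a t + (a s - a t)) - phi (a t)).
    by rewrite addrA !(addrC (a t)) !subrK; lmod R Z.
  rewrite (le_trans (ler_normB _ _)) // [e]splitr lerD // fd //.
    by rewrite (le_lt_trans (ler_normD _ _)) //; lra.
  by apply: le_lt_trans as_at _; lra.
- by exists d => // t k t01; exact: fd.
Qed.

End UnitInterval.

(** * Riemann integrals with values in Banach spaces and division by a linear form *)

Section UnitIntegral.
Context {R : realType}.
Implicit Types E F G W Z : normedModType R.

(* Left Riemann sums over [2 ^ n] equal parts of the interval [[a, a + h]]; the
   recursive splitting makes refinement estimates plain inductions. *)
Fixpoint dsum Z (f : R -> Z) (n : nat) (a h : R) : Z :=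
  if n is m.+1 then dsum f m a (h / 2) + dsum f m (a + h / 2) (h / 2)
  else h *: f a.

(** 0 is a default for divergent sums; [rint_cvg] excludes this case for continuous integrands with
    values in a Banach space. *)
Definition rint Z (f : R -> Z) : Z := xget 0 [set l | seqlim (fun n => dsum f n 0 1) l].

Lemma dsumB Z (f g : R -> Z) n a h :
  dsum (fun t => f t - g t) n a h = dsum f n a h - dsum g n a h.
Proof.
by elim: n a h => [|n IH] a h /=; rewrite ?scalerBr // !IH; lmod R Z.
Qed.

Lemma dsum_blin Z W (T : blin Z W) (f : R -> Z) n a h :
  dsum (fun t => T (f t)) n a h = T (dsum f n a h).
Proof. by elim: n a h => [|n IH] a h /=; rewrite ?blinZ // !IH blinD. Qed.

Lemma dsum_cst Z (c : Z) n a h : dsum (fun=> c) n a h = h *: c.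
Proof.
by elim: n a h => [|n IH] a h //=; rewrite !IH -scalerDl -splitr.
Qed.

Lemma dsum_norm Z (f : R -> Z) n a h M : 0 <= h ->
  (forall t, a <= t <= a + h -> `|f t| <= M) -> `|dsum f n a h| <= h * M.
Proof.
elim: n a h => [|n IH] a h h0 fM /=.
  by rewrite normrZ ger0_norm // ler_wpM2l // fM // lexx lerDl.
have h20 : 0 <= h / 2 by rewrite divr_ge0.
rewrite (le_trans (ler_normD _ _)) // [h in leRHS]splitr mulrDl lerD //;
  apply: IH => // t /andP[ta th];
  by apply: fM; apply/andP; split; lra.
Qed.

(** [h < d * 2 ^+ n] says that the mesh h / 2^n lies below the modulus of continuity d. Splitting in
    halves preserves this relation and the errors add up to h M. *)
Lemma dsum_refine Z (f : R -> Z) n m a h d M : 0 <= h -> h < d * 2 ^+ n ->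
  (forall s t, a <= s <= a + h -> a <= t <= a + h -> `|s - t| < d -> `|f s - f t| <= M) ->
  `|dsum f (n + m) a h - dsum f n a h| <= h * M.
Proof.
elim: n a h => [|n IH] a h h0 hd fM.
  rewrite add0n -[dsum f 0 a h](dsum_cst (f a) m a h) -dsumB.
  apply: dsum_norm => // t th; apply: fM => //; first by rewrite lexx lerDl.
  move: th hd => /andP[ta th]; rewrite expr0 mulr1 => hd.
  by rewrite ger0_norm; lra.
have h20 : 0 <= h / 2 by rewrite divr_ge0.
have hd2 : h / 2 < d * 2 ^+ n by move: hd; rewrite exprS; lra.
rewrite addSn /= opprD addrACA (le_trans (ler_normD _ _)) // [h in leRHS]splitr mulrDl.
by rewrite lerD // IH // => s t /andP[? ?] /andP[? ?] st; apply: fM => //; apply/andP;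
  split; lra.
Qed.

Lemma exp2_large (d : R) : 0 < d -> exists n, forall m, (n <= m)%N -> 1 < d * 2 ^+ m.
Proof.
move=> d0; have [n nd] : exists n : nat, d^-1 < n%:R.
  by exists (Num.bound d^-1); rewrite archi_boundP // invr_ge0 ltW.
exists n => m nm; rewrite mulrC -ltr_pdivrMr // div1r; apply: lt_le_trans nd _.
rewrite -natrX ler_nat; apply: leq_trans nm _; apply: ltnW; exact: ltn_expl.
Qed.

Lemma rint_cvg Z (f : R^o -> Z) : banach Z -> Ck 0 unitI f ->
  seqlim (fun n => dsum f n 0 1) (rint f).
Proof.
move=> bZ fC; apply: (@xgetPex _ 0 [set l | seqlim (fun n => dsum f n 0 1) l]).
apply: bZ => e e0; have e20 : 0 < e / 2 by rewrite divr_gt0.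
have [d d0 fd] := unit_ucont fC e20.
have [N Nd] := exp2_large d0.
have H p : (N <= p)%N -> `|dsum f p 0 1 - dsum f N 0 1| <= e / 2.
  move=> Np; rewrite -[p](subnKC Np) -[leRHS]mul1r; apply: (@dsum_refine _ _ _ _ _ _ d) => //.
    exact: Nd.
  by move=> s t; rewrite add0r; exact: fd.
exists N => p q Np Nq.
have -> : dsum f p 0 1 - dsum f q 0 1 = (dsum f p 0 1 - dsum f N 0 1)
   - (dsum f q 0 1 - dsum f N 0 1) by lmod R Z.
by rewrite (le_trans (ler_normB _ _)) // [e]splitr lerD // H.
Qed.

Lemma rint_lim Z (f : R -> Z) l : seqlim (fun n => dsum f n 0 1) l -> rint f = l.
Proof.
move=> fl; apply: (seqlim_unique _ fl).
exact: (@xgetPex _ 0 [set l | seqlim (fun n => dsum f n 0 1) l] (ex_intro _ l fl)).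
Qed.

Lemma rint_norm Z (f : R^o -> Z) M : banach Z -> Ck 0 unitI f ->
  (forall t : R, 0 <= t <= 1 -> `|f t| <= M) -> `|rint f| <= M.
Proof.
move=> bZ fC fM; rewrite -[rint f]subr0; apply: (seqlim_le (rint_cvg bZ fC)).
exists 0 => n _; rewrite subr0 -[M]mul1r; apply: dsum_norm => // t.
by rewrite add0r; exact: fM.
Qed.

Lemma rint_blin Z W (T : blin Z W) (f : R^o -> Z) : banach Z -> Ck 0 unitI f ->
  rint (fun t => T (f t)) = T (rint f).
Proof.
move=> bZ fC; apply: rint_lim.
have -> : (fun n => dsum (fun t => T (f t)) n 0 1) = (fun n => T (dsum f n 0 1)).
  by apply/funext => n; exact: dsum_blin.
by apply: seqlim_blin; exact: rint_cvg.
Qed.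

Lemma rintB Z (f g : R^o -> Z) : banach Z -> Ck 0 unitI f -> Ck 0 unitI g ->
  rint (fun t => f t - g t) = rint f - rint g.
Proof.
move=> bZ fC gC; apply: rint_lim.
have -> : (fun n => dsum (fun t => f t - g t) n 0 1) =
    (fun n => dsum f n 0 1 + (- 1) *: dsum g n 0 1).
  by apply/funext => n; rewrite dsumB scaleN1r.
rewrite -[- rint g]scaleN1r.
by apply: seqlimD; [exact: rint_cvg|apply: seqlimZ; exact: rint_cvg].
Qed.

(** On a single piece this is the mean value inequality against the linear map [L a]; the recursion
    adds up the errors of the pieces. *)
Lemma dsum_ftc Z (f : R^o -> Z) (L : R -> blin R^o Z) n a h d M : 0 <= h ->
  0 <= a -> a + h <= 1 -> h < d * 2 ^+ n ->
  (forall t : R, 0 <= t <= 1 -> fder f t (L t)) ->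
  (forall s t : R, 0 <= s <= 1 -> 0 <= t <= 1 -> `|s - t| < d ->
     `|L s - L t| <= M) ->
  `|f (a + h) - f a - dsum (fun t => L t 1) n a h| <= h * M.
Proof.
move=> + + + + fL LM; elim: n a h => [|n IH] a h h0 a0 ah1 hd.
  rewrite /= -blinZ -[h *: 1]/(h * 1) mulr1 [leRHS]mulrC -[h in leRHS](ger0_norm h0).
  move: hd; rewrite expr0 mulr1 => hd.
  have H t : 0 <= t <= 1 -> 0 <= a + t * h <= 1 /\ `|a + t * h - a| < d.
    move=> /andP[t0 t1].
    have th0 : 0 <= t * h by rewrite mulr_ge0.
    have th1 : t * h <= h by rewrite ler_piMl.
    by split; [apply/andP; split; lra|rewrite addrC addKr ger0_norm; lra].
  apply: (@mvi_lin _ R^o _ f L a h (L a)) => t /H[H1 H2]; first exact: fL.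
  by apply: LM => //; apply/andP; split; lra.
have h20 : 0 <= h / 2 by rewrite divr_ge0.
have hd2 : h / 2 < d * 2 ^+ n by move: hd; rewrite exprS; lra.
rewrite /=.
have -> : f (a + h) - f a - (dsum (fun t => L t 1) n a (h / 2) +
   dsum (fun t => L t 1) n (a + h / 2) (h / 2)) =
   (f (a + h / 2) - f a - dsum (fun t => L t 1) n a (h / 2)) +
   (f (a + h / 2 + h / 2) - f (a + h / 2) - dsum (fun t => L t 1) n (a + h / 2) (h / 2)).
  by rewrite -[a + h / 2 + h / 2]addrA -splitr; lmod R Z.
rewrite (le_trans (ler_normD _ _)) // [h in leRHS]splitr mulrDl.
by rewrite lerD // IH //; lra.
Qed.

Lemma rint_ftc Z (f : R^o -> Z) (L : R^o -> blin R^o Z) : banach Z ->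
  Ck 0 unitI L -> (forall t : R, 0 <= t <= 1 -> fder f t (L t)) ->
  rint (fun t => L t 1) = f 1 - f 0.
Proof.
move=> bZ LC fL; apply: rint_lim => e e0.
have [d d0 Ld] := unit_ucont LC e0.
have [N Nd] := exp2_large d0; exists N => n Nn; rewrite distrC.
have := @dsum_ftc _ f L n 0 1 d e ler01 (lexx 0).
rewrite add0r mul1r; apply => //; exact: Nd.
Qed.

Definition preb E Z (A : blin E E) : blin (blin E Z) (blin E Z) :=
  flip1 (compL E E Z) A.

(** Differentiation under the integral sign. The derivative has an integrand of the same shape, with
    [dphi] for [phi] and [B t] replaced by composition with [B t] on the left and [A t] on the
    right; this is what lets [rint_Ck] proceed by induction. *)
Lemma rint_fder E Z W (U : set E) (A : R^o -> blin E E) (B : R^o -> blin Z W)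
    (phi : E -> Z) (dphi : E -> blin E Z) : banach W -> eopen U ->
  Ck 0 unitI A -> Ck 0 unitI B ->
  (forall (t : R) h, 0 <= t <= 1 -> U h -> U (A t h)) ->
  (forall u, U u -> fder phi u (dphi u)) -> Ck 0 U dphi ->
  forall u, U u -> fder (fun h => rint (fun t => B t (phi (A t h)))) u
     (rint (fun t => compb (postb E (B t)) (preb Z (A t)) (dphi (A t u)))).
Proof.
move=> bW oU AC BC UA phid dphiC u Uu e e0.
have phiC : Ck 0 U phi by apply: econt_Ck => x Ux; exact: fder_econt (phid x Ux).
have Aev x : Ck 0 unitI (fun t => A t x).
  exact: (Ck_post (evb E x) AC).
have gC G (psi : E -> G) x : Ck 0 U psi -> U x -> Ck 0 unitI (fun t => psi (A t x)).
  by move=> psiC Ux; apply: (Ck_comp (V := U) _ (Aev x) psiC) => t t01; exact: UA.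
have JC x : U x -> Ck 0 unitI (fun t => B t (phi (A t x))).
  by move=> Ux; apply: Ck_eval => //; exact: gC.
have PC : Ck 0 unitI (fun t => compb (postb E (B t)) (preb Z (A t)) (dphi (A t u))).
  apply: (@Ck_eval _ _ _ _ _ _ (fun t => compb (postb E (B t)) (preb Z (A t))));
    last exact: gC.
  apply: (@Ck_eval _ _ _ _ _ _ (fun t => compL _ _ _ (compL _ _ _ (B t)))
     (fun t => flip1 (compL E E Z) (A t))); last exact: Ck_post.
  by apply: Ck_post; exact: Ck_post.
have [MA MA0 AM] := unit_bounded AC; have [MB MB0 BM] := unit_bounded BC.
(* The remainder of [phi] is evaluated at [A t k], of norm at most MA |k|, and then multiplied by
   [B t], of norm at most MB. *)
have e1 : 0 < e / (MB * MA) by rewrite divr_gt0 // mulr_gt0.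
have [d d0 dphid] := @unit_tube _ _ _ dphi _ (Aev u)
   (fun t t01 => Ck_econt dphiC (UA t u t01 Uu)) _ e1.
have [d' d'0 Ud'] := oU u Uu.
exists (Num.min d' (d / MA)); first by rewrite lt_min d'0 divr_gt0.
move=> k; rewrite lt_min => /andP[kd']; rewrite ltr_pdivlMr // => kd.
have Uk s : 0 <= s <= 1 -> U (u + s *: k).
  move=> /andP[s0 s1]; apply: Ud'; rewrite normrZ ger0_norm //.
  by apply: le_lt_trans kd'; rewrite ler_piMl.
have U1 : U (u + k) by have := Uk 1; rewrite scale1r; apply; rewrite lexx ler01.
rewrite -[X in _ - _ - X](rint_blin (evb W k) (banach_blin bW) PC).
rewrite -rintB //; [|exact: JC|exact: JC].
have PkC : Ck 0 unitI (fun t =>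
   evb W k (compb (postb E (B t)) (preb Z (A t)) (dphi (A t u)))).
  exact: Ck_post.
have subC (f g : R^o -> W) : Ck 0 unitI f -> Ck 0 unitI g -> Ck 0 unitI (fun t => f t - g t).
  move=> fC gC'; have -> : (fun t => f t - g t) = (fun t => f t + (- idb W) (g t)) by [].
  by apply: CkD => //; exact: Ck_post.
rewrite -rintB //; last by apply: subC; exact: JC.
apply: rint_norm => //.
  exact: (subC _ _ (subC _ _ (JC _ U1) (JC _ Uu)) PkC).
move=> t t01.
have -> : B t (phi (A t (u + k))) - B t (phi (A t u)) -
   evb W k (compb (postb E (B t)) (preb Z (A t)) (dphi (A t u))) =
   B t (phi (A t u + A t k) - phi (A t u) - dphi (A t u) (A t k)).
  by rewrite !blinB [in LHS]blinD.
have Ak : `|A t k| <= MA * `|k|.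
  by apply: le_trans (blin_le _ _) _; rewrite ler_wpM2r // AM.
have H : `|phi (A t u + A t k) - phi (A t u) - dphi (A t u) (A t k)| <= e / (MB * MA)
  * `|A t k|.
  apply: mvi_lin => s s01.
    by apply: phid; rewrite -blinZ -blinD; apply: UA => //; exact: Uk.
  apply: dphid => //; rewrite normrZ; case/andP: s01 => s0 s1; rewrite ger0_norm //.
  apply: le_lt_trans kd; apply: le_trans (ler_piMl _ s1) _ => //.
  by rewrite mulrC.
apply: le_trans (blin_le _ _) _.
apply: le_trans (ler_pM _ _ (BM t t01) (le_trans H (ler_wpM2l (ltW e1) Ak))) _ => //.
have -> : MB * (e / (MB * MA) * (MA * `|k|)) = e * `|k|; last by [].
by field; rewrite !gt_eqF.
Qed.

Lemma rint_Ck m E Z W (U : set E) (A : R^o -> blin E E) (B : R^o -> blin Z W)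
    (phi : E -> Z) : banach W -> eopen U ->
  Ck 0 unitI A -> Ck 0 unitI B ->
  (forall (t : R) h, 0 <= t <= 1 -> U h -> U (A t h)) -> Ck m U phi ->
  Ck m U (fun h => rint (fun t => B t (phi (A t h)))).
Proof.
move=> + oU AC + UA; elim: m Z W B phi => [|m IH] Z W B phi bW BC.
  move=> phiC; apply: econt_Ck => u Uu e e0.
  have Aev x : Ck 0 unitI (fun t => A t x) by exact: (Ck_post (evb E x) AC).
  have JC x : U x -> Ck 0 unitI (fun t => B t (phi (A t x))).
    move=> Ux; apply: Ck_eval => //.
    by apply: (Ck_comp (V := U) _ (Aev x) phiC) => t t01; exact: UA.
  have [MA MA0 AM] := unit_bounded AC; have [MB MB0 BM] := unit_bounded BC.
  have e1 : 0 < e / MB by rewrite divr_gt0.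
  have [d d0 dphid] := @unit_tube _ _ _ phi _ (Aev u)
     (fun t t01 => Ck_econt phiC (UA t u t01 Uu)) _ e1.
  have [d' d'0 Ud'] := oU u Uu.
  exists (Num.min d' (d / MA)); first by rewrite lt_min d'0 divr_gt0.
  move=> k; rewrite lt_min => /andP[kd']; rewrite ltr_pdivlMr // => kd.
  rewrite -rintB //; [|by apply: JC; exact: Ud'|exact: JC].
  apply: rint_norm => //.
    have -> : (fun t : R^o => B t (phi (A t (u + k))) - B t (phi (A t u))) =
      (fun t => B t (phi (A t (u + k))) + (- idb W) (B t (phi (A t u)))) by [].
    by apply: CkD; [apply: JC; exact: Ud'|apply: Ck_post; exact: JC].
  move=> t t01; rewrite -blinB blinD; apply: le_trans (blin_le _ _) _.
  have Ak : `|A t k| < d.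
    apply: le_lt_trans kd; apply: le_trans (blin_le _ _) _.
    by rewrite mulrC ler_wpM2l // AM.
  apply: le_trans (ler_pM _ _ (BM t t01) (dphid t _ t01 Ak)) _ => //.
  by rewrite mulrC mulfVK // gt_eqF.
move=> /CkSP[dphi phid dphiC]; apply/CkSP.
exists (fun u => rint (fun t => compb (postb E (B t)) (preb Z (A t)) (dphi (A t u)))).
  by move=> u Uu; apply: (rint_fder bW oU AC BC UA phid (Ck_le (leq0n m) dphiC) Uu).
apply: (IH _ _ (fun t => compb (postb E (B t)) (preb Z (A t)))) => //.
  exact: banach_blin.
apply: (@Ck_eval _ _ _ _ _ _ (fun t => compL _ _ _ (compL _ _ _ (B t)))
   (fun t => flip1 (compL E E Z) (A t))); last exact: Ck_post.
by apply: Ck_post; exact: Ck_post.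
Qed.

Lemma Ck_der m E F (U : set E) (f : E -> F) (df : E -> blin E F) : eopen U ->
  (forall u, U u -> fder f u (df u)) -> Ck m.+1 U f -> Ck m U df.
Proof.
move=> oU dfE /CkSP[df' df'E df'C]; apply: Ck_ext df'C => // u Uu.
by apply: fder_unique; [exact: df'E|exact: dfE].
Qed.

(* The quotient is the average of [df (A t h) e] over the segment from
   [A 0 h], where [f] vanishes, to [A 1 h = h]. *)
Lemma hadamard_Ck E Z (U : set E) (f : E -> Z) (df : E -> blin E Z)
    (A0 A1 : blin E E) (ell : blin E R^o) (e : E) :
  banach Z -> eopen U -> (forall h, A1 h = ell h *: e) ->
  (forall h, A0 h + A1 h = h) ->
  (forall (t : R) h, 0 <= t <= 1 -> U h -> U (A0 h + t *: A1 h)) ->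
  (forall u, U u -> fder f u (df u)) -> Ck 0 U df ->
  (forall h, U h -> f (A0 h) = 0) ->
  exists g : E -> Z, (forall h, U h -> f h = ell h *: g h) /\
    forall m, Ck m U df -> Ck m U g.
Proof.
move=> bZ oU A1E A01 UA dfE dfC f0.
pose A (t : R^o) : blin E E := A0 + t *: A1.
have AC : Ck 0 unitI A.
  by apply: CkD; [exact: Ck_cst|exact: (Ck_blin 0 unitI (lineb A1))].
have BC : Ck 0 unitI (fun _ : R^o => evb Z e) by exact: Ck_cst.
exists (fun h => rint (fun t => evb Z e (df (A t h)))); split; last first.
  by move=> m dfCm; apply: (@rint_Ck m _ _ _ U A (fun=> evb Z e)).
move=> h Uh.
have dAC : Ck 0 unitI (fun t => df (A t h)).
  apply: (Ck_comp (V := U) (f := fun t => A t h)); last exact: dfC.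
    by move=> t t01; exact: UA.
  exact: (Ck_post (evb E h) AC).
have evC : Ck 0 unitI (fun t => evb Z e (df (A t h))) by exact: Ck_post.
(* The scalar [ell h] as an operator, so that [rint_blin] can take it under the integral. *)
pose T : blin Z Z := ell h *: idb Z.
rewrite -[RHS]/(T _) -(rint_blin T bZ evC).
have f10 : f h = f (A 1 h) - f (A 0 h).
  by rewrite /A !blin_addE !blin_scaleE scale1r scale0r addr0 A01 f0 // subr0.
rewrite f10.
have <- : rint (fun t => compb (df (A t h)) (lineb (A1 h)) 1) = f (A 1 h) - f (A 0 h).
  apply: (@rint_ftc _ (fun t => f (A t h)) (fun t => compb (df (A t h)) (lineb (A1 h)))) => //.
    exact: (Ck_post (flip1 (compL R^o E Z) (lineb (A1 h))) dAC).
  move=> t t01; apply: (@fder_comp _ _ _ _ f (fun t => A t h)); last by apply: dfE; exact: UA.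
  rewrite -[lineb _]add0r; apply: (@fderD _ _ _ (fun=> A0 h) (lineb (A1 h))).
    exact: fder_cst.
  exact: fder_blin.
congr rint; apply/funext => t; rewrite compbE linebE scale1r A1E blinZ //.
Qed.

End UnitIntegral.

(** * Parametrized contractions *)

Section FixedPoint.
Context {R : realType}.
Implicit Types E F G W Z : normedModType R.

Lemma compbBr E F G (g : blin F G) (f f' : blin E F) :
  compb g (f - f') = compb g f - compb g f'.
Proof. exact: (blinB (postb E g)). Qed.

Definition half_lipschitz Z (rho : R) (f : Z -> Z) := forall y y' : Z,
  `|y| < rho -> `|y'| < rho -> `|f y - f y'| <= 2^-1 * `|y - y'|.

Lemma half_iter_small (a e : R) : 0 < e -> exists N, forall n, (N <= n)%N ->
  2^-1 ^+ n * `|a| <= e.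
Proof.
move=> e0; have a0 : 0 < `|a| + 1 by rewrite ltr_wpDl.
have [N Nd] := exp2_large (divr_gt0 e0 a0); exists N => n /Nd.
rewrite mulrAC ltr_pdivlMr // mul1r => H.
rewrite exprVn mulrC ler_pdivrMr ?exprn_gt0 //.
by apply: ltW; apply: lt_trans H; rewrite ltrDl.
Qed.

(** Each iterate is within |y| of y, hence of norm at most 2 |y|. This is why fixed points are kept
    in the ball of radius rho / 2: the iterates then stay where the Lipschitz estimate holds. *)
Lemma half_iter_dist Z rho (f : Z -> Z) y n : half_lipschitz rho f ->
  `|y| < rho / 2 -> y = f y ->
  `|iter n f 0 - y| <= 2^-1 ^+ n * `|y| /\ `|iter n f 0| < rho.
Proof.
move=> fl yr fy; have y0 := normr_ge0 y.
have aux m : `|iter m f 0 - y| <= 2^-1 ^+ m * `|y| -> `|iter m f 0| < rho.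
  move=> H; have : 2^-1 ^+ m * `|y| <= `|y| by rewrite ler_piMl // exprn_ile1 //; lra.
  have := ler_normD (iter m f 0 - y) y; rewrite subrK.
  by move: H; set a := `|_|; set b := `|iter _ _ _|; lra.
suff H : `|iter n f 0 - y| <= 2^-1 ^+ n * `|y| by split=> //; exact: aux.
elim: n => [|n IH]; first by rewrite /= sub0r normrN expr0 mul1r.
rewrite iterS [in X in `|_ - X|]fy; apply: le_trans (fl _ _ (aux _ IH) _) _.
  by move: yr; lra.
by rewrite exprS -mulrA ler_wpM2l // invr_ge0.
Qed.

Lemma half_fix_unique Z rho (f : Z -> Z) y y' : half_lipschitz rho f ->
  `|y| < rho -> `|y'| < rho -> y = f y -> y' = f y' -> y = y'.
Proof.
move=> fl yr y'r fy fy'; apply/eqP; rewrite -subr_eq0 -normr_le0.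
have := fl _ _ yr y'r; rewrite -fy -fy'; lra.
Qed.

(** Banach iteration from 0: the iterates stay in the ball of radius 2 |f 0| < rho, and the
    increments are dominated by a geometric series of ratio 1/2. *)
Lemma half_fix_exists Z rho (f : Z -> Z) : banach Z -> half_lipschitz rho f ->
  `|f 0| < rho / 2 -> exists2 y, `|y| <= 2 * `|f 0| & y = f y.
Proof.
move=> bZ fl f0r; pose u n := iter n f 0.
have f00 := normr_ge0 (f 0).
have uM n : `|u n| <= 2 * `|f 0|.
  elim: n => [|n IH]; first by rewrite normr0 mulr_ge0.
  have ur : `|u n| < rho by lra.
  have r0 : `|0 : Z| < rho by rewrite normr0; lra.
  have := fl _ _ ur r0; rewrite subr0.
  have := ler_normD (f (u n) - f 0) (f 0); rewrite subrK -[f (u n)]/(u n.+1).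
  by set a := `|u n.+1|; set b := `|_ - _|; lra.
have ur n : `|u n| < rho by apply: le_lt_trans (uM n) _; lra.
have du n : `|u n.+1 - u n| <= 2^-1 ^+ n * `|f 0|.
  elim: n => [|n IH]; first by rewrite /= subr0 expr0 mul1r.
  by apply: le_trans (fl _ _ (ur n.+1) (ur n)) _; rewrite exprS -mulrA ler_wpM2l.
have usum n : \sum_(i < n) (u i.+1 - u i) = u n.
  by elim: n => [|n IH]; rewrite ?big_ord0 // big_ord_recr /= IH; lmod R Z.
have [y yl] : exists l, seqlim (fun n => \sum_(i < n) (u i.+1 - u i)) l.
  apply: (@banach_summable _ _ bZ (fun i => u i.+1 - u i) (2 * `|f 0|)) => n;
    apply: (@le_trans _ _ (2 * `|f 0| * (1 - 2^-1 ^+ n))).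
    elim: n => [|n IH]; first by rewrite big_ord0 expr0 subrr mulr0.
    rewrite big_ord_recr /= exprS; have := du n; move: IH.
    by set a := `|u _ - _|; set b := _ ^+ n; set c := \sum_(i < n) _; lra.
  by rewrite ler_piMr ?mulr_ge0 // lerBlDr lerDl exprn_ge0 // invr_ge0.
have {}yl : seqlim u y by have -> : u = (fun n => \sum_(i < n) (u i.+1 - u i))
  by apply/funext => n; rewrite usum.
have y2 : `|y| <= 2 * `|f 0|.
  by rewrite -[y]subr0; apply: seqlim_le yl _; exists 0%N => n _; rewrite subr0.
exists y => //; apply/eqP; rewrite -subr_eq0 -normr_le0; apply/ler_addgt0Pr => /= e e0.
have e20 : 0 < e / 2 by rewrite divr_gt0.
have [N uN] := yl _ e20.
have -> : y - f y = (u N.+1 - f y) - (u N.+1 - y) by lmod R Z.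
rewrite add0r (le_trans (ler_normB _ _)) // [e]splitr lerD //; last by apply: uN.
have yr : `|y| < rho by lra.
apply: le_trans (fl _ _ (ur N) yr) _; have := uN N (leqnn _).
by have := normr_ge0 (u N - y); lra.
Qed.

(** The fixed point is the limit of the iterates of 0, which never leave S. This is how the
    invariance in (iv) passes to the solution of the range equation. *)
Lemma half_fix_closed Z rho (f : Z -> Z) y (S : set Z) : half_lipschitz rho f ->
  `|y| < rho / 2 -> y = f y -> closed S -> S 0 ->
  (forall z, `|z| < rho -> S z -> S (f z)) -> S y.
Proof.
move=> fl yr fy cS S0 Sf.
have Sn n : S (iter n f 0).
  by elim: n => [|n IH] //=; apply: Sf => //; have [] := half_iter_dist n fl yr fy.
have /seqlimP yl : seqlim (fun n => iter n f 0) y.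
  move=> e e0; have [N HN] := half_iter_small `|y| e0; exists N => n /HN.
  by rewrite normr_id => H; have [H1 _] := half_iter_dist n fl yr fy; apply: le_trans H1 H.
by apply: (closed_cvg S cS (nearW _ Sn) y yl).
Qed.

Lemma affine_fix Z (T : blin Z Z) (c : Z) : banach Z -> `|T| <= 2^-1 ->
  exists x, x = c + T x.
Proof.
(* The half Lipschitz bound is global here, so any radius above 2 |c| will do. *)
move=> bZ T2; have [||y _ yE] := @half_fix_exists Z (2 * `|c| + 1) (fun x => c + T x) bZ.
- move=> y y' _ _; have -> : c + T y - (c + T y') = T (y - y') by rewrite blinB; lmod R Z.
  by apply: le_trans (blin_le _ _) _; rewrite ler_wpM2r.
- by rewrite blin0 addr0; lra.
- by exists y.
Qed.

Lemma fix_Ck0 E Z (U : set E) (B : set Z) (N : E * Z -> Z) (psi : E -> Z) :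
  eopen U -> (forall h, U h -> B (psi h)) -> (forall h, U h -> psi h = N (h, psi h)) ->
  (forall h y y', U h -> B y -> B y' -> `|N (h, y) - N (h, y')| <= 2^-1 * `|y - y'|) ->
  Ck 0 [set p | U p.1 /\ B p.2] N -> Ck 0 U psi.
Proof.
move=> oU Bpsi psiE Nl NC; apply: econt_Ck => h Uh e e0.
have e20 : 0 < e / 2 by rewrite divr_gt0.
have [d d0 Nd] := Ck_econt NC (conj Uh (Bpsi h Uh) : [set p | U p.1 /\ B p.2] (h, psi h)) e20.
have [d' d'0 Ud] := oU h Uh; exists (Num.min d d'); first by rewrite lt_min d0.
move=> k; rewrite lt_min => /andP[kd /Ud Uk].
have kd0 : `|(k, 0 : Z)| < d by rewrite norm_pair_lt kd normr0.
have := Nd _ kd0; rewrite -[(h, psi h) + (k, 0)]/(h + k, psi h + 0) addr0.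
have := Nl _ _ _ Uk (Bpsi _ Uk) (Bpsi _ Uh); rewrite -psiE // -(psiE h) //.
have -> : psi (h + k) - psi h = (psi (h + k) - N (h + k, psi h)) + (N (h + k, psi h) - psi h).
  by lmod R Z.
have := ler_normD (psi (h + k) - N (h + k, psi h)) (N (h + k, psi h) - psi h).
by set a := `|_ + _|; set b := `|_ - N _|; set c := `|_|; lra.
Qed.

Lemma fder_half_le Z F (f : Z -> F) y (b : blin Z F) d : 0 < d -> fder f y b ->
  (forall k, `|k| < d -> `|f (y + k) - f y| <= 2^-1 * `|k|) -> `|b| <= 2^-1.
Proof.
move=> d0 fb fl; apply: blin_norm_le; first by rewrite invr_ge0.
move=> k; apply/ler_addgt0Pr => /= e e0.
have k0 : 0 < `|k| + 1 by rewrite ltr_wpDl.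
have [d' d'0 fd] := fb _ (divr_gt0 e0 k0).
pose t := Num.min d d' / 2 / (`|k| + 1).
have t0 : 0 < t by rewrite !divr_gt0 // lt_min d0.
have tk : `|t *: k| < Num.min d d'.
  rewrite normrZ gtr0_norm // /t mulrAC -mulrA.
  have m0 : 0 < Num.min d d' by rewrite lt_min d0.
  rewrite mulrC; apply: (@le_lt_trans _ _ (Num.min d d' / 2)); last by lra.
  by rewrite mulrC mulrA ler_pdivrMr // ler_wpM2l ?lerDl // divr_ge0 // ltW.
move: tk; rewrite lt_min => /andP[/fl H1 /fd H2].
rewrite -(ler_pM2l t0).
have -> : t * `|b k| = `|b (t *: k)| by rewrite blinZ normrZ gtr0_norm.
have -> : b (t *: k) = (f (y + t *: k) - f y) - (f (y + t *: k) - f y - b (t *: k)).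
  by lmod R F.
rewrite mulrDr (le_trans (ler_normB _ _)) // lerD //.
  by apply: le_trans H1 _; rewrite normrZ gtr0_norm // mulrCA.
apply: le_trans H2 _; rewrite normrZ gtr0_norm // mulrCA (ler_pM2l t0).
by rewrite mulrC mulr_div_le ?(ltW e0) // lerDl.
Qed.

(** [A] solves the linearized equation A = a + b A. For an increment w of [psi], w - A k = (w - a k
    - b w) + b (w - A k), and |b| <= 1/2 lets the last term be absorbed on the left. *)
Lemma fix_fder E Z (U : set E) (B : set Z) (N : E * Z -> Z) (psi : E -> Z) h
    (D : blin (E * Z)%type Z) (A : blin E Z) :
  eopen U -> eopen B -> (forall h, U h -> B (psi h)) ->
  (forall h, U h -> psi h = N (h, psi h)) ->
  (forall h y y', U h -> B y -> B y' -> `|N (h, y) - N (h, y')| <= 2^-1 * `|y - y'|) ->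
  econt psi h -> U h -> fder N (h, psi h) D ->
  A = compb D (inlb E Z) + compb (compb D (inrb E Z)) A ->
  `|compb D (inrb E Z)| <= 2^-1 /\ fder psi h A.
Proof.
move=> oU oB Bpsi psiE Nl psiC Uh ND AE.
set a := compb D (inlb E Z) in AE *; set b := compb D (inrb E Z) in AE *.
have Dab k z : D (k, z) = a k + b z by rewrite pairE blinD.
have b2 : `|b| <= 2^-1.
  have [d d0 Bd] := oB _ (Bpsi h Uh).
  apply: (@fder_half_le _ _ (fun y => N (h, y)) (psi h) b d d0).
    apply: (@fder_comp _ _ _ _ N (fun y => (h, y)) (psi h) (inrb E Z) D) => //.
    move=> e e0; exists 1 => // k _.
    rewrite -[inrb E Z k]/(0, k).
    have -> : (h, psi h + k) - (h, psi h) - (0, k) = 0 :> E * Z.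
      by apply/eqP; rewrite xpair_eqE /= subrr subr0 addrAC addrK subrr eqxx eqxx.
    by rewrite normr0 mulr_ge0 // ltW.
  move=> k kd; apply: le_trans (Nl _ _ _ Uh (Bd _ kd) (Bpsi h Uh)) _.
  by rewrite addrAC subrr add0r.
split=> // e e0.
have e40 : 0 < (4^-1 : R) by rewrite invr_gt0.
(* With tolerance 1/4, |w| <= (|k| + |w|) / 4 + |a| |k| + |w| / 2, that is |w| <= (4 |a| + 1) |k|.
   The factor 1/2 in e' pays for the absorption of b (w - A k). *)
pose C := 4 * `|a| + 1; have C0 : 0 < C by rewrite ltr_wpDl // mulr_ge0.
pose e' := e / 2 / (1 + C); have e'0 : 0 < e' by rewrite !divr_gt0 // addr_gt0.
have [d1 d10 N1] := ND _ e40; have [d2 d20 N2] := ND _ e'0.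
have d120 : 0 < Num.min d1 d2 / 2 by rewrite divr_gt0 // lt_min d10.
have [d3 d30 psid] := psiC _ d120; have [d4 d40 Ud] := oU h Uh.
exists (Num.min (Num.min d1 d2) (Num.min d3 d4)); first by rewrite !lt_min d10 d20 d30.
move=> k; rewrite lt_min => /andP[kd12]; rewrite lt_min => /andP[/psid pk /Ud Uk].
set w := psi (h + k) - psi h in pk *.
have kw : `|(k, w)| < Num.min d1 d2.
  by rewrite norm_pair_lt kd12 /=; apply: le_lt_trans pk _; move: d120; lra.
have NE : N ((h, psi h) + (k, w)) - N (h, psi h) = w.
  rewrite -[(h, psi h) + (k, w)]/(h + k, psi h + w).
  by rewrite {1}/w [psi h + _]addrC subrK -psiE // -psiE.
clearbody w; move: kw; rewrite lt_min => /andP[/N1 H1 /N2 H2].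
rewrite !NE !Dab in H1 H2.
have kwle := norm_pair_le k w.
have wC : `|w| <= C * `|k|.
  have -> : C * `|k| = 4 * (`|a| * `|k|) + `|k| by rewrite /C; ring.
  have wE : w = (w - (a k + b w)) + (a k + b w) by rewrite subrK.
  have h1 := ler_normD (w - (a k + b w)) (a k + b w); rewrite -wE in h1.
  have h2 := ler_normD (a k) (b w).
  have h3 := blin_le a k; have h4 := blin_le b w.
  have h5 : `|b| * `|w| <= 2^-1 * `|w| by rewrite ler_wpM2r.
  by move: H1 kwle h1 h2 h3 h4 h5; set A1 := `|_ - _|; set A2 := `|(k, w)|; set A3 :=
    `|a k + _|; lra.
have wA : w - A k = (w - (a k + b w)) + b (w - A k).
  have Ak : A k = a k + b (A k) by rewrite {1}AE.
  by rewrite [b (_ - _)]blinB {1}Ak; lmod R Z.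
have h1 := ler_normD (w - (a k + b w)) (b (w - A k)); rewrite -wA in h1.
have h2 := blin_le b (w - A k).
have h3 : `|b| * `|w - A k| <= 2^-1 * `|w - A k| by rewrite ler_wpM2r.
have h4 : e' * `|(k, w)| <= e' * ((1 + C) * `|k|).
  by rewrite (ler_pM2l e'0); apply: le_trans kwle _; rewrite mulrDl mul1r lerD2l.
have h5 : e' * ((1 + C) * `|k|) = e / 2 * `|k|.
  by rewrite /e'; field; rewrite gt_eqF // addr_gt0.
rewrite h5 in h4.
by move: H2 h1 h2 h3 h4; set A1 := `|_ - (_ + _)|; set A2 := `|w - A k|; lra.
Qed.

(* The derivative of [psi] is itself the fixed point of a family of half
   contractions, which are affine; this makes the induction on [m] close. *)
Lemma fix_Ck m E Z (U : set E) (B : set Z) (N : E * Z -> Z) (psi : E -> Z) :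
  banach Z -> eopen U -> eopen B ->
  (forall h, U h -> B (psi h)) -> (forall h, U h -> psi h = N (h, psi h)) ->
  (forall h y y', U h -> B y -> B y' -> `|N (h, y) - N (h, y')| <= 2^-1 * `|y - y'|) ->
  Ck m [set p | U p.1 /\ B p.2] N -> Ck m U psi.
Proof.
elim: m Z B N psi => [|m IH] Z B N psi bZ oU oB Bpsi psiE Nl NC; first exact: fix_Ck0 NC.
have psiCm : Ck m U psi by apply: IH (CkW NC).
have [dN NE NC'] := (CkSP _ _ _).1 NC.
pose D h := dN (h, psi h).
have DE h : U h -> fder N (h, psi h) (D h) by move=> Uh; apply: NE; split=> //; exact: Bpsi.
have DC : Ck m U D.
  apply: (Ck_comp (V := [set p | U p.1 /\ B p.2]) (f := fun h => (h, psi h))) => //.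
    by move=> h Uh; split=> //; exact: Bpsi.
  by apply: Ck_pair => //; exact: (Ck_blin m U (idb E)).
pose a h := compb (D h) (inlb E Z); pose b h := compb (D h) (inrb E Z).
have b2 h : U h -> `|b h| <= 2^-1.
  move=> Uh; have [d d0 Bd] := oB _ (Bpsi h Uh).
  apply: (@fder_half_le _ _ (fun y => N (h, y)) (psi h) (b h) d d0).
    apply: (@fder_comp _ _ _ _ N (fun y => (h, y)) (psi h) (inrb E Z) (D h)); last exact: DE.
    move=> e e0; exists 1 => // k _; rewrite -[inrb E Z k]/(0, k).
    have -> : (h, psi h + k) - (h, psi h) - (0, k) = 0 :> E * Z.
      by apply/eqP; rewrite xpair_eqE /= subrr subr0 addrAC addrK subrr eqxx eqxx.
    by rewrite normr0 mulr_ge0 // ltW.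
  move=> k kd; apply: le_trans (Nl _ _ _ Uh (Bd _ kd) (Bpsi h Uh)) _.
  by rewrite addrAC subrr add0r.
have : forall h, exists A : blin E Z, U h -> A = a h + compb (b h) A.
  move=> h; have [Uh|nUh] := pselect (U h); last by exists 0.
  have [|A AE] := @affine_fix _ (postb E (b h)) (a h) (banach_blin bZ).
    apply: blin_norm_le; first by rewrite invr_ge0.
    by move=> f; apply: le_trans (compb_norm _ _) _; rewrite ler_wpM2r // b2.
  by exists A.
move=> /choice[dpsi dpsiE].
apply/CkSP; exists dpsi.
  move=> h Uh; have [] // := fix_fder oU oB Bpsi psiE Nl (Ck_econt psiCm Uh) Uh (DE h Uh)
    (dpsiE h Uh).
pose N' (p : E * blin E Z) := a p.1 + compb (b p.1) p.2.
(* The contraction for the derivative is affine in its second argument, so its Lipschitz bound holds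
   everywhere and the ball becomes [setT]. *)
apply: (IH _ setT N') => //.
- exact: banach_blin.
- exact: eopenT.
- move=> h A A' Uh _ _; rewrite /N' /=.
  have -> : a h + compb (b h) A - (a h + compb (b h) A') = compb (b h) (A - A').
    by rewrite compbBr opprD addrACA subrr add0r.
  by apply: le_trans (compb_norm _ _) _; rewrite ler_wpM2r // b2.
set V := [set p | _]; have DV : Ck m V (fun p : E * blin E Z => D p.1).
  apply: (Ck_comp (V := U) (f := fun p : E * blin E Z => p.1)) => //; first by move=> p [].
  exact: (Ck_blin m V (fstb E (blin E Z))).
apply: CkD; first exact: (Ck_post (flip1 (compL E (E * Z)%type Z) (inlb E Z)) DV).
apply: (@Ck_eval _ m _ _ _ _ (fun p => compL E Z Z (compb (D p.1) (inrb E Z))) (fun p => p.2)).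
  apply: Ck_post; exact: (Ck_post (flip1 (compL Z (E * Z)%type Z) (inrb E Z)) DV).
exact: (Ck_blin m V (sndb E (blin E Z))).
Qed.

(** As [dN 0] vanishes on the second factor, [dN] has norm at most 1/2 on that factor throughout the
    ball where |dN p - dN 0| <= 1/2; the mean value inequality then gives the half contraction. *)
Lemma fix_exists E Z (N : E * Z -> Z) (dN : E * Z -> blin (E * Z)%type Z) r0 :
  banach Z -> 0 < r0 -> (forall p, `|p| < r0 -> fder N p (dN p)) -> econt dN 0 ->
  N 0 = 0 -> (forall y, dN 0 (0, y) = 0) ->
  exists r rho psi, [/\ 0 < r, r <= r0, 0 < rho, rho <= r0 &
    forall h, `|h| < r -> [/\ `|psi h| < rho / 2, psi h = N (h, psi h) &
      half_lipschitz rho (fun y => N (h, y))]].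
Proof.
move=> bZ r00 Nd dNC N0 dN0.
have h20 : 0 < (2^-1 : R) by rewrite invr_gt0.
have [d d0 dNd] := dNC _ h20; pose rho := Num.min d r0.
have rho0 : 0 < rho by rewrite lt_min d0.
have Nl h : `|h| < rho -> half_lipschitz rho (fun y => N (h, y)).
  move=> hr y y' yr y'r; rewrite -[y - y'](addr0) distrC.
  have -> : N (h, y') - N (h, y) = N ((h, y) + (0, y' - y)) - N (h, y) - dN 0 (0, y' - y).
    rewrite dN0 subr0; congr (N _ - _); rewrite -[(h, y) + _]/(h + 0, y + (y' - y)).
    by rewrite addr0 [y + _]addrC subrK.
  have nE : `|(0 : E, y' - y)| = `|y - y' + 0|.
    by rewrite addr0 prod_normE /= normr0 distrC max_r.
  rewrite -nE.
  have seg t : 0 <= t <= 1 -> `|(h, y) + t *: (0, y' - y)| < rho.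
    move=> /andP[t0 t1]; rewrite -[_ + _]/(h + t *: 0, y + t *: (y' - y)) scaler0 addr0.
    rewrite norm_pair_lt hr /=.
    have -> : y + t *: (y' - y) = (1 - t) *: y + t *: y' by lmod R Z.
    rewrite (le_lt_trans (ler_normD _ _)) // !normrZ !ger0_norm ?subr_ge0 //.
    have h1 : (1 - t) * `|y| <= (1 - t) * Num.max `|y| `|y'|.
      by rewrite ler_wpM2l ?subr_ge0 // le_max lexx.
    have h2 : t * `|y'| <= t * Num.max `|y| `|y'| by rewrite ler_wpM2l // le_max lexx orbT.
    apply: (@le_lt_trans _ _ (Num.max `|y| `|y'|)); last by rewrite gt_max yr.
    by move: h1 h2; set M := Num.max _ _; rewrite mulrBl mul1r; lra.
  apply: (@mvi_lin _ _ _ N dN) => t t01; have := seg t t01; rewrite lt_min => /andP[sd sr].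
    exact: Nd.
  by have := dNd _ sd; rewrite add0r.
(* |N (h, 0)| <= rho / 8 yields a fixed point of norm at most rho / 4, strictly inside the ball of
   radius rho / 2. *)
have rho40 : 0 < rho / 8 by rewrite divr_gt0.
have N0d : fder N 0 (dN 0) by apply: Nd; rewrite normr0.
have [d' d'0 Nd'] := fder_econt N0d rho40.
pose r := Num.min d' rho; have r_gt0 : 0 < r by rewrite lt_min d'0.
have : forall h, exists y, `|h| < r -> `|y| < rho / 2 /\ y = N (h, y).
  move=> h; have [|hr] := ltP `|h| r; last by exists 0.
  rewrite lt_min => /andP[hd hrho].
  have : `|N (h, 0)| <= rho / 8.
    have := Nd' (h, 0); rewrite add0r N0 subr0; apply.
    by rewrite norm_pair_lt hd normr0 d'0.
  move=> Nh; have [|y y2 yE] := half_fix_exists bZ (Nl _ hrho); first by lra.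
  by exists y => _; split=> //; lra.
move=> /choice[psi psiP]; exists r, rho, psi; split=> //.
- by rewrite ge_min [rho <= r0]ge_min lexx !orbT.
- by rewrite ge_min lexx orbT.
move=> h hr; have [h1 h2] := psiP h hr; split=> //.
by apply: Nl; move: hr; rewrite lt_min => /andP[].
Qed.

End FixedPoint.

(** * Power series and analytic maps *)

Section PowerSeries.
Context {R : realType}.
Implicit Types E F G V W X Z : normedModType R.

Lemma banach_mlin E Z m : banach Z -> banach (mlin m E Z).
Proof. by move=> bZ; elim: m => //= m; exact: banach_blin. Qed.

Fixpoint evd E Z m (h : E) : blin (mlin m E Z) Z :=
  match m return blin (mlin m E Z) Z with
  | 0%N => idb Z
  | m'.+1 => compb (evd Z m' h) (evb (mlin m' E Z) h)
  end.

Lemma evdE E Z m (h : E) (a : mlin m E Z) : evd Z m h a = mdiag a h.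
Proof. by elim: m a => //= m IH a; rewrite IH. Qed.

Lemma mdiagD E Z m (h : E) (a b : mlin m E Z) : mdiag (a + b) h = mdiag a h + mdiag b h.
Proof. by rewrite -!evdE blinD. Qed.

Lemma mdiag0 E Z m (h : E) : mdiag (0 : mlin m E Z) h = 0.
Proof. by rewrite -evdE blin0. Qed.

Lemma mdiag_norm E Z m (h : E) (a : mlin m E Z) : `|mdiag a h| <= `|a| * `|h| ^+ m.
Proof.
elim: m a => [|m IH] a /=; first by rewrite expr0 mulr1.
apply: le_trans (IH _) _; rewrite exprS mulrA ler_wpM2r ?exprn_ge0 //.
exact: (blin_le (a : blin E (mlin m E Z)) h).
Qed.

Lemma mdiag_norm_le E Z m (h : E) (a : mlin m E Z) r : `|h| <= r ->
  `|mdiag a h| <= `|a| * r ^+ m.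
Proof.
move=> hr; apply: le_trans (mdiag_norm _ _) _.
by rewrite ler_wpM2l // lerXn2r // nnegrE // (le_trans _ hr).
Qed.

(** The whole majorant sum is bounded, not each term as in [analytic_at]. Such bounds multiply under
    products and pass to compositions, with no loss of radius. *)
Definition PSc E Z (r M : R) (a : forall m, mlin m E Z) (f : E -> Z) :=
  (forall N, \sum_(m < N) `|a m| * r ^+ m <= M) /\
  forall h, `|h| <= r -> seqlim (fun N => \sum_(m < N) mdiag (a m) h) (f h).

Definition PS E Z (r M : R) (f : E -> Z) := exists a, PSc r M a f.

Lemma PS_ge0 E Z r M (f : E -> Z) : PS r M f -> 0 <= M.
Proof. by move=> [a [aM _]]; have := aM 0%N; rewrite big_ord0. Qed.

Lemma PSc_coef E Z r M a (f : E -> Z) m : 0 <= r -> PSc r M a f -> `|a m| * r ^+ m <= M.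
Proof.
move=> r0 [aM _]; apply: le_trans (aM m.+1); rewrite big_ord_recr /= lerDr.
by apply: sumr_ge0 => i _; rewrite mulr_ge0 // exprn_ge0.
Qed.

Lemma PSc_tail E Z r M a (f : E -> Z) h N : `|h| <= r -> PSc r M a f ->
  `|f h - \sum_(m < N) mdiag (a m) h| <= M.
Proof.
move=> hr [aM af]; have r0 : 0 <= r by apply: le_trans hr.
apply: seqlim_le (af h hr) _; exists N => N' /subnKC <-; move: (N' - N)%N => d.
rewrite big_split_ord /= addrAC subrr add0r (le_trans (ler_norm_sum _ _ _)) //.
apply: le_trans (aM (N + d)%N); rewrite big_split_ord /= ler_wpDl //.
  by apply: sumr_ge0 => i _; rewrite mulr_ge0 // exprn_ge0.
by apply: ler_sum => i _; exact: mdiag_norm_le.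
Qed.

Lemma PS_norm E Z r M (f : E -> Z) h : PS r M f -> `|h| <= r -> `|f h| <= M.
Proof.
by move=> [a af] hr; have := PSc_tail 0 hr af; rewrite big_ord0 subr0.
Qed.

Lemma PS_ext E Z r M (f g : E -> Z) : (forall h, `|h| <= r -> f h = g h) ->
  PS r M f -> PS r M g.
Proof.
by move=> fg [a [aM af]]; exists a; split=> // h hr; rewrite -fg //; exact: af.
Qed.

Lemma PS_le E Z r M M' (f : E -> Z) : M <= M' -> PS r M f -> PS r M' f.
Proof. by move=> MM' [a [aM af]]; exists a; split=> // N; exact: le_trans MM'. Qed.

Lemma PS_radius E Z r r' M (f : E -> Z) : 0 <= r' -> r' <= r -> PS r M f -> PS r' M f.
Proof.
move=> r'0 r'r [a [aM af]]; exists a; split.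
  move=> N; apply: le_trans (aM N); apply: ler_sum => i _.
  by rewrite ler_wpM2l // lerXn2r // nnegrE // (le_trans r'0).
by move=> h hr; apply: af; exact: le_trans r'r.
Qed.

Lemma PS_add E Z r M M' (f g : E -> Z) : 0 <= r -> PS r M f -> PS r M' g ->
  PS r (M + M') (fun h => f h + g h).
Proof.
move=> r0 [a [aM af]] [b [bM bg]]; exists (fun m => a m + b m); split.
  move=> N; apply: le_trans (lerD (aM N) (bM N)); rewrite -big_split /=.
  by apply: ler_sum => i _; rewrite -mulrDl ler_wpM2r ?exprn_ge0 // ler_normD.
move=> h hr.
have -> : (fun N => \sum_(m < N) mdiag (a m + b m) h) =
    (fun N => \sum_(m < N) mdiag (a m) h + \sum_(m < N) mdiag (b m) h).
  by apply/funext => N; rewrite -big_split; apply: eq_bigr => i _; rewrite mdiagD.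
by apply: seqlimD; [exact: af|exact: bg].
Qed.

Lemma seqlim_cst Z (c : Z) : seqlim (fun=> c) c.
Proof. by move=> e e0; exists 0%N => n _; rewrite subrr normr0 ltW. Qed.

Lemma seqlim_shift Z (u : nat -> Z) l : seqlim (fun n => u n.+1) l -> seqlim u l.
Proof.
move=> ul e /ul[N uN]; exists N.+1; case=> // n; rewrite ltnS; exact: uN.
Qed.

Lemma PS_cst E Z r (c : Z) : PS r `|c| (fun _ : E => c).
Proof.
exists (fun m => match m return mlin m E Z with 0%N => c | _ => 0 end); split.
  case=> [|N]; first by rewrite big_ord0.
  rewrite big_ord_recl /= expr0 mulr1 big1 ?addr0 // => i _.
  by rewrite normr0 mul0r.
move=> h hr; apply: seqlim_shift.
set u := (X in seqlim X _); have -> : u = fun=> c.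
  apply/funext => N; rewrite /u big_ord_recl /= big1 ?addr0 // => i _.
  by rewrite -[RHS](@mdiag0 E Z i h).
exact: seqlim_cst.
Qed.


Lemma PS_zero E Z r : PS r 0 (fun _ : E => 0 : Z).
Proof. by have := @PS_cst E Z r 0; rewrite normr0. Qed.

Fixpoint mpost E V W m : blin (blin V W) (blin (mlin m E V) (mlin m E W)) :=
  match m return blin (blin V W) (blin (mlin m E V) (mlin m E W)) with
  | 0%N => idb (blin V W)
  | m'.+1 => compb (compL E (mlin m' E V) (mlin m' E W)) (mpost E V W m')
  end.

Lemma mpost_norm E V W m (T : blin V W) : `|mpost E V W m T| <= `|T|.
Proof.
elim: m => //= m IH; apply: le_trans IH; rewrite -[leRHS]mul1r.
exact: (postb_bound E (mpost E V W m T)).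
Qed.

Lemma mpostE E V W m (T : blin V W) (a : mlin m E V) h :
  mdiag (mpost E V W m T a) h = T (mdiag a h).
Proof. by elim: m a => //= m IH a; rewrite IH. Qed.

Lemma PS_post E V W (T : blin V W) r M (f : E -> V) : 0 <= r -> PS r M f ->
  PS r (`|T| * M) (fun h => T (f h)).
Proof.
move=> r0 [a [aM af]]; exists (fun m => mpost E V W m T (a m)); split.
  move=> N; apply: le_trans (ler_wpM2l (normr_ge0 T) (aM N)).
  rewrite mulr_sumr; apply: ler_sum => i _; rewrite mulrA ler_wpM2r ?exprn_ge0 //.
  by apply: le_trans (blin_le _ _) _; rewrite ler_wpM2r // mpost_norm.
move=> h hr; have -> : (fun N => \sum_(m < N) mdiag (mpost E V W m T (a m)) h) =
    (fun N => T (\sum_(m < N) mdiag (a m) h)).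
  by apply/funext => N; rewrite blin_sum; apply: eq_bigr => i _; rewrite mpostE.
by apply: seqlim_blin; exact: af.
Qed.

Lemma PS_post1 E V W (T : blin V W) r M (f : E -> V) : 0 <= r -> `|T| <= 1 -> PS r M f ->
  PS r M (fun h => T (f h)).
Proof.
move=> r0 T1 fM; apply: PS_le (PS_post T r0 fM).
by rewrite ler_piMl // (PS_ge0 fM).
Qed.

(** The new coefficient of degree m + 1 feeds its first argument to [T] and the remaining ones to
    [a m]; with nonsymmetric multilinear maps this is a mere shift of the degree. *)
Lemma PS_mul_lin E V W (T : blin E (blin V W)) r M (p : E -> V) : 0 <= r -> PS r M p ->
  PS r (`|T| * r * M) (fun h => T h (p h)).
Proof.
move=> r0 [a [aM ap]].
pose c m := match m return mlin m E W with
  | 0%N => 0 | m'.+1 => flip1 (compb (mpost E V W m') T) (a m') end.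
have cE m h : mdiag (c m.+1) h = T h (mdiag (a m) h) by rewrite /= mpostE.
have cn m : `|c m.+1| <= `|T| * `|a m|.
  apply: blin_norm_le; first by rewrite mulr_ge0.
  move=> h; rewrite -[c m.+1 h]/(mpost E V W m (T h) (a m)).
  apply: le_trans (blin_le _ _) _; rewrite mulrAC ler_wpM2r //.
  by apply: le_trans (@mpost_norm E V W m (T h)) _; exact: blin_le.
exists c; split.
  case=> [|N]; first by rewrite big_ord0 !mulr_ge0 // (PS_ge0 (ex_intro _ a (conj aM ap))).
  rewrite big_ord_recl /= normr0 mul0r add0r.
  apply: le_trans (ler_wpM2l (mulr_ge0 (normr_ge0 T) r0) (aM N)).
  rewrite mulr_sumr; apply: ler_sum => i _.
  have -> : `|T| * r * (`|a i| * r ^+ i) = `|T| * `|a i| * r ^+ i.+1 by rewrite exprS; ring.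
  by rewrite ler_wpM2r ?exprn_ge0 //; exact: cn.
move=> h hr; apply: seqlim_shift.
have -> : (fun n => \sum_(m < n.+1) mdiag (c m) h) = (fun N => T h (\sum_(m < N)
  mdiag (a m) h)).
  apply/funext => N; rewrite big_ord_recl /= add0r blin_sum; apply: eq_bigr => i _.
  exact: cE.
by apply: seqlim_blin; exact: ap.
Qed.

Lemma PS_lin E Z (L : blin E Z) r : 0 <= r -> PS r (`|L| * r) L.
Proof.
move=> r0; exists (fun m => match m return mlin m E Z with 1%N => L | _ => 0 end); split.
  case=> [|[|N]]; rewrite ?big_ord0 ?mulr_ge0 //.
    by rewrite big_ord_recl big_ord0 /= normr0 mul0r addr0 mulr_ge0.
  rewrite !big_ord_recl /= normr0 mul0r add0r expr1 big1 ?addr0 // => i _.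
  by rewrite normr0 mul0r.
move=> h hr; do 2!apply: seqlim_shift.
set u := (X in seqlim X _); have -> : u = fun=> L h.
  apply/funext => N; rewrite /u !big_ord_recl /= add0r big1 ?addr0 // => i _.
  by rewrite -[RHS](@mdiag0 E Z i h).
exact: seqlim_cst.
Qed.

Lemma seqlim_sum Z (u : nat -> nat -> Z) (l : nat -> Z) K :
  (forall k, seqlim (u k) (l k)) ->
  seqlim (fun n => \sum_(k < K) u k n) (\sum_(k < K) l k).
Proof.
move=> ul; elim: K => [|K IH].
  rewrite big_ord0; have -> : (fun n => \sum_(k < 0) u k n) = fun=> 0.
    by apply/funext => n; rewrite big_ord0.
  exact: seqlim_cst.
rewrite big_ord_recr /=.
have -> : (fun n => \sum_(k < K.+1) u k n) = (fun n => \sum_(k < K) u k n + u K n).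
  by apply/funext => n; rewrite big_ord_recr.
exact: seqlimD.
Qed.

(** Interchange of two summations: by [PSc_tail] the terms beyond K0 contribute at most e / 2
    whatever the truncation N in the degree, and the finitely many others converge as N grows. *)
Lemma PS_sum E Z r M (Mk : nat -> R) (f : nat -> E -> Z) (g : E -> Z) :
  banach Z -> 0 < r -> (forall k, PS r (Mk k) (f k)) ->
  (forall K, \sum_(k < K) Mk k <= M) ->
  (forall h, `|h| <= r -> seqlim (fun K => \sum_(k < K) f k h) (g h)) ->
  PS r M g.
Proof.
move=> bZ r0 fP MkM fg; have r0' := ltW r0.
have [a aP] := choice fP.
have Mk0 k : 0 <= Mk k := PS_ge0 (fP k).
have acoef k m : `|a k m| <= Mk k / r ^+ m.
  by rewrite ler_pdivlMr ?exprn_gt0 //; exact: (PSc_coef m r0' (aP k)).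
have : forall m, exists l : mlin m E Z, seqlim (fun K => \sum_(k < K) a k m) l.
  move=> m.
  apply: (@banach_summable _ _ (@banach_mlin E Z m bZ) (fun k => a k m) (M / r ^+ m)) => K.
  apply: (@le_trans _ _ (\sum_(k < K) Mk k / r ^+ m)); first exact: ler_sum.
  by rewrite -mulr_suml ler_wpM2r ?invr_ge0 ?exprn_ge0.
move=> bex; pose b m := projT1 (cid (bex m)).
have bP m : seqlim (fun K => \sum_(k < K) a k m) (b m) := projT2 (cid (bex m)).
exists b; split.
  move=> N; apply/ler_addgt0Pr => /= e e0.
  have key : exists K0, forall K, (K0 <= K)%N ->
      \sum_(m < N) `|b m| * r ^+ m <= \sum_(m < N) `|\sum_(k < K) a k m| * r ^+ m + e.
    elim: N e e0 => [|N IH] e e0.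
      by exists 0%N => K _; rewrite !big_ord0 add0r ltW.
    have e20 : 0 < e / 2 by rewrite divr_gt0.
    have rN : 0 < r ^+ N by rewrite exprn_gt0.
    have [K1 K1P] := IH _ e20; have [K2 K2P] := bP N _ (divr_gt0 e20 rN).
    exists (maxn K1 K2) => K; rewrite geq_max => /andP[/K1P H1 /K2P H2].
    rewrite !big_ord_recr /=.
    have H3 : `|b N| * r ^+ N <= `|\sum_(k < K) a k N| * r ^+ N + e / 2.
      rewrite -ler_pdivlMr // mulrDl mulfK ?gt_eqF //.
      rewrite -[b N](subrK (\sum_(k < K) a k N)) addrC.
      by rewrite (le_trans (ler_normD _ _)) // lerD2l distrC.
    by move: H1 H3; set A1 := \sum_(_ < _) _; set A2 := \sum_(_ < _) _; lra.
  have [K0 /(_ _ (leqnn _))] := key; move/le_trans; apply; rewrite lerD2r.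
  apply: le_trans (MkM K0).
  apply: (@le_trans _ _ (\sum_(m < N) \sum_(k < K0) `|a k m| * r ^+ m)).
    by apply: ler_sum => m _; rewrite -mulr_suml ler_wpM2r ?exprn_ge0 // ler_norm_sum.
  by rewrite exchange_big; apply: ler_sum => k _; have [] := aP k.
move=> h hr e e0; have e20 : 0 < e / 2 by rewrite divr_gt0.
have [K0 K0P] : exists K0, forall d, \sum_(k < d) Mk (K0 + k)%N <= e / 2.
  have /summable_cauchy/(_ _ e20)[K0 HK] : forall n, \sum_(i < n) `|Mk i : R^o| <= M.
    by move=> n; apply: le_trans (MkM n); apply: ler_sum => i _; rewrite ger0_norm.
  exists K0 => d; have := HK (K0 + d)%N K0 (leq_addr _ _) (leqnn _).
  rewrite big_split_ord /= addrAC subrr add0r; apply: le_trans; exact: ler_norm.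
have : seqlim (fun N => \sum_(k < K0) (f k h - \sum_(m < N) mdiag (a k m) h))
    (\sum_(k < K0) (f k h + (-1) *: f k h)).
  apply: (@seqlim_sum _ (fun k N => f k h - \sum_(m < N) mdiag (a k m) h)
     (fun k => f k h + (-1) *: f k h)) => k.
  have -> : (fun N => f k h - \sum_(m < N) mdiag (a k m) h) =
     (fun N => f k h + (-1) *: \sum_(m < N) mdiag (a k m) h).
    by apply/funext => N; rewrite scaleN1r.
  by apply: seqlimD; [exact: seqlim_cst|apply: seqlimZ; have [_] := aP k; exact].
rewrite big1 => [/(_ _ e20)[N0 N0P]|k _]; last by rewrite scaleN1r subrr.
exists N0 => N /N0P; rewrite subr0 => H1; rewrite distrC.
have lim1 : seqlim (fun K => \sum_(k < K) (f k h - \sum_(m < N) mdiag (a k m) h))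
    (g h - \sum_(m < N) mdiag (b m) h).
  have -> : (fun K => \sum_(k < K) (f k h - \sum_(m < N) mdiag (a k m) h)) =
     (fun K => \sum_(k < K) f k h + (-1) *: \sum_(m < N) mdiag (\sum_(k < K) a k m) h).
    apply/funext => K; rewrite sumrB scaleN1r; congr (_ - _); rewrite exchange_big.
    apply: eq_bigr => m _; rewrite -evdE blin_sum; apply: eq_bigr => k _.
    by rewrite evdE.
  rewrite -[- (\sum_(m < N) _)]scaleN1r.
  apply: seqlimD; first exact: fg.
  apply: seqlimZ; apply: (@seqlim_sum _ (fun m K => mdiag (\sum_(k < K) a k m) h)
    (fun m => mdiag (b m) h)) => m.
  have -> : (fun K => mdiag (\sum_(k < K) a k m) h) = (fun K => evd Z m h (\sum_(k < K)
    a k m)).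
    by apply/funext => K; rewrite evdE.
  by rewrite -evdE; apply: seqlim_blin; exact: bP.
rewrite -[X in `|X|]subr0 -normrN opprB sub0r opprB -[_ - g h]opprB normrN -[X in `|X|]subr0.
apply: seqlim_le lim1 _; exists K0 => K /subnKC <-; move: (K - K0)%N => d.
rewrite subr0 big_split_ord /= [e]splitr (le_trans (ler_normD _ _)) // lerD //.
apply: le_trans (K0P d); rewrite (le_trans (ler_norm_sum _ _ _)) //.
by apply: ler_sum => k _; exact: PSc_tail hr (aP _).
Qed.


Lemma flip1_norm E F G (A : blin E (blin F G)) : `|flip1 A| <= `|A|.
Proof. by rewrite -[leRHS]mul1r flip1_bound. Qed.

Lemma idb_norm E : `|idb E| <= 1.
Proof. by apply: blin_norm_le => // u; exact: idb_bound. Qed.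

Lemma compL_norm E F G : `|compL E F G| <= 1.
Proof. by apply: blin_norm_le => // u; exact: postb_bound. Qed.

Lemma flipL_norm E F G : `|flipL E F G| <= 1.
Proof. by apply: blin_norm_le => // u; exact: flip1_bound. Qed.

Lemma evb_norm E F (y : E) : `|evb F y| <= `|y|.
Proof. by apply: blin_norm_le => // u; exact: (@evb_bound R E F y u). Qed.

Lemma PS_id E r : 0 <= r -> PS r r (fun h : E => h).
Proof.
move=> r0; apply: PS_le (PS_lin (idb E) r0).
by rewrite ler_piMl // idb_norm.
Qed.

(** The values are linear maps on the space of coefficients a of degree i, sending a to a (h, ...,
    h) (g h). The induction adds one argument h at a time by [PS_mul_lin]; [PS_eval] applies these
    maps to the coefficients of f. *)
Lemma PS_eval_coef E X W r M i (g : E -> X) : 0 <= r -> PS r M g ->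
  PS r (r ^+ i * M) (fun h => compb (evb W (g h)) (evd (blin X W) i h)).
Proof.
move=> r0 gP; elim: i => [|i IH].
  rewrite expr0 mul1r; apply: (@PS_ext _ _ _ _ (fun h => flip1 (idb (blin X W)) (g h))).
    by move=> h _; apply: blin_ext.
  by apply: PS_post1 => //; apply: le_trans (flip1_norm _) (idb_norm _).
pose Vi := mlin i E (blin X W).
pose T := compb (flip1 (compL (blin E Vi) Vi W)) (flip1 (idb (blin E Vi))).
have T1 : `|T| <= 1.
  apply: le_trans (compb_norm _ _) _; rewrite -[leRHS]mul1r ler_pM //.
    by apply: le_trans (flip1_norm _) _; exact: compL_norm.
  by apply: le_trans (flip1_norm _) _; exact: idb_norm.
have := PS_mul_lin T r0 IH.
move/(PS_le (M' := r ^+ i.+1 * M)) => H.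
apply: (@PS_ext _ _ _ _ (fun h => T h (compb (evb W (g h)) (evd (blin X W) i h)))).
  by move=> h _; apply: blin_ext.
apply: H; have -> : r ^+ i.+1 * M = r * (r ^+ i * M) by rewrite exprS mulrA.
rewrite -mulrA ler_piMl //.
by rewrite !mulr_ge0 ?exprn_ge0 // (PS_ge0 gP).
Qed.

Lemma PS_eval E X W r M M' (f : E -> blin X W) (g : E -> X) : banach W -> 0 < r ->
  PS r M f -> PS r M' g -> PS r (M * M') (fun h => f h (g h)).
Proof.
move=> bW r0 [a [aM af]] gP; have r0' := ltW r0.
apply: (@PS_sum _ _ r _ (fun k => `|a k| * r ^+ k * M')
  (fun k h => mdiag (a k) h (g h))) => //.
- move=> k; rewrite -mulrA.
  apply: (@PS_ext _ _ _ _ (fun h => evb W (a k) (compb (evb W (g h)) (evd (blin X W) k h)))).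
    by move=> h _; rewrite -evdE.
  apply: PS_le (PS_post (evb W (a k)) r0' (@PS_eval_coef E X W r M' k g r0' gP)).
  by rewrite ler_wpM2r ?evb_norm // mulr_ge0 ?exprn_ge0 // (PS_ge0 gP).
- by move=> K; rewrite -mulr_suml ler_wpM2r ?(PS_ge0 gP).
move=> h hr.
have -> : (fun K => \sum_(k < K) mdiag (a k) h (g h)) =
    (fun K => evb W (g h) (\sum_(k < K) mdiag (a k) h)).
  by apply/funext => K; rewrite blin_sum.
by apply: seqlim_blin; exact: af.
Qed.

Lemma PS_mdiag E X Z r m A s (al : E -> mlin m X Z) (p : E -> X) : banach Z -> 0 < r ->
  PS r A al -> PS r s p -> PS r (A * s ^+ m) (fun h => mdiag (al h) (p h)).
Proof.
move=> bZ r0 + pP; elim: m A al => [|m IH] A al alP; first by rewrite expr0 mulr1.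
rewrite exprS mulrA; apply: (IH _ (fun h => (al h : blin X (mlin m X Z)) (p h))).
by apply: PS_eval => //; exact: banach_mlin.
Qed.

(** The radius s of the outer series is the majorant of the inner one, so the k-th homogeneous term
    has majorant |a k| s^k and the sum is again at most M. *)
Lemma PS_comp E X Z r s M (f : X -> Z) (p : E -> X) : banach Z -> 0 < r ->
  PS s M f -> PS r s p -> PS r M (fun h => f (p h)).
Proof.
move=> bZ r0 [a [aM af]] pP.
apply: (@PS_sum _ _ r M (fun k => `|a k| * s ^+ k) (fun k h => mdiag (a k) (p h))) => //.
  by move=> k; apply: (@PS_mdiag _ _ _ _ _ _ _ (fun=> a k)) => //; exact: PS_cst.
by move=> h hr; apply: af; exact: PS_norm pP hr.
Qed.

Lemma PS_shift E Z r r' M (f : E -> Z) u : banach Z -> 0 < r' -> `|u| + r' <= r ->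
  PS r M f -> PS r' M (fun h => f (u + h)).
Proof.
move=> bZ r'0 ur fP; apply: (PS_comp bZ r'0 fP); apply: PS_le ur _.
by apply: PS_add (ltW r'0) (PS_cst _ _ u) (PS_id _ (ltW r'0)).
Qed.

Lemma mdiag_at0 E Z m (a : mlin m.+1 E Z) : mdiag a 0 = 0.
Proof.
apply/eqP; rewrite -normr_le0; apply: le_trans (mdiag_norm _ _) _.
by rewrite normr0 expr0n mulr0.
Qed.

Lemma PSc_at0 E Z r M a (f : E -> Z) : 0 <= r -> PSc r M a f -> a 0%N = f 0.
Proof.
move=> r0 [_ /(_ 0)]; rewrite normr0 => /(_ r0) H.
apply: (seqlim_unique _ H); apply: seqlim_shift.
have -> : (fun n => \sum_(m < n.+1) mdiag (a m) 0) = (fun=> a 0%N).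
  by apply/funext => n; rewrite big_ord_recl big1 ?addr0 // => i _; exact: mdiag_at0.
exact: seqlim_cst.
Qed.

(** An analogue of the Schwarz lemma: without a constant term, every term gains at least one factor
    r' / r. *)
Lemma PS_shrink E Z r r' M (f : E -> Z) : 0 < r -> 0 <= r' -> r' <= r -> f 0 = 0 ->
  PS r M f -> PS r' (r' / r * M) f.
Proof.
move=> r0 r'0 r'r f0 [a aP]; have a0 := PSc_at0 (ltW r0) aP; have [aM af] := aP.
have q1 : r' / r <= 1 by rewrite ler_pdivrMr // mul1r.
have q0 : 0 <= r' / r by rewrite divr_ge0 // ltW.
exists a; split; last by move=> h hr; apply: af; exact: le_trans r'r.
move=> N; apply: le_trans (ler_wpM2l q0 (aM N)); rewrite mulr_sumr.
apply: ler_sum => -[[|i] _] _ /=; first by rewrite a0 f0 normr0 !mul0r mulr0.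
rewrite mulrCA ler_wpM2l //.
have -> : r' ^+ i.+1 = (r' / r) ^+ i.+1 * r ^+ i.+1 by rewrite -exprMn mulfVK // gt_eqF.
apply: ler_wpM2r; first exact/exprn_ge0/ltW.
by rewrite exprS ler_piMr // exprn_ile1.
Qed.

Lemma PS_scale E Z r M (c : R) (f : E -> Z) : PS r M f -> PS r (`|c| * M) (fun h => c *: f h).
Proof.
move=> [a [aM af]]; exists (fun m => c *: a m); split.
  move=> N; apply: le_trans (ler_wpM2l (normr_ge0 c) (aM N)).
  by rewrite mulr_sumr; apply: ler_sum => i _; rewrite normrZ mulrA.
move=> h hr; have -> : (fun N => \sum_(m < N) mdiag (c *: a m) h) =
    (fun N => c *: \sum_(m < N) mdiag (a m) h).
  by apply/funext => N; rewrite scaler_sumr; apply: eq_bigr => i _; rewrite -!evdE blinZ.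
by apply: seqlimZ; exact: af.
Qed.

Lemma PS_sub E Z r M M' (f g : E -> Z) : 0 <= r -> PS r M f -> PS r M' g ->
  PS r (M + M') (fun h => f h - g h).
Proof.
move=> r0 fP /(PS_scale (-1)); rewrite normrN1 mul1r => gP.
by apply: (PS_ext _ (PS_add r0 fP gP)) => h _; rewrite scaleN1r.
Qed.

(** The factor (2 s)^m / s = 2^m s^(m-1) dominates the expected m s^(m-1) and satisfies a recursion
    that closes; the powers of 2 are paid by halving a radius later. Distinct [al] and [be] are
    forced by the induction, which substitutes one argument at a time. *)
Lemma PS_mdiag_diff E X Z r m A A' s d (al be : E -> mlin m X Z) (p q : E -> X) :
  banach Z -> 0 < r -> 0 < s -> PS r A al -> PS r A be -> PS r A' (fun h => al h - be h) ->
  PS r s p -> PS r s q -> PS r d (fun h => p h - q h) ->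
  PS r (A * ((2 * s) ^+ m / s) * d + A' * s ^+ m)
    (fun h => mdiag (al h) (p h) - mdiag (be h) (q h)).
Proof.
move=> bZ r0 s0 + + + pP qP pqP; have d0 := PS_ge0 pqP; have s0' := ltW s0; have r0' := ltW r0.
elim: m A A' al be => [|m IH] A A' al be alP beP abP.
  apply: PS_le abP; rewrite !expr0 mulr1 lerDr !mulr_ge0 ?invr_ge0 //.
  exact: PS_ge0 alP.
have bm := @banach_mlin X Z m bZ.
have A0 := PS_ge0 alP.
have H1 := PS_eval bm r0 (alP : PS r A (al : E -> blin X (mlin m X Z))) pP.
have H2 := PS_eval bm r0 (beP : PS r A (be : E -> blin X (mlin m X Z))) qP.
have H3 := PS_eval bm r0 (alP : PS r A (al : E -> blin X (mlin m X Z))) pqP.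
have H4 := PS_eval bm r0 (abP : PS r A' ((fun h => al h - be h) :
  E -> blin X (mlin m X Z))) qP.
have H5 := PS_add r0' H3 H4.
have H6 : PS r (A * d + A' * s) (fun h => (al h : blin X (mlin m X Z)) (p h) -
    (be h : blin X (mlin m X Z)) (q h)).
  apply: PS_ext H5 => h _; rewrite blinB.
  rewrite -[(al h - be h : mlin m.+1 X Z)]/((al h : blin X (mlin m X Z)) - (be h :
    blin X (mlin m X Z))).
  by rewrite blin_subE; lmod R (mlin m X Z).
apply: PS_le (IH _ _ _ _ H1 H2 H6).
have sm : s ^+ m <= (2 * s) ^+ m by rewrite lerXn2r // ?nnegrE ?mulr_ge0 //; lra.
have -> : A * s * ((2 * s) ^+ m / s) * d + (A * d + A' * s) * s ^+ m =
  A * d * ((2 * s) ^+ m + s ^+ m) + A' * s ^+ m.+1.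
  by rewrite exprS; field; rewrite gt_eqF.
have -> : A * ((2 * s) ^+ m.+1 / s) * d = A * d * (2 * (2 * s) ^+ m).
  by rewrite exprS; field; rewrite gt_eqF.
by rewrite lerD2r ler_wpM2l ?mulr_ge0 //; lra.
Qed.

(** [Q] starts in degree 2, and for k >= 2, (2 s)^k / s <= (4 s / R0^2) R0^k as soon as 2 s <= R0.
    The Lipschitz constant is therefore of order s and can be made small. *)
Lemma PS_comp_diff E X Z r R0 M s d a (Q : X -> Z) (p q : E -> X) :
  banach Z -> 0 < r -> 0 < s -> 2 * s <= R0 -> PSc R0 M a Q -> a 0%N = 0 -> a 1%N = 0 ->
  PS r s p -> PS r s q -> PS r d (fun h => p h - q h) ->
  PS r (4 * s / R0 ^+ 2 * M * d) (fun h => Q (p h) - Q (q h)).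
Proof.
move=> bZ r0 s0 sR [aM aQ] a0 a1 pP qP pqP; have d0 := PS_ge0 pqP.
have R00 : 0 < R0 by apply: lt_le_trans sR; rewrite mulr_gt0.
apply: (@PS_sum _ _ r _ (fun k => `|a k| * ((2 * s) ^+ k / s) * d)
  (fun k h => mdiag (a k) (p h) - mdiag (a k) (q h))) => //.
- move=> k; have := @PS_mdiag_diff E X Z r k `|a k| 0 s d (fun=> a k) (fun=> a k) p q bZ r0 s0.
  rewrite mul0r addr0; apply=> //; try exact: PS_cst.
  by apply: (@PS_ext _ _ _ _ (fun=> 0)) => [h _|]; rewrite ?subrr //; exact: PS_zero.
- move=> K; rewrite -mulr_suml ler_wpM2r //.
  have c0 : 0 <= 4 * s / R0 ^+ 2 by rewrite divr_ge0 ?exprn_ge0 ?mulr_ge0 // ltW.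
  apply: le_trans (ler_wpM2l c0 (aM K)); rewrite mulr_sumr.
  apply: ler_sum => -[[|[|k]] _] _ /=; rewrite ?a0 ?a1 ?normr0 ?mul0r ?mulr0 //.
  rewrite [leRHS]mulrCA ler_wpM2l // !exprS.
  have -> : 2 * s * (2 * s * (2 * s) ^+ k) / s = 4 * s * (2 * s) ^+ k by field; rewrite gt_eqF.
  have -> : 4 * s / (R0 * (R0 * R0 ^+ 0)) * (R0 * (R0 * R0 ^+ k)) = 4 * s * R0 ^+ k.
    by rewrite expr0; field; rewrite gt_eqF.
  have s40 : 0 < 4 * s by rewrite mulr_gt0.
  by rewrite (ler_pM2l s40) lerXn2r // nnegrE ?mulr_ge0 // ltW.
move=> h hr.
have -> : (fun K => \sum_(k < K) (mdiag (a k) (p h) - mdiag (a k) (q h))) =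
  (fun K => \sum_(k < K) mdiag (a k) (p h) + (-1) *: \sum_(k < K) mdiag (a k) (q h)).
  by apply/funext => K; rewrite sumrB scaleN1r.
have sR' : s <= R0 by lra.
rewrite -[- Q (q h)]scaleN1r; apply: seqlimD; last apply: seqlimZ.
  by apply: aQ; apply: le_trans sR'; exact: PS_norm pP hr.
by apply: aQ; apply: le_trans sR'; exact: PS_norm qP hr.
Qed.

Lemma PSc_drop1 E Z r M a (f : E -> Z) : 0 <= r -> PSc r M a f -> a 0%N = 0 ->
  PSc r M (fun m => match m return mlin m E Z with 1%N => 0 | m' => a m' end)
    (fun h => f h - (a 1%N : blin E Z) h).
Proof.
move=> r0 [aM af] a0; split.
  move=> N; apply: le_trans (aM N); apply: ler_sum => -[[|[|i]] _] _ //=.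
  by rewrite normr0 mul0r mulr_ge0 // exprn_ge0.
move=> h hr; do 2!apply: seqlim_shift.
set u := (X in seqlim X _).
have -> : u = (fun N => \sum_(m < N.+2) mdiag (a m) h + (-1) *: (a 1%N : blin E Z) h).
  apply/funext => N; rewrite /u !big_ord_recl /= -[X in _ + (X + _) = _]/(0 : Z).
  by lmod R Z.
rewrite -[X in seqlim _ (_ + X)]scaleN1r.
apply: (@seqlimD _ _ (fun N => \sum_(m < N.+2) mdiag (a m) h)); last exact: seqlim_cst.
by move=> e e0; have [N0 HN] := af h hr e e0; exists N0 => n N0n; apply: HN;
  exact: leqW (leqW N0n).
Qed.

Lemma quad_fder E F (f : E -> F) u (L : blin E F) d C : 0 < d -> 0 <= C ->
  (forall k, `|k| < d -> `|f (u + k) - f u - L k| <= C * `|k| ^+ 2) -> fder f u L.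
Proof.
move=> d0 C0 fq e e0; have C1 : 0 < C + 1 by rewrite ltr_wpDl.
exists (Num.min d (e / (C + 1))); first by rewrite lt_min d0 divr_gt0.
move=> k; rewrite lt_min => /andP[/fq H]; rewrite ltr_pdivlMr // => /ltW ke.
apply: le_trans H _; rewrite expr2 mulrA ler_wpM2r //.
by apply: le_trans ke; rewrite mulrC ler_wpM2l // lerDl.
Qed.

Lemma PSc_fder0 E Z r M a (f : E -> Z) : 0 < r -> PSc r M a f ->
  fder f 0 (a 1%N : blin E Z).
Proof.
move=> r0 aP; have a0 := PSc_at0 (ltW r0) aP; have [aM af] := aP.
have M0 := PS_ge0 (ex_intro _ a aP).
apply: (@quad_fder _ _ _ _ _ r (M / r ^+ 2)) => //;
  first by rewrite divr_ge0 // exprn_ge0 // ltW.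
move=> k kr; rewrite add0r -a0.
have -> : f k - a 0%N - (a 1%N : blin E Z) k = f k - (a 0%N + (a 1%N : blin E Z) k)
  by lmod R Z.
apply: seqlim_le (af k (ltW kr)) _; exists 2%N => -[|[|N]] // _.
rewrite !big_ord_recl /=; set S := (X in _ + (_ + X)).
have -> : a 0%N + ((a 1%N : blin E Z) k + S) - (a 0%N + (a 1%N : blin E Z) k) = S by lmod R Z.
apply: le_trans (ler_norm_sum _ _ _) _.
rewrite mulrAC ler_pdivlMr ?exprn_gt0 // mulrC [leRHS]mulrC.
apply: le_trans (ler_wpM2l (exprn_ge0 _ (normr_ge0 k)) (aM N.+2)).
rewrite !big_ord_recl /= mulr_sumr mulrDr mulrDr -[leLHS]add0r lerD //.
  by rewrite mulr_ge0 ?exprn_ge0 // mulr_ge0 // exprn_ge0 // ltW.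
rewrite -[leLHS]add0r lerD //.
  by rewrite mulr_ge0 ?exprn_ge0 // mulr_ge0 // exprn_ge0 // ltW.
rewrite mulr_sumr; apply: ler_sum => i _.
change (r ^+ 2 * `|mdiag (a i.+2) k| <= `|k| ^+ 2 * (`|a i.+2| * r ^+ i.+2)).
apply: le_trans (ler_wpM2l (exprn_ge0 2 (ltW r0)) (mdiag_norm _ _)) _.
rewrite !exprS expr0.
have -> : r * (r * 1) * (`|a i.+2| * (`|k| * (`|k| * `|k| ^+ i))) =
  `|k| * (`|k| * 1) * (`|a i.+2| * (r * (r * `|k| ^+ i))) by ring.
rewrite ler_wpM2l ?mulr_ge0 // ler_wpM2l // !(ler_pM2l r0).
by rewrite lerXn2r // ?nnegrE // ltW.
Qed.

(** The iteration converges in the majorant norm at one fixed radius: the linear part [b] of N in y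
    contributes the factor 1/2 and the part of degree at least 2 contributes 1/4, so increments
    shrink by 3/4. [PS_sum] adds them, and the sum is [psi] because the iterates converge to it
    pointwise. *)
Lemma PS_fix E Z (N : E * Z -> Z) (psi : E -> Z) R0 M rho d : banach Z -> 0 < R0 ->
  PS R0 M N -> N 0 = 0 -> 0 < d -> 0 < rho ->
  (forall h, `|h| < d -> [/\ `|psi h| < rho / 2, psi h = N (h, psi h) &
      half_lipschitz rho (fun y => N (h, y))]) ->
  exists2 r, 0 < r & exists M', PS r M' psi.
Proof.
move=> bZ R00 NP N0 d0 rho0 psiP; have [a aP] := NP; have M0 := PS_ge0 NP.
have a0 : a 0%N = 0 by rewrite (PSc_at0 (ltW R00) aP).
have a1 := PSc_fder0 R00 aP.
pose b := compb (a 1%N : blin (E * Z)%type Z) (inrb E Z).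
have b2 : `|b| <= 2^-1.
  apply: (@fder_half_le _ _ _ (fun y => N (0, y)) 0 b rho rho0).
    by apply: (@fder_comp _ _ _ _ N (inrb E Z) 0); [exact: fder_blin|rewrite blin0].
  move=> k kr; rewrite add0r.
  have [_ _ Nl] : [/\ `|psi 0| < rho / 2, psi 0 = N (0, psi 0)
    & half_lipschitz rho (fun y => N (0, y))].
    by apply: psiP; rewrite normr0.
  by have := Nl k 0 kr; rewrite normr0 subr0; exact.
pose K := 1 + 4 * M / R0.
have K1 : 1 <= K by rewrite lerDl divr_ge0 ?mulr_ge0 // ltW.
have K0 : 0 < K by apply: lt_le_trans K1.
(* Each bound has one use: R0 for the series of N, d / 2 to keep |h| < d, the third for 2 s <= R0,
   the fourth for the factor 1/4 in [sM]. *)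
pose r := Num.min (Num.min R0 (d / 2)) (Num.min (R0 / 2 / K) (R0 ^+ 2 / (16 * (M + 1) * K))).
have M10 : 0 < M + 1 by rewrite ltr_wpDl.
have r0 : 0 < r by rewrite !lt_min R00 !divr_gt0 ?exprn_gt0 ?mulr_gt0.
have [rR [rd [rK rM]]] : r <= R0 /\ r <= d / 2 /\ r <= R0 / 2 / K /\
    r <= R0 ^+ 2 / (16 * (M + 1) * K).
  by rewrite /r !ge_min !lexx ?orbT.
have r0' := ltW r0.
(* [tau] bounds the first iterate N (h, 0) by [PS_shrink]; all iterates are then bounded by 4 tau,
   the sum of tau (3/4)^k, and the pair formed by h and an iterate by r + 4 tau, which is s. *)
pose tau := r / R0 * M; have tau0 : 0 <= tau by rewrite mulr_ge0 // divr_ge0 // ltW.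
pose s := r * K.
have s0 : 0 < s by rewrite mulr_gt0.
have sR : 2 * s <= R0 by move: rK; rewrite ler_pdivlMr // -/s; lra.
have sE : s = r + 4 * tau by rewrite /s /K /tau; field; rewrite gt_eqF.
have sM : 4 * s / R0 ^+ 2 * M <= 4^-1.
  rewrite mulrAC ler_pdivrMr ?exprn_gt0 //.
  move: rM; rewrite ler_pdivlMr ?mulr_gt0 // => H.
  have -> : 4 * s * M = 4 * M * s by ring.
  have : r * (16 * (M + 1) * K) = 16 * (M + 1) * s by rewrite /s; ring.
  have := mulr_ge0 M0 (ltW s0); move: H; set w := r * (16 * _ * _); set v := R0 ^+ 2.
  by move=> H1 H2 H3; have -> : 4 * M * s = 4 * (M * s) by [ring]; nra.
pose p k h := iter k (fun y => N (h, y)) 0.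
have pairP k : PS r (4 * tau) (p k) -> PS r s (fun h => (h, p k h)).
  move=> kP; rewrite sE.
  apply: (@PS_ext _ _ _ _ (fun h => inlb E Z h + inrb E Z (p k h))).
    by move=> h _; rewrite pairE.
  apply: PS_add => //.
    by apply: PS_post1 => //; [apply: blin_norm_le => // u; exact: inlb_bound|exact: PS_id].
  by apply: PS_post1 => //; apply: blin_norm_le => // u; exact: inrb_bound.
have Q := PSc_drop1 (ltW R00) aP a0.
have NE : forall pr, N pr = (N pr - (a 1%N : blin (E * Z)%type Z) pr) + (a 1%N :
  blin (E * Z)%type Z) pr.
  by move=> pr; rewrite subrK.
have diffP k dk : PS r (4 * tau) (p k) -> PS r (4 * tau) (p k.+1) ->
    PS r dk (fun h => p k.+1 h - p k h) ->
    PS r (3/4 * dk) (fun h => p k.+2 h - p k.+1 h).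
  move=> kP k1P dP; have dk0 := PS_ge0 dP.
  have H1 : PS r dk (fun h => (h, p k.+1 h) - (h, p k h)).
    apply: (@PS_ext _ _ _ _ (fun h => inrb E Z (p k.+1 h - p k h))).
      by move=> h _; rewrite -[RHS]/(h - h, p k.+1 h - p k h) subrr.
    by apply: PS_post1 => //; apply: blin_norm_le => // u; exact: inrb_bound.
  have H2 := PS_comp_diff bZ r0 s0 sR Q a0 (erefl _) (pairP _ k1P) (pairP _ kP) H1.
  have H3 := PS_post b r0' dP.
  apply: PS_le (PS_ext _ (PS_add r0' H2 H3)).
    have -> : 3 / 4 * dk = 4^-1 * dk + 2^-1 * dk by field.
    by rewrite lerD // ler_wpM2r.
  move=> h _; rewrite /p !iterS -/(p k h).
  have -> : b (N (h, p k h) - p k h) = (a 1%N : blin (E * Z)%type Z) (h, N (h, p k h))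
      - (a 1%N : blin (E * Z)%type Z) (h, p k h).
    by rewrite -blinB -[_ - (h, p k h)]/(h - h, N (h, p k h) - p k h) subrr.
  by lmod R Z.
have th0 : (0 : R) <= 3 / 4 by [].
have main k : PS r (4 * tau * (1 - (3/4) ^+ k)) (p k) /\
    PS r (tau * (3/4) ^+ k) (fun h => p k.+1 h - p k h).
  elim: k => [|k [IH1 IH2]].
    rewrite expr0 subrr mulr0 mulr1; split.
      exact: PS_zero.
    apply: (@PS_ext _ _ _ _ (fun h => N (inlb E Z h))).
      by move=> h _; rewrite /p /= subr0.
    apply: PS_shrink => //.
    apply: (PS_comp bZ R00 NP).
    by apply: PS_post1; [exact: ltW|apply: blin_norm_le => // u;
      exact: inlb_bound|apply: PS_id; exact: ltW].
  have IH3 : PS r (4 * tau * (1 - (3/4) ^+ k.+1)) (p k.+1).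
    apply: PS_le (PS_ext _ (PS_add r0' IH1 IH2)).
      by rewrite exprS le_eqVlt; apply/orP; left; apply/eqP; field.
    by move=> h _; rewrite addrC subrK.
  have le4 j : PS r (4 * tau * (1 - (3/4) ^+ j)) (p j) -> PS r (4 * tau) (p j).
    have q1 : 1 - (3/4) ^+ j <= 1 :> R by rewrite lerBlDr lerDl exprn_ge0.
    by move=> H; apply: PS_le H; rewrite ler_piMr // mulr_ge0.
  split=> //; have -> : tau * (3/4) ^+ k.+1 = 3/4 * (tau * (3/4) ^+ k) by rewrite exprS; ring.
  by apply: diffP => //; exact: le4.
exists r => //; exists (4 * tau).
apply: (@PS_sum _ _ r _ (fun k => tau * (3/4) ^+ k) (fun k h => p k.+1 h - p k h)) => //.
- by move=> k; have [] := main k.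
- move=> J; have -> : \sum_(k < J) tau * (3/4) ^+ k = 4 * tau * (1 - (3/4) ^+ J).
    elim: J => [|J IH]; first by rewrite big_ord0 expr0 subrr mulr0.
    by rewrite big_ord_recr /= IH exprS; field.
  have q1 : 1 - (3/4) ^+ J <= 1 :> R by rewrite lerBlDr lerDl exprn_ge0.
  by rewrite ler_piMr // mulr_ge0.
move=> h hr.
have -> : (fun J => \sum_(k < J) (p k.+1 h - p k h)) = (fun J => p J h).
  apply/funext => J; elim: J => [|J IH]; first by rewrite big_ord0.
  by rewrite big_ord_recr /= IH addrC subrK.
have hd : `|h| < d by lra.
have [h1 h2 h3] := psiP h hd.
move=> e e0; have [N1 HN] := half_iter_small `|psi h| e0; exists N1 => n /HN.
by rewrite normr_id => H; have [H1 _] := half_iter_dist n h3 h1 h2; apply: le_trans H1 H.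
Qed.

End PowerSeries.

(** * Analytic maps: derivatives, composition, division, fixed points *)

Section AnalyticFunctions.
Context {R : realType}.
Implicit Types E F G V W X Z : normedModType R.

(** Halving the radius turns a common bound M on the terms into the geometric majorant M / 2^m, of
    sum 2 M. *)
Lemma analytic_PS E Z (f : E -> Z) u : analytic_at f u <->
  exists2 r, 0 < r & exists M, PS r M (fun h => f (u + h)).
Proof.
split=> [[r r0 [a [[M aM] af]]]|[r r0 [M [a aP]]]].
  have r20 : 0 < r / 2 by rewrite divr_gt0.
  exists (r / 2) => //; exists (2 * M), a; split.
    have M0 : 0 <= M by apply: le_trans (aM 0%N); rewrite expr0 mulr1.
    move=> N; apply: (@le_trans _ _ (2 * M * (1 - 2^-1 ^+ N))).
      elim: N => [|N IH]; first by rewrite big_ord0 expr0 subrr mulr0.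
      rewrite big_ord_recr /= exprMn exprS.
      have : `|a N| * (r ^+ N * 2^-1 ^+ N) <= M * 2^-1 ^+ N.
        by rewrite mulrA ler_wpM2r // exprn_ge0 // invr_ge0.
      have -> : 2 * M * (1 - 2^-1 * 2^-1 ^+ N) = 2 * M * (1 - 2^-1 ^+ N)
        + M * 2^-1 ^+ N by field.
      exact: lerD.
    have q1 : 1 - 2^-1 ^+ N <= 1 :> R by rewrite lerBlDr lerDl exprn_ge0 // invr_ge0.
    by rewrite ler_piMr // mulr_ge0.
  move=> h hr; apply/seqlimP.
  have -> : (fun N => \sum_(m < N) mdiag (a m) h) = series (fun m => mdiag (a m) h).
    by apply/funext => N; rewrite /series /= big_mkord.
  by apply: af; lra.
exists r => //; exists a; split.
  by exists M => m; exact: PSc_coef (ltW r0) aP.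
move=> h /ltW hr; have [_ /(_ h hr)/seqlimP] := aP.
have -> // : (fun N => \sum_(m < N) mdiag (a m) h) = series (fun m => mdiag (a m) h).
by apply/funext => N; rewrite /series /= big_mkord.
Qed.

Fixpoint mdiagL E Z (E' : normedModType R) m : blin E' (mlin m E Z) -> E -> blin E' Z :=
  match m return blin E' (mlin m E Z) -> E -> blin E' Z with
  | 0%N => fun A _ => A
  | m'.+1 => fun A h => @mdiagL E Z E' m' (flip1 A h) h
  end.

Lemma mdiagLE E Z E' m (A : blin E' (mlin m E Z)) h k :
  mdiagL A h k = mdiag (A k) h.
Proof. by elim: m A => //= m IH A; rewrite IH. Qed.

(** The derivative of the homogeneous polynomial of [a]: the sum over the positions of the argument
    that is freed, the others being h. The coefficients are not symmetric, so this is not m times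
    one term. *)
Fixpoint mderiv E Z m : mlin m E Z -> E -> blin E Z :=
  match m return mlin m E Z -> E -> blin E Z with
  | 0%N => fun _ _ => 0
  | m'.+1 => fun (a : blin E (mlin m' E Z)) h => mdiagL a h + @mderiv E Z m' (a h) h
  end.

Lemma PS_mdiagL E Z E' m r A (al : E -> blin E' (mlin m E Z)) : banach Z -> 0 < r ->
  PS r A al -> PS r (A * r ^+ m) (fun h => mdiagL (al h) h).
Proof.
move=> bZ r0; elim: m A al => [|m IH] A al alP; first by rewrite expr0 mulr1.
rewrite exprS mulrA; apply: (IH _ (fun h => flip1 (al h) h)).
apply: (@PS_eval _ _ _ _ _ _ _ (fun h => flipL E' E (mlin m E Z) (al h)) (fun h => h)) => //.
- by apply: banach_blin; exact: banach_mlin.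
- by apply: PS_post1 => //; [exact: ltW|exact: flipL_norm].
- exact: PS_id (ltW r0).
Qed.

Lemma PS_mderiv E Z m r A (al : E -> mlin m E Z) : banach Z -> 0 < r ->
  PS r A al -> PS r (A * ((2 * r) ^+ m / r)) (fun h => mderiv (al h) h).
Proof.
move=> bZ r0; elim: m A al => [|m IH] A al alP.
  apply: PS_le (@PS_zero _ _ _ _).
  by rewrite expr0 mulr_ge0 ?(PS_ge0 alP) // divr_ge0 // ltW.
have A0 := PS_ge0 alP.
have H1 := PS_mdiagL bZ r0 (alP : PS r A (al : E -> blin E (mlin m E Z))).
have H2 := PS_eval (@banach_mlin _ E Z m bZ) r0 (alP : PS r A (al :
  E -> blin E (mlin m E Z))) (PS_id _ (ltW r0)).
apply: PS_le (PS_add (ltW r0) H1 (IH _ _ H2)).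
have sm : r ^+ m <= (2 * r) ^+ m by rewrite lerXn2r // ?nnegrE ?mulr_ge0 //; lra.
have -> : A * ((2 * r) ^+ m.+1 / r) = A * (2 * (2 * r) ^+ m).
  by rewrite exprS; field; rewrite gt_eqF.
have -> : A * r ^+ m + A * r * ((2 * r) ^+ m / r) = A * (r ^+ m + (2 * r) ^+ m).
  by field; rewrite gt_eqF.
by rewrite ler_wpM2l //; lra.
Qed.

Lemma mdiag_lip E Z m (a : mlin m E Z) r h k : 0 < r -> `|h| <= r -> `|k| <= r ->
  `|mdiag a (h + k) - mdiag a h| <= `|a| * ((2 * r) ^+ m / r) * `|k|.
Proof.
move=> r0 hr kr; have hk2 : `|h + k| <= 2 * r.
  by apply: le_trans (ler_normD _ _) _; lra.
elim: m a => [|m IH] a /=.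
  by rewrite subrr normr0 !mulr_ge0 ?invr_ge0 // ltW.
pose a' : blin E (mlin m E Z) := a.
have -> : mdiag (a' (h + k)) (h + k) - mdiag (a' h) h =
   mdiag (a' k) (h + k) + (mdiag (a' h) (h + k) - mdiag (a' h) h).
  by rewrite blinD mdiagD; lmod R Z.
apply: le_trans (ler_normD _ _) _.
have H1 := le_trans (mdiag_norm_le (a' k) hk2) (ler_wpM2r (exprn_ge0 m (ltW (mulr_gt0 (ltr0Sn _ 1) r0))) (blin_le a' k)).
have H2 : `|mdiag (a' h) (h + k) - mdiag (a' h) h| <= `|a'| * r * ((2 * r) ^+ m / r) * `|k|.
  apply: le_trans (IH _) _; apply: ler_wpM2r => //; apply: ler_wpM2r.
    by rewrite divr_ge0 ?exprn_ge0 ?mulr_ge0 // ltW.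
  by apply: le_trans (blin_le _ _) _; rewrite ler_wpM2l.
apply: le_trans (lerD H1 H2) _; rewrite -/a' exprS le_eqVlt; apply/orP; left; apply/eqP.
by field; rewrite gt_eqF.
Qed.

Lemma mdiag_taylor E Z m (a : mlin m E Z) r h k : 0 < r -> `|h| <= r -> `|k| <= r ->
  `|mdiag a (h + k) - mdiag a h - mderiv a h k| <= `|a| * ((2 * r) ^+ m / r ^+ 2) * `|k| ^+ 2.
Proof.
move=> r0 hr kr; elim: m a => [|m IH] a /=.
  rewrite subrr -[X in _ - X]/(0 : Z).
  by rewrite subr0 normr0 expr0 !mulr_ge0 ?invr_ge0 ?exprn_ge0 // ltW.
pose a' : blin E (mlin m E Z) := a; rewrite -/a'.
rewrite -[X in _ - X]/(mdiagL a' h k + mderiv (a' h) h k) mdiagLE.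
have -> : mdiag (a' (h + k)) (h + k) - mdiag (a' h) h - (mdiag (a' k) h + mderiv (a' h) h k) =
   (mdiag (a' h) (h + k) - mdiag (a' h) h - mderiv (a' h) h k) +
   (mdiag (a' k) (h + k) - mdiag (a' k) h).
  by rewrite blinD mdiagD; lmod R Z.
apply: le_trans (ler_normD _ _) _.
have r2 : 0 <= (2 * r) ^+ m by rewrite exprn_ge0 // mulr_ge0 // ltW.
have H1 : `|mdiag (a' h) (h + k) - mdiag (a' h) h - mderiv (a' h) h k| <=
    `|a'| * r * ((2 * r) ^+ m / r ^+ 2) * `|k| ^+ 2.
  apply: le_trans (IH _) _; apply: ler_wpM2r; first exact: exprn_ge0.
  apply: ler_wpM2r; first by rewrite divr_ge0 // exprn_ge0 // ltW.
  by apply: le_trans (blin_le _ _) _; rewrite ler_wpM2l.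
have H2 : `|mdiag (a' k) (h + k) - mdiag (a' k) h| <= `|a'| * `|k| * ((2 * r) ^+ m / r) * `|k|.
  apply: le_trans (mdiag_lip _ r0 hr kr) _.
  by rewrite !ler_wpM2r ?divr_ge0 // ?(ltW r0) //; exact: blin_le.
apply: le_trans (lerD H1 H2) _; rewrite [_ ^+ m.+1]exprS le_eqVlt; apply/orP; left; apply/eqP.
by field; rewrite gt_eqF.
Qed.

(** Termwise differentiation: the factors 2^k in the bounds for [mderiv] and in the Taylor estimate
    are absorbed by giving up half of the radius. *)
Lemma PS_fder E Z r M (f : E -> Z) : banach Z -> 0 < r -> PS (2 * r) M f ->
  exists2 D : E -> blin E Z, PS r (M / r) D & forall h, `|h| < r -> fder f h (D h).
Proof.
move=> bZ r0 [a aP]; have [aM af] := aP; have M0 := PS_ge0 (ex_intro _ a aP).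
have r0' := ltW r0.
have DP k : PS r (`|a k| * ((2 * r) ^+ k / r)) (fun h => mderiv (a k) h).
  by apply: (@PS_mderiv _ _ _ _ _ (fun=> a k)) => //; exact: PS_cst.
have DM K : \sum_(k < K) `|a k| * ((2 * r) ^+ k / r) <= M / r.
  have -> : \sum_(k < K) `|a k| * ((2 * r) ^+ k / r) = (\sum_(k < K) `|a k| * (2 * r)
    ^+ k) / r.
    by rewrite mulr_suml; apply: eq_bigr => k _; rewrite mulrA.
  by rewrite ler_wpM2r // invr_ge0.
have : forall h, exists D, `|h| <= r -> seqlim (fun K => \sum_(k < K) mderiv (a k) h) D.
  move=> h; have [hr|_] := leP `|h| r; last by exists 0.
  have [|D DL] := @banach_summable _ _ (@banach_blin _ E Z bZ) (fun k => mderiv (a k) h)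
    (M / r).
    by move=> K; apply: le_trans (DM K); apply: ler_sum => k _; exact: PS_norm (DP k) hr.
  by exists D.
move=> /choice[D DL]; exists D.
  by apply: (@PS_sum _ _ _ r _ _ (fun k h => mderiv (a k) h) D _ r0 DP DM) => //;
    exact: banach_blin.
move=> h hr; apply: (@quad_fder _ _ _ _ _ _ r (M / r ^+ 2)) => //.
  by rewrite divr_ge0 // exprn_ge0.
move=> k kr; have hr' := ltW hr; have kr' := ltW kr.
have hkr : `|h + k| <= 2 * r by apply: le_trans (ler_normD _ _) _; lra.
have h2r : `|h| <= 2 * r by lra.
rewrite -[X in `|X|]subr0.
apply: (@seqlim_le _ _ (fun K => \sum_(m < K) (mdiag (a m) (h + k) - mdiag (a m)
  h - mderiv (a m) h k))).
  have -> : (fun K => \sum_(m < K) (mdiag (a m) (h + k) - mdiag (a m) h - mderiv (a m) h k)) =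
    (fun K => \sum_(m < K) mdiag (a m) (h + k) + (-1) *: \sum_(m < K) mdiag (a m) h
      + (-1) *: evb Z k (\sum_(m < K) mderiv (a m) h)).
    by apply/funext => K; rewrite !sumrB !scaleN1r /= blin_sumE.
  rewrite -[- f h]scaleN1r -[- D h k]scaleN1r.
  apply: seqlimD; first apply: seqlimD; first exact: af.
    by apply: seqlimZ; exact: af.
  by apply: seqlimZ; apply: seqlim_blin; exact: DL.
exists 0%N => K _; rewrite subr0 (le_trans (ler_norm_sum _ _ _)) //.
apply: (@le_trans _ _ (\sum_(m < K) `|a m| * (2 * r) ^+ m / r ^+ 2 * `|k| ^+ 2)).
  by apply: ler_sum => m _; rewrite -mulrA mulrA -mulrA mulrA;
    apply: le_trans (mdiag_taylor _ r0 hr' kr') _; rewrite !mulrA.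
by rewrite -!mulr_suml !ler_wpM2r ?invr_ge0 ?exprn_ge0.
Qed.

(** Around each point the derivative is the sum of the differentiated series; by uniqueness the
    globally chosen [df] agrees with it nearby, hence is analytic, and the induction continues in
    the larger target. *)
Lemma analytic_Ck m E Z (U : set E) (f : E -> Z) : banach Z -> eopen U ->
  (forall u, U u -> analytic_at f u) -> Ck m U f.
Proof.
move=> + oU; elim: m Z f => [|m IH] Z f bZ fU.
  apply: econt_Ck => u /fU/analytic_PS[r r0 [M fP]].
  have [a aP] := fP; have := fder_econt (PSc_fder0 r0 aP).
  by move=> H e e0; have [d d0 Hd] := H e e0; exists d => // k /Hd; rewrite add0r addr0.
have fd u : U u -> exists2 r, 0 < r & exists M D, PS r M D /\
    forall h, `|h| < r -> fder f (u + h) (D h).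
  move=> /fU/analytic_PS[r r0 [M fP]]; have r20 : 0 < r / 2 by rewrite divr_gt0.
  have rE : r = 2 * (r / 2) by field.
  rewrite rE in fP; have [D DP Df] := PS_fder bZ r20 fP.
  exists (r / 2) => //; exists (M / (r / 2)), D; split=> // h /Df H e e0.
  by have [d d0 Hd] := H e e0; exists d => // k /Hd; rewrite addrA.
have : forall u, exists L : blin E Z, U u -> fder f u L.
  move=> u; have [/fd[r r0 [M [D [_ Df]]]]|nU] := pselect (U u); last by exists 0.
  by exists (D 0) => _; have := Df 0; rewrite normr0 addr0; exact.
move=> /choice[df dfP]; apply/CkSP; exists df => //.
apply: IH; first exact: banach_blin.
move=> u Uu; have [r r0 [M [D [DP Df]]]] := fd u Uu; apply/analytic_PS.
have [d d0 Ud] := oU u Uu.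
have m0 : 0 < Num.min r d / 2 by rewrite divr_gt0 // lt_min r0.
exists (Num.min r d / 2) => //; exists M.
have mr : Num.min r d <= r by rewrite ge_min lexx.
have md : Num.min r d <= d by rewrite ge_min lexx orbT.
have := PS_radius (ltW m0) _ DP => /(_ ltac:(lra)).
apply: PS_ext => h hm; apply: fder_unique; first by apply: Df; lra.
by apply: dfP; apply: Ud; lra.
Qed.

Lemma analytic_comp E X Z (f : X -> Z) (p : E -> X) u : banach Z ->
  analytic_at p u -> analytic_at f (p u) -> analytic_at (f \o p) u.
Proof.
move=> bZ /analytic_PS[r r0 [M pP]] /analytic_PS[s s0 [M' fP]]; apply/analytic_PS.
have M0 := PS_ge0 pP.
have qP : PS r (M + `|p u|) (fun h => p (u + h) - p u).
  by apply: (PS_sub (ltW r0) pP); exact: PS_cst.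
have Mq : 0 < M + `|p u| + 1 by rewrite ltr_wpDl // addr_ge0.
(* [p (u + h) - p u] vanishes at h = 0, so shrinking the radius to t brings its majorant below the
   radius s of f at [p u]. *)
pose t := Num.min r (s * r / (M + `|p u| + 1)).
have t0 : 0 < t by rewrite lt_min r0 divr_gt0 // mulr_gt0.
have tr : t <= r by rewrite ge_min lexx.
exists t => //; exists M'.
have := PS_shrink r0 (ltW t0) tr _ qP; rewrite addr0 subrr => /(_ erefl) qP'.
have {}qP' : PS t s (fun h => p (u + h) - p u).
  apply: PS_le qP'; rewrite mulrAC ler_pdivrMr // .
  have : t <= s * r / (M + `|p u| + 1) by rewrite ge_min lexx orbT.
  rewrite ler_pdivlMr //; apply: le_trans.
  by rewrite ler_wpM2l ?(ltW t0) // lerDl.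
apply: PS_ext (PS_comp bZ t0 fP qP') => h _ /=.
by rewrite addrC subrK.
Qed.

Lemma analytic_near E Z (f : E -> Z) u : banach Z -> analytic_at f u ->
  exists2 d, 0 < d & forall v, `|v - u| < d -> analytic_at f v.
Proof.
move=> bZ /analytic_PS[r r0 [M fP]]; exists (r / 2); first by rewrite divr_gt0.
move=> v vr; apply/analytic_PS; exists (r / 2); first by rewrite divr_gt0.
exists M; have := @PS_shift _ E Z r (r / 2) M (fun h => f (u + h)) (v - u) bZ.
have -> : (fun h => f (u + (v - u + h))) = (fun h => f (v + h)).
  by apply/funext => h; congr f; lmod R E.
by apply => //; [rewrite divr_gt0|lra].
Qed.

Lemma analytic_blin E Z (L : blin E Z) u : analytic_at L u.
Proof.
apply/analytic_PS; exists 1 => //; exists (`|L u| + `|L| * 1).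
apply: PS_ext (PS_add ler01 (PS_cst _ _ (L u)) (PS_lin L ler01)) => h _.
by rewrite blinD.
Qed.

Lemma analytic_cst E Z (c : Z) (u : E) : analytic_at (fun _ : E => c) u.
Proof. by apply/analytic_PS; exists 1 => //; exists `|c|; exact: PS_cst. Qed.

Lemma analyticD E Z (f g : E -> Z) u : analytic_at f u -> analytic_at g u ->
  analytic_at (fun x => f x + g x) u.
Proof.
move=> /analytic_PS[r r0 [M fP]] /analytic_PS[s s0 [M' gP]]; apply/analytic_PS.
have m0 : 0 < Num.min r s by rewrite lt_min r0.
exists (Num.min r s) => //; exists (M + M').
by apply: (PS_add (ltW m0)); [apply: PS_radius fP|apply: PS_radius gP];
  rewrite ?(ltW m0) // ge_min lexx ?orbT.
Qed.

(* Telescoping: [mquot a h] is the coefficient of [ell h] in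
   [a (h, ..., h) - a (A0 h, ..., A0 h)] when [h = A0 h + ell h *: e]. *)
Fixpoint mquot E Z (A0 : E -> E) (e : E) m : mlin m E Z -> E -> Z :=
  match m return mlin m E Z -> E -> Z with
  | 0%N => fun _ _ => 0
  | m'.+1 => fun (a : blin E (mlin m' E Z)) h =>
      mdiag (a e) h + @mquot E Z A0 e m' (a (A0 h)) h
  end.

Lemma mquotE E Z (A0 : E -> E) (e : E) (c : R) m (a : mlin m E Z) h :
  h = A0 h + c *: e -> mdiag a h - mdiag a (A0 h) = c *: mquot A0 e a h.
Proof.
move=> hE; elim: m a => [|m IH] a /=; first by rewrite subrr scaler0.
pose a' : blin E (mlin m E Z) := a; rewrite -/a' scalerDr -IH.
have -> : a' h = a' (A0 h) + c *: a' e by rewrite {1}hE blinD blinZ.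
by rewrite mdiagD -[mdiag (c *: a' e) h]evdE blinZ evdE; lmod R Z.
Qed.

Lemma PS_mquot E Z (A0 : blin E E) (e : E) m r A (al : E -> mlin m E Z) : banach Z -> 0 < r ->
  `|A0| <= 1 -> `|e| <= 1 ->
  PS r A al -> PS r (A * ((2 * r) ^+ m / r)) (fun h => mquot A0 e (al h) h).
Proof.
move=> bZ r0 A01 e1; elim: m A al => [|m IH] A al alP.
  apply: PS_le (@PS_zero _ _ _ _).
  by rewrite expr0 mulr_ge0 ?(PS_ge0 alP) // divr_ge0 // ltW.
have A_0 := PS_ge0 alP; have bm := @banach_mlin _ E Z m bZ.
have alP' : PS r A (al : E -> blin E (mlin m E Z)) := alP.
have H1 : PS r (A * r ^+ m) (fun h => mdiag ((al h : blin E (mlin m E Z)) e) h).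
  apply: (@PS_mdiag _ _ _ _ _ _ _ _ (fun h => evb (mlin m E Z) e (al h)) (fun h => h)) => //.
    by apply: (PS_post1 (ltW r0) _ alP'); apply: le_trans (evb_norm _ _) e1.
  exact: PS_id (ltW r0).
have H2 : PS r (A * r) (fun h => (al h : blin E (mlin m E Z)) (A0 h)).
  apply: PS_eval => //; exact: (PS_post1 (ltW r0) A01 (PS_id _ (ltW r0))).
apply: PS_le (PS_add (ltW r0) H1 (IH _ _ H2)).
have sm : r ^+ m <= (2 * r) ^+ m by rewrite lerXn2r // ?nnegrE ?mulr_ge0 //; lra.
have -> : A * ((2 * r) ^+ m.+1 / r) = A * (2 * (2 * r) ^+ m).
  by rewrite exprS; field; rewrite gt_eqF.
have -> : A * r ^+ m + A * r * ((2 * r) ^+ m / r) = A * (r ^+ m + (2 * r) ^+ m).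
  by field; rewrite gt_eqF.
by rewrite ler_wpM2l //; lra.
Qed.

(** Each homogeneous term is divided by [ell] through [mquot]; since f vanishes on the range of [A0]
    near 0, the series of subtracted terms sums to 0. As for derivatives, convergence of the
    quotients costs half of the radius. *)
Lemma hadamard_analytic E Z (f : E -> Z) (A0 : blin E E) (ell : blin E R^o) (e : E) d :
  banach Z -> `|A0| <= 1 -> `|e| <= 1 -> (forall h, h = A0 h + ell h *: e) ->
  0 < d -> (forall h, `|h| < d -> f (A0 h) = 0) -> analytic_at f 0 ->
  exists g : E -> Z, exists2 r, 0 < r & analytic_at g 0 /\
    forall h, `|h| < r -> f h = ell h *: g h.
Proof.
move=> bZ A01 e1 hE d0 f0 /analytic_PS[s s0 [M fP]].
have {}fP : PS s M f by apply: PS_ext fP => h _; rewrite add0r.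
pose r := Num.min s d / 4.
have ms : Num.min s d <= s by rewrite ge_min lexx.
have md : Num.min s d <= d by rewrite ge_min lexx orbT.
have m0 : 0 < Num.min s d by rewrite lt_min s0.
have r0 : 0 < r by rewrite divr_gt0.
have r2 : 2 * r <= s by rewrite /r; lra.
have rd : r < d by rewrite /r; lra.
have [a aP] := PS_radius (ltW (mulr_gt0 (ltr0Sn _ 1) r0)) r2 fP; have [aM af] := aP.
have DP k : PS r (`|a k| * ((2 * r) ^+ k / r)) (fun h => mquot A0 e (a k) h).
  by apply: (@PS_mquot _ _ _ _ _ _ _ (fun=> a k)) => //; exact: PS_cst.
have DM K : \sum_(k < K) `|a k| * ((2 * r) ^+ k / r) <= M / r.
  have -> : \sum_(k < K) `|a k| * ((2 * r) ^+ k / r) = (\sum_(k < K) `|a k| * (2 * r)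
    ^+ k) / r.
    by rewrite mulr_suml; apply: eq_bigr => k _; rewrite mulrA.
  by rewrite ler_wpM2r // invr_ge0 ltW.
have : forall h, exists D, `|h| <= r -> seqlim (fun K => \sum_(k < K) mquot A0 e (a k) h) D.
  move=> h; have [hr|_] := leP `|h| r; last by exists 0.
  have [|D DL] := @banach_summable _ _ bZ (fun k => mquot A0 e (a k) h) (M / r).
    by move=> K; apply: le_trans (DM K); apply: ler_sum => k _; exact: PS_norm (DP k) hr.
  by exists D.
move=> /choice[g gL]; exists g, r => //; split.
  apply/analytic_PS; exists r => //; exists (M / r).
  apply: (@PS_ext _ _ _ _ _ g); first by move=> h _; rewrite add0r.
  by apply: (@PS_sum _ _ _ r _ _ (fun k h => mquot A0 e (a k) h) g _ r0 DP DM).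
move=> h /ltW hr.
have A0h : `|A0 h| <= r.
  by apply: le_trans (blin_le _ _) _; apply: le_trans hr; rewrite ler_piMl.
have fA : f h = f h + (-1) *: f (A0 h) by rewrite f0 ?scaler0 ?addr0 //; lra.
rewrite fA; apply: (@seqlim_unique _ _ (fun K => \sum_(k < K) mdiag (a k) h + (-1)
  *: \sum_(k < K) mdiag (a k) (A0 h))).
  by apply: seqlimD; [|apply: seqlimZ]; apply: af; lra.
have -> : (fun K => \sum_(k < K) mdiag (a k) h + (-1) *: \sum_(k < K) mdiag (a k) (A0 h)) =
    (fun K => ell h *: \sum_(k < K) mquot A0 e (a k) h).
  apply/funext => K; rewrite scaleN1r -sumrB scaler_sumr; apply: eq_bigr => k _.
  exact: mquotE.
by apply: seqlimZ; exact: gL.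
Qed.

(** The problem is recentred at (h0, psi h0). Continuity of [psi], from [fix_Ck0], keeps its
    increment in the small ball where [PS_fix] applies. *)
Lemma fix_analytic E Z (U : set E) (B : set Z) (N : E * Z -> Z) (psi : E -> Z) :
  banach Z -> eopen U -> eopen B ->
  (forall h, U h -> B (psi h)) -> (forall h, U h -> psi h = N (h, psi h)) ->
  (forall h y y', U h -> B y -> B y' -> `|N (h, y) - N (h, y')| <= 2^-1 * `|y - y'|) ->
  (forall p, U p.1 -> B p.2 -> analytic_at N p) -> forall h, U h -> analytic_at psi h.
Proof.
move=> bZ oU oB Bpsi psiE Nl NA h0 Uh0.
have oUB : eopen [set p : E * Z | U p.1 /\ B p.2].
  move=> [h y] [/= /oU[d d0 Ud] /oB[d' d'0 Bd]].
  exists (Num.min d d'); first by rewrite lt_min d0.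
  move=> [k z]; rewrite norm_pair_lt !lt_min => /andP[/andP[kd _] /andP[_ zd]].
  by split; [exact: Ud|exact: Bd].
have NC : Ck 0 [set p | U p.1 /\ B p.2] N.
  by apply: analytic_Ck => // p [Up Bp]; exact: NA.
have psiC := Ck_econt (fix_Ck0 oU Bpsi psiE Nl NC) Uh0.
have /analytic_PS[R0 R00 [M NP]] := NA (h0, psi h0) Uh0 (Bpsi _ Uh0).
pose N' (p : E * Z) := N ((h0, psi h0) + p) - psi h0.
have N'P : PS R0 (M + `|psi h0|) N' by apply: PS_sub => //; [exact: ltW|exact: PS_cst].
have [rho rho0 Brho] := oB _ (Bpsi _ Uh0).
have rho40 : 0 < rho / 4 by rewrite divr_gt0.
have [d d0 psid] := psiC _ rho40; have [d' d'0 Ud] := oU _ Uh0.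
have [||||r r0 [M' psiP]] := @PS_fix _ E Z N' (fun h => psi (h0 + h) - psi h0) R0
   (M + `|psi h0|) rho (Num.min d d') bZ R00 N'P.
- by rewrite /N' addr0 -psiE // subrr.
- by rewrite lt_min d0.
- exact: rho0.
- move=> h; rewrite lt_min => /andP[/psid hd /Ud Uh]; split.
  + by lra.
  + rewrite /N' -[(h0, psi h0) + _]/(h0 + h, psi h0 + (psi (h0 + h) - psi h0)).
    by rewrite [psi h0 + _]addrC subrK -psiE.
  + move=> y y' yr y'r; rewrite /N' -[(h0, psi h0) + (h, y)]/(h0 + h, psi h0 + y).
    rewrite -[(h0, psi h0) + (h, y')]/(h0 + h, psi h0 + y').
    rewrite opprB addrA subrK.
    have -> : y - y' = (psi h0 + y) - (psi h0 + y') by lmod R Z.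
    by apply: Nl => //; exact: Brho.
apply/analytic_PS; exists r => //; exists (M' + `|psi h0|).
apply: PS_ext (PS_add (ltW r0) psiP (PS_cst _ _ (psi h0))) => h _.
by rewrite subrK.
Qed.

End AnalyticFunctions.

(** * Splittings of Banach spaces *)

Section RowVectors.
Context {R : realType}.
Implicit Types n : nat.

Lemma rV_coord_le n (x : 'rV[R]_n) i : `|x ord0 i| <= `|x|.
Proof.
rewrite [leRHS]/Num.norm /= mx_normrE.
exact: (le_bigmax _ (fun ij : 'I_1 * 'I_n => `|x ij.1 ij.2|) (ord0, i)).
Qed.

Lemma rV_norm_le n (x : 'rV[R]_n) e : 0 <= e -> (forall i, `|x ord0 i| <= e) -> `|x| <= e.
Proof.
move=> e0 xe; rewrite [leLHS]/Num.norm /= mx_normrE.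
by apply: bigmax_le => // -[i j] _; rewrite /= ord1.
Qed.

(** Row vectors carry the sup norm. Every estimate is made for it, and this comparison turns balls
    and remainders into Euclidean ones at the end. *)
Lemma rV_norm_le_eucl n (x : 'rV[R]_n) : `|x| <= eucl_norm x.
Proof.
apply: rV_norm_le => [|i]; first exact: sqrtr_ge0.
rewrite -sqrtr_sqr ler_sqrt.
  by rewrite (bigD1 i) //= lerDl sumr_ge0 // => j _; exact: sqr_ge0.
by apply: sumr_ge0 => j _; exact: sqr_ge0.
Qed.

Lemma banach_R : banach (R^o : normedModType R).
Proof. exact: (@complete_banach R (R^o : completeNormedModType R)). Qed.

Lemma banach_rV n : banach ('rV[R]_n : normedModType R).
Proof.
move=> u uC.
have uCi i : seqcauchy (fun k => u k ord0 i : R^o).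
  move=> e e0; have [N uN] := uC e e0; exists N => p q Np Nq.
  by have := rV_coord_le (u p - u q) i; rewrite !mxE => /le_trans; apply; exact: uN.
have /choice[l lP] : forall i, exists l, seqlim (fun k => u k ord0 i : R^o) l.
  by move=> i; apply: banach_R.
exists (\row_i l i) => e e0; have [N uN] := uC e e0; exists N => k Nk.
apply: rV_norm_le (ltW e0) _ => i; rewrite !mxE distrC.
apply: seqlim_le (lP i) _; exists N => q Nq.
by have := rV_coord_le (u q - u k) i; rewrite !mxE => /le_trans; apply; exact: uN.
Qed.

Lemma banach_prod (E F : normedModType R) : banach E -> banach F -> banach (E * F)%type.
Proof.
move=> bE bF u uC.
have [|x xl] := bE (fun n => (u n).1).
  move=> e e0; have [N uN] := uC e e0; exists N => p q Np Nq.
  by have := fstb_bound (u p - u q); rewrite mul1r => /le_trans; apply; exact: uN.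
have [|y yl] := bF (fun n => (u n).2).
  move=> e e0; have [N uN] := uC e e0; exists N => p q Np Nq.
  by have := sndb_bound (u p - u q); rewrite mul1r => /le_trans; apply; exact: uN.
exists (x, y) => e e0; have [N xN] := xl e e0; have [N' yN] := yl e e0.
exists (maxn N N') => n; rewrite geq_max => /andP[/xN H1 /yN H2].
by rewrite prod_normE /= ge_max H1.
Qed.

Lemma coordb_linear n (i : 'I_n) : linear (fun x : 'rV[R]_n => x ord0 i : R^o).
Proof. by move=> a x y; rewrite !mxE. Qed.

Lemma coordb_bound n (i : 'I_n) (x : 'rV[R]_n) : `|x ord0 i : R^o| <= 1 * `|x|.
Proof. by rewrite mul1r rV_coord_le. Qed.

Definition coordb n (i : 'I_n) : blin 'rV[R]_n R^o :=
  mkblin (@coordb_linear n i) (@coordb_bound n i).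

Definition combb n (E : normedModType R) (x : 'I_n -> E) : blin 'rV[R]_n E :=
  \sum_i compb (lineb (x i)) (coordb i).

Lemma combbE n (E : normedModType R) (x : 'I_n -> E) s :
  combb x s = \sum_i s ord0 i *: x i.
Proof. by rewrite /combb blin_sumE. Qed.

Lemma mulmxb_linear n m (M : 'M[R]_(n, m)) : linear (fun v : 'rV[R]_n => v *m M).
Proof. by move=> a u v; rewrite mulmxDl scalemxAl. Qed.

Lemma mulmxb_bound n m (M : 'M[R]_(n, m)) (v : 'rV[R]_n) :
  `|v *m M| <= (\sum_i \sum_j `|M i j|) * `|v|.
Proof.
have S0 : 0 <= \sum_i \sum_j `|M i j| by apply: sumr_ge0 => i _; apply: sumr_ge0.
apply: rV_norm_le => [|j]; first by rewrite mulr_ge0.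
rewrite mxE (le_trans (ler_norm_sum _ _ _)) // mulr_suml; apply: ler_sum => i _.
rewrite normrM mulrC ler_pM //; last exact: rV_coord_le.
by rewrite (bigD1 j) //= lerDl sumr_ge0.
Qed.

Definition mulmxb n m (M : 'M[R]_(n, m)) : blin 'rV[R]_n 'rV[R]_m :=
  mkblin (mulmxb_linear M) (@mulmxb_bound n m M).

Lemma delta_norm n (i : 'I_n) : `|delta_mx 0 i : 'rV[R]_n| <= 1.
Proof.
apply: rV_norm_le => // j; rewrite mxE.
by case: (_ && _); rewrite ?normr1 ?normr0.
Qed.

End RowVectors.

(** * The open mapping theorem on a closed subspace *)

Section OpenMapping.
Context {R : realType}.

Lemma open_mapping (E : normedModType R) (Y : completeNormedModType R)
    (A : blin E Y) (W : set E) :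
  banach E -> closed_subspace W -> (forall y, exists2 w, W w & A w = y) ->
  exists2 C, 0 < C & forall y, exists w, [/\ W w, A w = y & `|w| <= C * `|y|].
Proof.
move=> bE [[W0 Wlin] Wc] AW.
have Wl a u v : W u -> W v -> W (a *: u + v).
  by move=> Wu Wv; have := Wlin a u v; rewrite !inE; exact.
have {}W0 : W 0 by move: W0; rewrite inE.
have WZ a u : W u -> W (a *: u) by move=> Wu; rewrite -[_ *: _]addr0; exact: Wl.
have WB u v : W u -> W v -> W (u - v).
  by move=> Wu Wv; rewrite addrC -scaleN1r; exact: Wl.
pose S n := closure [set A w | w in [set w | W w /\ `|w| <= n%:R]].
(* Baire: since A maps W onto Y, the closed sets [S n] cover Y, so one of them contains a ball. *)
have [n [y0 [d d0 Sd]]] : exists n y0, exists2 d : R, 0 < d & forall y,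
  `|y| < d -> S n (y0 + y).
  apply: contrapT => nS.
  have /(_ setT) : dense (\bigcap_n ~` S n).
    apply: Baire => n; split; first by apply: closed_openC; exact: closed_closure.
    move=> O [y0 Oy0] oO; apply: contrapT => nO; apply: nS; exists n, y0.
    have /nbhs_ballP[d d0 dO] : nbhs y0 O by apply: open_nbhs_nbhs.
    exists d => // y yd; apply: contrapT => nSy; apply: nO; exists (y0 + y); split=> //.
    by apply: dO; rewrite -ball_normE /= opprD addNKr normrN.
  case=> [||y [_ yS]]; [by exists 0|exact: openT|].
  have [w Ww Awy] := AW y; have := yS (Num.bound `|w|) I; apply.
  apply: subset_closure; exists w => //; split=> //.
  by apply: ltW; apply: archi_boundP.
have Sapprox m y e : S m y -> 0 < e -> exists w, [/\ W w, `|w| <= m%:R & `|y - A w| <= e].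
  move=> Sy e0; have [z [[w [Ww wm] <-]]] := Sy (ball y e) (nbhsx_ballx y e e0).
  by rewrite -ball_normE /= => ye; exists w; split=> //; exact: ltW.
(* The centre y0 is removed by subtracting an approximate preimage of y0 from one of y0 + y, which
   doubles the norm bound to 2 n. *)
have approx y e : `|y| < d -> 0 < e -> exists w, [/\ W w, `|w| <= 2 * n%:R & `|y - A w| <= e].
  move=> yd e0; have e20 : 0 < e / 2 by rewrite divr_gt0.
  have [w1 [W1 n1 A1]] := Sapprox _ _ _ (Sd y yd) e20.
  have [w2 [W2 n2 A2]] : exists w, [/\ W w, `|w| <= n%:R & `|y0 - A w| <= e / 2].
    by apply: Sapprox => //; have := Sd 0; rewrite normr0 addr0; exact.
  exists (w1 - w2); split; first exact: WB.
    by rewrite (le_trans (ler_normB _ _)) //; lra.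
  rewrite blinB; have -> : y - (A w1 - A w2) = (y0 + y - A w1) - (y0 - A w2) by lmod R Y.
  by rewrite (le_trans (ler_normB _ _)) //; lra.
(* y is scaled to norm d / 2, so error d / 4 is half of it, and a preimage of norm at most 2 n
   scales back to at most (4 n / d) |y|. *)
pose K := 4 * n%:R / d; have K0 : 0 <= K by rewrite divr_ge0 ?mulr_ge0 // ltW.
have /choice[om omP] : forall y, exists w, [/\ W w,
  `|w| <= K * `|y| & `|y - A w| <= 2^-1 * `|y|].
  move=> y; have [->|y_neq0] := eqVneq y 0.
    by exists 0; split; rewrite ?blin0 ?subrr ?normr0 ?mulr0.
  have ny : 0 < `|y| by rewrite normr_gt0.
  pose t := d / (2 * `|y|); have t0 : 0 < t by rewrite divr_gt0 // mulr_gt0.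
  have tny : t * `|y| = d / 2 by rewrite /t; field; rewrite gt_eqF.
  have d40 : 0 < d / 4 by rewrite divr_gt0.
  have [|w [Ww wn wA]] := approx (t *: y) (d / 4) _ d40.
    by rewrite normrZ gtr0_norm // tny; lra.
  exists (t^-1 *: w); split; first exact: WZ.
    rewrite normrZ normfV gtr0_norm // mulrC ler_pdivrMr //.
    have -> : K * `|y| * t = 2 * n%:R by rewrite -mulrA [_ * t]mulrC tny /K; field;
      rewrite gt_eqF.
    exact: wn.
  rewrite blinZ -(ler_pM2l t0) -[t in t * `|_ - _|]gtr0_norm // -normrZ.
  rewrite scalerBr scalerA mulfV ?gt_eqF // scale1r mulrCA tny.
  by apply: le_trans wA _; lra.
(* Correcting the remaining error repeatedly sums K |y| / 2^i to 2 K |y|; the added 1 makes the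
   constant positive. *)
exists (2 * K + 1); first by rewrite ltr_wpDl // mulr_ge0.
move=> y; pose yk k := iter k (fun z => z - A (om z)) y.
have ykn k : `|yk k| <= 2^-1 ^+ k * `|y|.
  elim: k => [|k IH]; first by rewrite mul1r.
  have [_ _ H] := omP (yk k); apply: le_trans H _.
  by rewrite exprS -mulrA ler_wpM2l // invr_ge0.
have omn k : `|om (yk k)| <= K * (2^-1 ^+ k * `|y|).
  by have [_ H _] := omP (yk k); apply: le_trans H _; rewrite ler_wpM2l.
have half_sum k : \sum_(i < k) K * (2^-1 ^+ i * `|y|) <= 2 * K * `|y|.
  have -> : \sum_(i < k) K * (2^-1 ^+ i * `|y|) = 2 * K * `|y| * (1 - 2^-1 ^+ k).
    elim: k => [|k IH]; first by rewrite big_ord0 expr0 subrr mulr0.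
    by rewrite big_ord_recr /= IH exprS; field.
  have q1 : 1 - 2^-1 ^+ k <= 1 :> R by rewrite lerBlDr lerDl exprn_ge0 // invr_ge0.
  by rewrite ler_piMr // mulr_ge0 // mulr_ge0.
have snorm k : \sum_(i < k) `|om (yk i)| <= 2 * K * `|y|.
  by apply: le_trans (half_sum k); apply: ler_sum => i _; exact: omn.
have [w wl] := @banach_summable _ E bE (fun k => om (yk k)) _ snorm.
have Asum k : A (\sum_(i < k) om (yk i)) = y - yk k.
  elim: k => [|k IH]; first by rewrite big_ord0 blin0 subrr.
  by rewrite big_ord_recr /= blinD IH; lmod R Y.
exists w; split.
- apply: (closed_cvg W Wc _ w ((seqlimP _ _).1 wl)); apply: nearW => k.
  elim: k => [|k IH]; first by rewrite big_ord0.
  rewrite big_ord_recr /= -[\sum_(_ < _) _]scale1r; apply: Wl => //.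
  by have [] := omP (yk k).
- apply: (seqlim_unique (seqlim_blin A wl)).
  move=> e e0; have [N HN] := half_iter_small `|y| e0; exists N => k /HN;
    rewrite normr_id => H.
  by rewrite Asum addrAC subrr add0r normrN (le_trans (ykn k)).
- apply: (@le_trans _ _ (2 * K * `|y|)); last by rewrite ler_wpM2r // lerDl.
  rewrite -[w]subr0; apply: seqlim_le wl _; exists 0%N => k _; rewrite subr0.
  exact: le_trans (ler_norm_sum _ _ _) (snorm k).
Qed.

End OpenMapping.

(** * Finite-dimensional complements and comparison of codimensions *)

Section DirectSums.
Context {R : realType} {V : normedModType R}.
Implicit Types (U W : set V).

Definition is_subspace W := GRing.submod_closed (mem W).

Lemma subspace0 W : is_subspace W -> W 0.
Proof. by case=> + _; rewrite inE. Qed.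

Lemma subspaceP W a u v : is_subspace W -> W u -> W v -> W (a *: u + v).
Proof. by case=> _ Wl Wu Wv; have := Wl a u v; rewrite !inE; exact. Qed.

Lemma subspaceZ W a u : is_subspace W -> W u -> W (a *: u).
Proof. by move=> sW Wu; rewrite -[_ *: _]addr0; apply: subspaceP => //; exact: subspace0. Qed.

Lemma subspaceD W u v : is_subspace W -> W u -> W v -> W (u + v).
Proof. by move=> sW Wu Wv; rewrite -[u]scale1r; exact: subspaceP. Qed.

Lemma subspaceB W u v : is_subspace W -> W u -> W v -> W (u - v).
Proof. by move=> sW Wu Wv; rewrite addrC -scaleN1r; exact: subspaceP. Qed.

Lemma subspace_sum W (I : Type) (r : seq I) (P : pred I) (u : I -> V) : is_subspace W ->
  (forall i, P i -> W (u i)) -> W (\sum_(i <- r | P i) u i).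
Proof.
move=> sW Wu; elim/big_rec: _ => [|i x Pi Wx]; first exact: subspace0.
by apply: subspaceD => //; exact: Wu.
Qed.

Lemma subspace_set0 : is_subspace [set 0].
Proof.
split; first by rewrite inE.
by move=> a u v; rewrite !inE /= => -> ->; rewrite scaler0 addr0.
Qed.

Lemma direct_sum_indep n (y : 'I_n -> V) W U (a : 'rV[R]_n) w : is_subspace W ->
  direct_sum y W U -> W w -> \sum_i a ord0 i *: y i + w = 0 -> a = 0 /\ w = 0.
Proof.
move=> sW [_ WU yU] Ww sum0; have W0 := subspace0 sW.
have [p [_ up]] := yU 0 (WU _ W0).
have p0 : p = (0, 0).
  apply: up; split=> //=; rewrite big1 ?addr0 // => i _.
  by rewrite mxE scale0r.
have pa : p = (a, w) by apply: up; split.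
by move: pa; rewrite p0 => -[<- <-].
Qed.

Lemma direct_sum_decomp n (y : 'I_n -> V) W U v : direct_sum y W U -> U v ->
  exists a : 'rV[R]_n, exists2 w, W w & v = \sum_i a ord0 i *: y i + w.
Proof. by move=> [_ _ yU] /yU[[a w] [[Ww vE] _]]; exists a, w. Qed.

Lemma direct_sum_intro n (y : 'I_n -> V) W U : is_subspace W ->
  (forall i, U (y i)) -> W `<=` U ->
  (forall v, U v -> exists a : 'rV[R]_n, exists2 w, W w & v = \sum_i a ord0 i *: y i + w) ->
  (forall (a : 'rV[R]_n) w, W w -> \sum_i a ord0 i *: y i + w = 0 -> a = 0) ->
  direct_sum y W U.
Proof.
move=> sW Uy WU dec ind; split=> // v /dec[a [w Ww vE]]; exists (a, w); split=> //.
move=> [b w'] /= [Ww' vE'].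
have ab : a - b = 0.
  apply: (ind _ (w - w')); first exact: subspaceB.
  have : \sum_i a ord0 i *: y i + w - (\sum_i b ord0 i *: y i + w') = 0.
    by rewrite -vE -vE' subrr.
  move=> H; rewrite -[RHS]H opprD addrACA -sumrB; congr (_ + _).
  by apply: eq_bigr => i _; rewrite !mxE scalerBl.
have {}ab : a = b by apply/eqP; rewrite -subr_eq0 ab.
by congr pair => //; move: vE; rewrite vE' ab => /addrI.
Qed.

(** [f] selects some of the lines: the identity keeps all of them, and [lift i] omits the i-th,
    giving the hatted spaces of (iv). *)
Lemma direct_sum_sub n m (y : 'I_n -> V) W W0 (f : 'I_m -> 'I_n) : injective f ->
  is_subspace W -> is_subspace W0 -> W0 `<=` W -> direct_sum y W setT ->
  direct_sum (y \o f) W0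
    [set v | exists a : 'rV[R]_m, exists2 w, W0 w & v = \sum_j a ord0 j *: y (f j) + w].
Proof.
move=> fI sW sW0 W0W yW; have W00 := subspace0 sW0.
apply: direct_sum_intro => //.
- move=> i; exists (delta_mx 0 i), 0 => //; rewrite addr0 (bigD1 i) //= mxE !eqxx scale1r.
  by rewrite big1 ?addr0 // => j /negPf ji; rewrite mxE ji andbF scale0r.
- by move=> w Ww; exists 0, w => //; rewrite big1 ?add0r // => i _; rewrite mxE scale0r.
move=> a w /W0W Ww sum0; apply/rowP => j; rewrite mxE.
have [H _] : (\row_i \sum_(j | f j == i) a ord0 j) = 0 /\ w = 0.
  apply: (direct_sum_indep sW yW Ww); rewrite -[RHS]sum0; congr (_ + _).
  rewrite (partition_big f predT) //=; apply: eq_bigr => i _.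
  by rewrite mxE scaler_suml; apply: eq_bigr => j' /eqP <-.
move/rowP/(_ (f j)): H; rewrite !mxE => <-.
by rewrite (big_pred1 j) // => j'; rewrite (inj_eq fI).
Qed.

(** Let M hold the coordinates of the y_j along the e_i modulo W. If v M = 0, the combination of the
    y_j by v lies in W, hence in W', so v = 0; thus m <= d. If m = d, M is invertible, so the e-part
    of an element of W' is a combination of the y_j modulo W; independence modulo W' makes it 0. *)
Lemma direct_sum_exchange m d (y : 'I_m -> V) (e : 'I_d -> V) W W' U : is_subspace W' ->
  direct_sum y W' U -> direct_sum e W U -> W `<=` W' ->
  (m <= d)%N /\ (m = d -> W' `<=` W).
Proof.
move=> sW' yW' eW WW'.
have [Uy W'U _] := yW'.
have /choice[B /choice[w wP]] : forall j, exists b : 'rV[R]_d, exists w,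
    W w /\ y j = \sum_i b ord0 i *: e i + w.
  by move=> j; have [b [w Ww yE]] := direct_sum_decomp eW (Uy j); exists b, w.
pose M : 'M[R]_(m, d) := \matrix_(j, i) B j ord0 i.
have combE (v : 'rV[R]_m) : \sum_j v ord0 j *: y j =
    \sum_i (v *m M) ord0 i *: e i + \sum_j v ord0 j *: w j.
  transitivity (\sum_j (\sum_i (v ord0 j * B j ord0 i) *: e i + v ord0 j *: w j)).
    apply: eq_bigr => j _; have [_ ->] := wP j.
    by rewrite scalerDr scaler_sumr; congr (_ + _); apply: eq_bigr => i _; rewrite scalerA.
  rewrite big_split exchange_big /=; congr (_ + _); apply: eq_bigr => i _.
  by rewrite mxE scaler_suml; apply: eq_bigr => j _; rewrite mxE.
have W'w (v : 'rV[R]_m) : W' (\sum_j v ord0 j *: w j).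
  by apply: subspace_sum => // j _; apply: subspaceZ => //; apply: WW'; have [] := wP j.
have freeM : row_free M.
  rewrite -kermx_eq0; apply/eqP/row_matrixP => i; rewrite row0.
  set v := row i _; have vM : v *m M = 0 by rewrite -row_mul mulmx_ker row0.
  have W'v : W' (- \sum_j v ord0 j *: w j) by rewrite -scaleN1r; apply: subspaceZ.
  have [] // := direct_sum_indep (a := v) sW' yW' W'v.
  rewrite combE vM big1 ?add0r ?subrr // => j _; rewrite mxE scale0r //.
split; first by have := rank_leq_col M; move/eqP: freeM => ->.
move=> md; subst d => w' Ww'.
have uM : M \in unitmx by rewrite -row_free_unit.
have [a [u Wu w'E]] := direct_sum_decomp eW (W'U _ Ww').
pose b := a *m invmx M.
have bM : b *m M = a by rewrite mulmxKV.
have bE : \sum_j b ord0 j *: y j = (w' - u) + \sum_j b ord0 j *: w j.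
  by rewrite combE bM w'E addrK.
have [b0 _] : b = 0 /\ - ((w' - u) + \sum_j b ord0 j *: w j) = 0.
  apply: (direct_sum_indep sW' yW'); last by rewrite bE subrr.
  rewrite -scaleN1r; apply: subspaceZ => //; apply: subspaceD => //.
  by apply: subspaceB => //; exact: WW'.
have a0 : a = 0 by rewrite -bM b0 mul0mx.
by rewrite w'E a0 big1 ?add0r // => i _; rewrite mxE scale0r.
Qed.

Lemma direct_sum_dim m d (x : 'I_m -> V) (e : 'I_d -> V) W U : is_subspace W ->
  direct_sum x W U -> direct_sum e W U -> m = d.
Proof.
move=> sW xU eU; apply/eqP; rewrite eqn_leq.
have [-> _] := direct_sum_exchange sW xU eU (@subset_refl _ _).
by have [-> _] := direct_sum_exchange sW eU xU (@subset_refl _ _).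
Qed.

End DirectSums.

(** * The smoothness classes treated uniformly *)

Section SmoothnessClasses.
Context {R : realType}.
Implicit Types (E F G X Z : normedModType R) (k : smoothness).

Definition at_least_C1 k : Prop := if k is Defs.Finite m then (1 <= m)%N else True.

Lemma at_least_C2_pred k : at_least_C2 k -> at_least_C1 (smoothness_pred k).
Proof. by case: k => // -[|[]]. Qed.

Lemma at_least_C2_C1 k : at_least_C2 k -> at_least_C1 k.
Proof. by case: k => // -[|[]]. Qed.

Lemma class_Ck2 k E F (U : set E) (f : E -> F) : banach F -> eopen U ->
  at_least_C2 k -> of_class k U f -> Ck 2 U f.
Proof.
move=> bF oU; case: k => [m m2|_|_]; [exact: Ck_le m2|exact|exact: analytic_Ck].
Qed.

Lemma class_Ck1 k E F (U : set E) (f : E -> F) : banach F -> eopen U ->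
  at_least_C1 k -> of_class k U f -> Ck 1 U f.
Proof.
move=> bF oU; case: k => [m m2|_|_]; [exact: Ck_le m2|exact|exact: analytic_Ck].
Qed.

Lemma class_pred k E F (U : set E) (f : E -> F) : of_class k U f ->
  of_class (smoothness_pred k) U f.
Proof. by case: k => //= m; apply: Ck_le; exact: leq_pred. Qed.

Lemma class_sub k E F (U V : set E) (f : E -> F) : U `<=` V ->
  of_class k V f -> of_class k U f.
Proof.
move=> UV; case: k => [m|fV m|fV u /UV] //=; [exact: Ck_sub|exact: Ck_sub (fV m)|exact: fV].
Qed.

Lemma class_blin k E F (U : set E) (L : blin E F) : of_class k U L.
Proof.
by case: k => [m|m|u _]; [exact: Ck_blin|exact: Ck_blin|exact: analytic_blin].
Qed.

Lemma class_cst k E F (U : set E) (c : F) : of_class k U (fun _ : E => c).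
Proof.
by case: k => [m|m|u _]; [exact: Ck_cst|exact: Ck_cst|exact: analytic_cst].
Qed.

Lemma classD k E F (U : set E) (f g : E -> F) : of_class k U f -> of_class k U g ->
  of_class k U (fun x => f x + g x).
Proof.
case: k => [m|fC gC m|fC gC u Uu]; first exact: CkD.
  exact: CkD (fC m) (gC m).
exact: analyticD (fC u Uu) (gC u Uu).
Qed.

Lemma class_comp k E F G (U : set E) (V : set F) (f : E -> F) (g : F -> G) :
  banach G -> (forall u, U u -> V (f u)) -> of_class k U f -> of_class k V g ->
  of_class k U (fun x => g (f x)).
Proof.
move=> bG UV; case: k => [m fC gC|fC gC m|fC gC u Uu].
- exact: Ck_comp UV fC gC.
- exact: Ck_comp UV (fC m) (gC m).
- by apply: (@analytic_comp _ _ _ _ g f) => //; [exact: fC|apply: gC; exact: UV].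
Qed.

Lemma class_post k E F G (U : set E) (T : blin F G) (f : E -> F) : banach G ->
  of_class k U f -> of_class k U (fun x => T (f x)).
Proof. by move=> bG fC; apply: (class_comp (V := setT) bG _ fC) => //; exact: class_blin. Qed.

Lemma class_pair k E F G (U : set E) (f : E -> F) (g : E -> G) :
  banach F -> banach G ->
  of_class k U f -> of_class k U g -> of_class k U (fun x => (f x, g x)).
Proof.
move=> bF bG fC gC; have bFG := banach_prod bF bG.
have -> : (fun x => (f x, g x)) = (fun x => inlb F G (f x) + inrb F G (g x)).
  by apply/funext => x; exact: pairE.
by apply: classD; exact: class_post.
Qed.

Lemma class_sum k E F (U : set E) n (f : 'I_n -> E -> F) :
  (forall i, of_class k U (f i)) -> of_class k U (fun x => \sum_i f i x).
Proof.
elim: n f => [|n IH] f fC.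
  have -> : (fun x => \sum_i f i x) = (fun=> 0) by apply/funext => x; rewrite big_ord0.
  exact: class_cst.
have -> : (fun x => \sum_i f i x) = (fun x => f ord0 x + \sum_i f (lift ord0 i) x).
  by apply/funext => x; rewrite big_ord_recl.
by apply: classD => //; exact: IH.
Qed.

Lemma class_fix k E Z (U : set E) (B : set Z) (N : E * Z -> Z) (psi : E -> Z) :
  banach Z -> eopen U -> eopen B ->
  (forall h, U h -> B (psi h)) -> (forall h, U h -> psi h = N (h, psi h)) ->
  (forall h y y', U h -> B y -> B y' -> `|N (h, y) - N (h, y')| <= 2^-1 * `|y - y'|) ->
  of_class k [set p | U p.1 /\ B p.2] N -> of_class k U psi.
Proof.
move=> bZ oU oB Bpsi psiE Nl; case: k => [m|NC m|NC].
- exact: fix_Ck.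
- exact: fix_Ck (NC m).
- by apply: fix_analytic Nl _ => // p Up Bp; exact: NC.
Qed.

(** In the classes C^m and C^infinity the quotient lives on the whole ball; an analytic quotient
    comes as a power series at 0 and is analytic on a smaller ball, hence [r <= d]. *)
Lemma class_hadamard k E Z d (f : E -> Z) (A0 : blin E E) (ell : blin E R^o) (e : E) :
  banach Z -> 0 < d -> at_least_C1 k -> `|A0| <= 1 -> `|e| <= 1 ->
  (forall h, h = A0 h + ell h *: e) ->
  of_class k [set h | `|h| < d] f -> (forall h, `|h| < d -> f (A0 h) = 0) ->
  exists g : E -> Z, exists r, [/\ 0 < r, r <= d,
    of_class (smoothness_pred k) [set h | `|h| < r] g &
    forall h, `|h| < r -> f h = ell h *: g h].
Proof.
move=> bZ d0 k1 A01 e1 hE fC f0.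
have oU := @eopen_ball0 R E d.
have Ckcase df : (forall u, `|u| < d -> fder f u (df u)) -> Ck 0 [set h | `|h| < d] df ->
    exists g : E -> Z, (forall h, `|h| < d -> f h = ell h *: g h) /\
      forall m, Ck m [set h | `|h| < d] df -> Ck m [set h | `|h| < d] g.
  move=> dfE dfC; pose A1 := idb E - A0.
  have A1E h : A1 h = ell h *: e by rewrite blin_subE /= {1}(hE h) addrAC subrr add0r.
  apply: (@hadamard_Ck _ E Z [set h | `|h| < d] f df A0 A1 ell e) => //.
    by move=> h; rewrite A1E -hE.
  move=> t h /andP[t0 t1] /= hd.
  have -> : A0 h + t *: A1 h = (1 - t) *: A0 h + t *: h.
    by rewrite blin_subE /=; lmod R E.
  apply: le_lt_trans hd; rewrite (le_trans (ler_normD _ _)) // !normrZ !ger0_norm ?subr_ge0 //.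
  have A0h : `|A0 h| <= `|h| by apply: le_trans (blin_le _ _) _; rewrite ler_piMl.
  have := ler_wpM2l (_ : 0 <= 1 - t) A0h; rewrite subr_ge0 => /(_ t1).
  by rewrite [X in _ <= X -> _]mulrBl mul1r; set x := _ * `|A0 h|; lra.
case: k k1 fC => [[|m] // _|_ fC|_ fC].
- move=> /CkSP[df dfE dfC]; have [g [gE gC]] := Ckcase df dfE (Ck_le (leq0n m) dfC).
  by exists g, d; split=> //; exact: gC.
(* The quotient is an integral of a fixed [df], so a single g serves all m; [Ck_der] transfers every
   order of smoothness to this [df]. *)
- have [df dfE dfC] := (CkSP 0 _ _).1 (fC 1%N).
  have [g [gE gC]] := Ckcase df dfE dfC; exists g, d; split=> // m.
  by apply: gC; exact: Ck_der oU dfE (fC m.+1).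
- have fA0 : analytic_at f 0 by apply: fC; rewrite /= normr0.
  have [g [r r0 [gA gE]]] := hadamard_analytic bZ A01 e1 hE d0 f0 fA0.
  have [r' r'0 gA'] := analytic_near bZ gA.
  exists g, (Num.min d (Num.min r r')); split.
  + by rewrite !lt_min d0 r0.
  + by rewrite ge_min lexx.
  + by move=> u /=; rewrite !lt_min => /and3P[_ _ ur']; apply: gA'; rewrite subr0.
  + by move=> h; rewrite !lt_min => /and3P[_ hr _]; exact: gE.
Qed.

(** The implicit function theorem in fixed-point form: an equation H (h, y) = 0 with invertible
    partial derivative B in y is brought to it by N (h, y) = y - B^-1 H (h, y), whose derivative in
    y at 0 vanishes. *)
Lemma class_ift k E Z (N : E * Z -> Z) (D : blin (E * Z)%type Z) r0 : banach Z -> 0 < r0 ->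
  at_least_C1 k -> of_class k [set p | `|p| < r0] N -> N 0 = 0 ->
  fder N 0 D -> (forall y, D (0, y) = 0) ->
  exists r rho psi, [/\ 0 < r /\ r <= r0, 0 < rho /\ rho <= r0,
    of_class k [set h | `|h| < r] psi &
    forall h, `|h| < r -> [/\ `|psi h| < rho / 2, psi h = N (h, psi h) &
      half_lipschitz rho (fun y => N (h, y))]].
Proof.
move=> bZ r00 k1 NC N0 ND D0.
have [dN NE NC1] := (CkSP 0 _ _).1 (class_Ck1 bZ (@eopen_ball0 R (E * Z)%type r0) k1 NC).
have U0 : [set p : E * Z | `|p| < r0] 0 by rewrite /= normr0.
have dN0 : dN 0 = D := fder_unique (NE 0 U0) ND.
have [|r [rho [psi [r_gt0 rr0 rho0 rhor0 psiP]]]] :=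
  fix_exists bZ r00 NE (Ck_econt NC1 U0) N0 _.
  by rewrite dN0.
exists r, rho, psi; split=> //.
apply: (@class_fix k E Z [set h | `|h| < r] [set y | `|y| < rho] N) => //.
- exact: eopen_ball0.
- exact: eopen_ball0.
- by move=> h /psiP[/= + _ _]; lra.
- by move=> h /psiP[].
- by move=> h y y' /psiP[_ _ Nl]; exact: Nl.
- apply: class_sub NC => -[h y] [/= hr yr].
  by rewrite norm_pair_lt (lt_le_trans hr) //= (lt_le_trans yr).
Qed.

Lemma fder_ift E Z (N : E * Z -> Z) (psi : E -> Z) (D : blin (E * Z)%type Z)
    (D' : blin E Z) r : 0 < r ->
  (forall h, `|h| < r -> psi h = N (h, psi h)) -> psi 0 = 0 ->
  fder N 0 D -> (forall y, D (0, y) = 0) -> fder psi 0 D' ->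
  D' = compb D (inlb E Z).
Proof.
move=> r0 psiE psi0 ND D0 psiD; apply: (fder_unique psiD).
have H : fder (fun h => inlb E Z h + inrb E Z (psi h)) 0 (inlb E Z + compb (inrb E Z) D').
  by apply: fderD; [exact: fder_blin|exact: fder_post].
have H' : fder (fun h => N (inlb E Z h + inrb E Z (psi h)))
  0 (compb D (inlb E Z + compb (inrb E Z) D')).
  by apply: (fder_comp H); rewrite psi0 !blin0 addr0.
have -> : compb D (inlb E Z) = compb D (inlb E Z + compb (inrb E Z) D').
  apply: blin_ext => h; rewrite !compbE blin_addE compbE blinD -[inrb E Z _]/(0, D' h).
  by rewrite D0 addr0.
apply: fder_ext r0 _ H' => h hr; rewrite add0r [RHS]psiE //.
by rewrite -pairE.
Qed.

Lemma half_fix_zero k E Z (N : E * Z -> Z) (psi : E -> Z) r rho :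
  0 < r -> 0 < rho -> N 0 = 0 ->
  (forall h, `|h| < r -> [/\ `|psi h| < rho / 2, psi h = N (h, psi h) &
      half_lipschitz rho (fun y => N (h, y))]) ->
  (forall h, `|h| < r -> N (h, 0) = 0 -> psi h = 0).
Proof.
move=> r0 rho0 N0 psiP h /psiP[h1 h2 h3] Nh.
apply: (half_fix_unique h3) => //; [by have := normr_ge0 (psi h); lra|by rewrite normr0].
Qed.

(** The value at 0 of a quotient [G] that is only continuous there, read off from the derivative of
    t G (t). *)
Lemma fder_quotient Z (h G : R^o -> Z) (M : blin R^o Z) d : 0 < d -> econt G 0 ->
  fder h 0 M -> (forall t, `|t| < d -> h t = t *: G t) -> M 1 = G 0.
Proof.
move=> d0 GC hM hE; apply/eqP; rewrite -subr_eq0 -normr_le0; apply/ler_addgt0Pr => /= e e0.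
have e20 : 0 < e / 2 by rewrite divr_gt0.
have [d1 d10 G1] := GC _ e20; have [d2 d20 h2] := hM _ e20.
pose t : R := Num.min d (Num.min d1 d2) / 2.
have m0 : 0 < Num.min d (Num.min d1 d2) by rewrite !lt_min d0 d10.
have t0 : 0 < t by rewrite divr_gt0.
have tm : `|t : R^o| < Num.min d (Num.min d1 d2) by rewrite gtr0_norm // /t; lra.
move: tm; rewrite !lt_min => /and3P[td td1 td2].
have := G1 _ td1; have := h2 _ td2; rewrite add0r (hE t) // (hE 0) ?normr0 // scale0r subr0.
have -> : M t = t *: M 1 by rewrite -blinZ -[t *: 1]/(t * 1) mulr1.
have nt : `|t : R^o| = t := gtr0_norm t0.
rewrite -scalerBr normrZ nt [t * _]mulrC (ler_pM2r t0) => H1 H2.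
have -> : M 1 - G 0 = (G t - G 0) - (G t - M 1) by lmod R Z.
by rewrite add0r (le_trans (ler_normB _ _)) //; lra.
Qed.

End SmoothnessClasses.

(** * The reduction *)

Section PartialDerivativeFormulas.
Context {R : realType} {X Y : normedModType R} {n : nat}.
Implicit Types (F : X * 'rV[R]_n -> Y).

Lemma DparamE F j x c (D : blin (X * 'rV[R]_n)%type Y) t : fder F (x, c) D ->
  Dparam F j x c t = D (0, t *: delta_mx 0 j).
Proof.
move=> FD; pose cj : R := c ord0 j.
pose inner (r : R^o) : X * 'rV[R]_n := (x, c - cj *: delta_mx 0 j)
  + inrb X 'rV[R]_n (lineb (delta_mx 0 j) r).
have innerE (r : R) : inner r = (x, \row_l (if l == j then r else c ord0 l)).
  rewrite /inner -[_ + _]/(x + 0, c - cj *: delta_mx 0 j + r *: delta_mx 0 j) addr0.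
  congr pair; apply/rowP => l; rewrite !mxE eqxx /=.
  by have [->|_] := eqVneq l j; rewrite /= ?mulr1 ?mulr0 ?subr0 ?addr0 ?subrr ?add0r.
have inD : fder inner cj (0 + compb (inrb X 'rV[R]_n) (lineb (delta_mx 0 j))).
  by apply: fderD; [exact: fder_cst|exact: fder_post (fder_blin _ _)].
have incj : inner cj = (x, c).
  rewrite innerE; congr pair; apply/rowP => l; rewrite mxE.
  by have [->|//] := eqVneq l j.
have FinD : fder (fun r : R^o => F (inner r)) cj (compb D (0 + compb (inrb X 'rV[R]_n)
  (lineb (delta_mx 0 j)))).
  by apply: (fder_comp inD); rewrite incj.
have [_ dE] := fder_diff FinD.
rewrite /Dparam.
have -> : (fun r : R => F (x, \row_l (if l == j then r else c ord0 l))) = (fun r =>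
  F (inner r)).
  by apply/funext => r; rewrite innerE.
by rewrite dE compbE blin_addE blin_zeroE add0r.
Qed.

Lemma D1DparamE F j x c (dF : X * 'rV[R]_n -> blin (X * 'rV[R]_n)%type Y) D2 u t :
  (forall p, fder F p (dF p)) -> fder dF (x, c) D2 ->
  D1Dparam F j x c u t = D2 (u, 0) (0, t *: delta_mx 0 j).
Proof.
move=> FD dFD; rewrite /D1Dparam.
have -> : (fun x' : X => Dparam F j x' c t) =
    (fun x' => evb Y (0, t *: delta_mx 0 j) (dF ((0, c) + inlb X 'rV[R]_n x'))).
  apply/funext => x'; rewrite (DparamE _ _ (FD (x', c))) /=; congr (dF _ _).
  by rewrite -[_ + _]/(0 + x', c + 0) add0r addr0.
have H : fder (fun x' => dF ((0, c) + inlb X 'rV[R]_n x')) x (compb D2 (0 + inlb X 'rV[R]_n)).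
  apply: (@fder_comp _ _ _ _ dF (fun x' => (0, c) + inlb X 'rV[R]_n x')).
    by apply: fderD; [exact: fder_cst|exact: fder_blin].
  by rewrite -[_ + _]/(0 + x, c + 0) add0r addr0.
have [_ ->] := fder_diff (fder_post (evb Y (0, t *: delta_mx 0 j)) H).
by rewrite !compbE blin_addE blin_zeroE add0r.
Qed.

End PartialDerivativeFormulas.

(** * The Lyapunov-Schmidt reduction and the scalar equations *)

Section ReducedProblem.
Context {R : realType} {n : nat} {X Y : normedModType R}.
Context (bX : banach X) (bY : banach Y).
Context (k : smoothness) (k2 : at_least_C2 k).
Context (F : X * 'rV[R]_n -> Y) (F_class : of_class k setT F).
Context (F_trivial : forall c, F (0, c) = 0).
Context (cs : 'rV[R]_n) (x_ : 'I_n -> X) (y_ : 'I_n -> Y).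
Context (L : blin X Y) (lam : 'I_n -> blin Y R^o) (T : blin Y X) (nu : 'M[R]_n).
Context (FL : fder (fun x => F (x, cs)) 0 L).
Context (decomp : forall y, y = \sum_i lam i y *: y_ i + L (T y)).
Context (lamL : forall i x, lam i (L x) = 0).
Context (Lx : forall i, L (x_ i) = 0).
(** Hypothesis (iv) in the form used by the iteration: the contraction maps S into itself when s_i =
    0, and the i-th scalar equation then holds. For the theorem, S is [Yti]. *)
Context (invariant : forall i, exists S : set Y, [/\ closed S, S 0 &
  forall (s c : 'rV[R]_n) (y : Y), s ord0 i = 0 -> S y ->
    S (L (T (y - F (combb x_ s + T y, c)))) /\ lam i (F (combb x_ s + T y, c)) = 0]).
Context (nuE : forall i j t, lam i (D1Dparam F j 0 cs (x_ i) t) = nu i j * t).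
Context (nu_inv : nu \in unitmx).

Local Notation C := 'rV[R]_n.
Local Notation P := (C * C)%type.

Let bP : banach P := banach_prod (banach_rV (n := n)) (banach_rV (n := n)).

Let shift0 : blin (P * Y)%type (X * C)%type :=
  compb (inlb X C) (compb (combb x_) (compb (fstb C C) (fstb P Y)) + compb T (sndb P Y))
  + compb (inrb X C) (compb (sndb C C) (fstb P Y)).

Let shift0E s g y : shift0 ((s, g), y) = (combb x_ s + T y, g).
Proof. by rewrite /shift0 blin_addE !compbE blin_addE !compbE -pairE. Qed.

Let arg (q : P * Y) : X * C := (0, cs) + shift0 q.

Let argE s g y : arg ((s, g), y) = (combb x_ s + T y, cs + g).
Proof. by rewrite /arg shift0E -[LHS]/(0 + _, cs + _) add0r. Qed.

Let Q : blin Y Y := compb L T.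

Let QQ y : Q (Q y) = Q y.
Proof.
rewrite {2}[in LHS]/Q {1}/Q !compbE [RHS](decomp (Q y)) big1 ?add0r // => i _.
by rewrite lamL scale0r.
Qed.

Let QL x : Q (L x) = L x.
Proof.
by rewrite [RHS](decomp (L x)) big1 ?add0r // => i _; rewrite lamL scale0r.
Qed.

(** Applying the projection [Q] to y = N gives Q y = Q y - Q F, so a fixed point solves Q F = 0. The
    derivative at 0 is Q (y - L (T y)) = Q y - Q (Q y) = 0; cancelling it is the purpose of the term
    y. *)
Let N (q : P * Y) : Y := Q (q.2 + (- idb Y) (F (arg q))).

Let NE s g y : N ((s, g), y) = Q (y - F (combb x_ s + T y, cs + g)).
Proof. by rewrite /N argE. Qed.

Let bXC : banach (X * C)%type := banach_prod bX (banach_rV (n := n)).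

Let arg_class k' (U : set (P * Y)) : of_class k' U arg.
Proof. by apply: classD; [exact: class_cst|exact: class_blin]. Qed.

Let N_class : of_class k setT N.
Proof.
apply: class_post => //; apply: classD; first exact: (class_blin _ _ (sndb P Y)).
apply: class_post => //; apply: (class_comp (V := setT)) => //; exact: arg_class.
Qed.

Let F_C2 : Ck 2 setT F := class_Ck2 bY (@eopenT R (X * C)%type) k2 F_class.

Let F_derivatives : exists dF d2F, [/\ forall p, fder F p (dF p), forall p, fder dF p (d2F p) &
  Ck 1 setT dF].
Proof.
have [dF FdF /[dup] dFC /CkSP[d2F dFd2F _]] := (CkSP 1 _ _).1 F_C2.
by exists dF, d2F; split=> // p; [exact: FdF|exact: dFd2F].
Qed.

Let dF_x dF : (forall p, fder F p (dF p)) -> forall x, dF (0, cs) (x, 0) = L x.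
Proof.
move=> FdF x.
have H : fder (fun x => F ((0, cs) + inlb X C x)) 0 (compb (dF (0, cs)) (0 + inlb X C)).
  apply: (@fder_comp _ _ _ _ F (fun x => (0, cs) + inlb X C x)).
    by apply: fderD; [exact: fder_cst|exact: fder_blin].
  by rewrite blin0 addr0.
have -> : L = compb (dF (0, cs)) (0 + inlb X C).
  apply: fder_unique FL _; apply: (fder_ext ltr01 _ H) => h _.
  by rewrite -[_ + inlb _ _ _]/(0 + (0 + h), cs + 0) add0r addr0.
by rewrite compbE blin_addE blin_zeroE add0r.
Qed.

(** F vanishes along 0 x C, so its derivative at the base point sees only the x-direction. *)
Let dF_c dF : (forall p, fder F p (dF p)) -> forall g, dF (0, cs) (0, g) = 0.
Proof.
move=> FdF g.
have H : fder (fun g => F ((0, cs) + inrb X C g)) 0 (compb (dF (0, cs)) (0 + inrb X C)).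
  apply: (@fder_comp _ _ _ _ F (fun g => (0, cs) + inrb X C g)).
    by apply: fderD; [exact: fder_cst|exact: fder_blin].
  by rewrite blin0 addr0.
have H0 : fder (fun g => F ((0, cs) + inrb X C g)) 0 0.
  apply: (fder_ext ltr01 _ (fder_cst 0 (0 : C))) => h _.
  by rewrite -[_ + inrb _ _ _]/(0 + 0, cs + (0 + h)) addr0 F_trivial.
have E := fder_unique H H0.
have : compb (dF (0, cs)) (0 + inrb X C) g = 0 by rewrite E.
by rewrite compbE blin_addE blin_zeroE add0r.
Qed.

Let dF_pair dF : (forall p, fder F p (dF p)) -> forall x g, dF (0, cs) (x, g) = L x.
Proof.
move=> FdF x g; transitivity (dF (0, cs) (x, 0) + dF (0, cs) (0, g)).
  by rewrite -blinD -[(x, 0) + (0, g)]/(x + 0, 0 + g) addr0 add0r.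
by rewrite (dF_x FdF) (dF_c FdF) addr0.
Qed.

Let combb_delta i : combb x_ (delta_mx 0 i) = x_ i.
Proof.
rewrite combbE (bigD1 i) //= mxE !eqxx scale1r big1 ?addr0 // => j /negPf ji.
by rewrite mxE ji andbF scale0r.
Qed.

Let L_combb s : L (combb x_ s) = 0.
Proof. by rewrite combbE blin_sum big1 // => i _; rewrite blinZ Lx scaler0. Qed.

Let dN (dF : X * C -> blin (X * C)%type Y) : blin (P * Y)%type Y :=
  compb Q (sndb P Y + compb (- idb Y) (compb (dF (0, cs)) (0 + shift0))).

Let N_fder dF : (forall p, fder F p (dF p)) -> fder N 0 (dN dF).
Proof.
move=> FdF; apply: fder_post; apply: fderD; first exact: (fder_blin (sndb P Y)).
apply: fder_post; apply: (@fder_comp _ _ _ _ F arg).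
  by apply: fderD; [exact: fder_cst|exact: fder_blin].
by rewrite /arg blin0 addr0.
Qed.

Let dN_eq dF : (forall p, fder F p (dF p)) -> forall s g y, dN dF ((s, g), y) = 0.
Proof.
move=> FdF s g y.
have -> : dN dF ((s, g), y) = Q (y - dF (0, cs) (combb x_ s + T y, g)).
  by rewrite -[LHS]/(Q (y - dF (0, cs) (0 + shift0 (s, g, y)))) add0r shift0E.
rewrite dF_pair //.
by rewrite blinD L_combb add0r blinB QL -[L (T y)]/(Q y) subrr.
Qed.

(* Solving the range component of the equation for [y], where [x = sum s_i x_i + T y]. *)
Let lyapunov_schmidt : exists r psi, [/\ 0 < r, of_class k [set p : P | `|p| < r] psi,
  fder psi 0 0, forall g, `|(0 : C, g)| < r -> psi (0, g) = 0 &
  (forall s g : C, `|(s, g)| < r ->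
     Q (F (combb x_ s + T (psi (s, g)), cs + g)) = 0) /\
  (forall (s g : C) i, `|(s, g)| < r -> s ord0 i = 0 ->
     lam i (F (combb x_ s + T (psi (s, g)), cs + g)) = 0)].
Proof.
have [dF [d2F [FdF _ _]]] := F_derivatives.
have N0 g : N ((0, g), 0) = 0.
  by rewrite NE !blin0 addr0 F_trivial subr0 blin0.
have D0 y : dN dF (0, y) = 0 by exact: dN_eq.
have [r [rho [psi [[r0 _] [rho0 _] psiC psiP]]]] :=
  class_ift bY ltr01 (at_least_C2_C1 k2) (class_sub (@subsetT _ _) N_class) (N0 0)
    (N_fder FdF) D0.
(* y = 0 solves the fixed-point equation for s = 0 and every g: this is the trivial branch F [0, c]
   = 0. *)
have psi0 g : `|(0 : C, g)| < r -> psi (0, g) = 0.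
  by move=> gr; apply: (half_fix_zero k r0 rho0 (N0 0) psiP) => //; exact: N0.
have [dpsi psidpsi _] := (CkSP 0 _ _).1 (class_Ck1 bY (@eopen_ball0 R P r)
  (at_least_C2_C1 k2) psiC).
have psi00 : psi 0 = 0 by apply: psi0; rewrite -[(0, 0)]/(0 : P) normr0.
have psid0 : fder psi 0 0.
  have H : fder psi 0 (dpsi 0) by apply: psidpsi; rewrite /= normr0.
  have psiE h : `|h| < r -> psi h = N (h, psi h) by move=> /psiP[].
  have := fder_ift r0 psiE psi00 (N_fder FdF) D0 H.
  have -> : compb (dN dF) (inlb P Y) = 0; last by move=> <-.
  by apply: blin_ext => -[s g]; rewrite compbE; exact: dN_eq.
exists r, psi; split=> //; split=> [s g sgr|s g i sgr si0].
  have [_ /(congr1 Q) H _] := psiP _ sgr; move: H.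
  rewrite NE QQ blinB => H.
  by move/eqP: H; rewrite -subr_eq0 opprB addrC subrK => /eqP.
have [S [Sc S0 SP]] := invariant i; have [h1 h2 h3] := psiP _ sgr.
suff Spsi : S (psi (s, g)) by have [] := SP s (cs + g) _ si0 Spsi.
apply: (half_fix_closed h3 h1 h2 Sc S0) => z _ Sz.
by rewrite NE; have [] := SP s (cs + g) _ si0 Sz.
Qed.


(** The transpose appears because parameters are row vectors: the i-th entry of [g *m nu^T] is the
    sum over j of nu_ij g_j. *)
Let d2F_nu dF d2F : (forall p, fder F p (dF p)) -> (forall p, fder dF p (d2F p)) ->
  forall i (g : C), lam i (d2F (0, cs) (x_ i, 0) (0, g)) = (g *m nu^T) ord0 i.
Proof.
move=> FdF dFd2F i g.
have gE : (0, g) = \sum_j inrb X C (g ord0 j *: delta_mx 0 j).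
  by rewrite -blin_sum -row_sum_delta.
rewrite gE !blin_sum mxE; apply: eq_bigr => j _.
by rewrite mxE -(D1DparamE j (x_ i) (g ord0 j) FdF (dFd2F (0, cs))) nuE mulrC.
Qed.

Let ell i : blin P R^o := compb (coordb i) (fstb C C).

Let dir i : P := (delta_mx 0 i, 0).

Let ell_dir i (t : R) : ell i (t *: dir i) = t.
Proof. by rewrite blinZ /ell compbE /= mxE !eqxx -[_ *: _]/(t * 1) mulr1. Qed.

Let dir_norm i : `|dir i| <= 1.
Proof. by rewrite prod_normE /= normr0 ge_max delta_norm ler01. Qed.

Let proj0 i : blin P P := idb P - compb (lineb (dir i)) (ell i).

Let proj0E i s g : proj0 i (s, g) = (s - s ord0 i *: delta_mx 0 i, g).
Proof.
rewrite /proj0 blin_subE compbE linebE.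
by rewrite -[LHS]/(s - s ord0 i *: delta_mx 0 i, g - s ord0 i *: 0) scaler0 subr0.
Qed.

Let proj0_coord i (s : C) : (s - s ord0 i *: delta_mx 0 i) ord0 i = 0.
Proof. by rewrite !mxE !eqxx mulr1 subrr. Qed.

(** Erasing a coordinate does not increase the sup norm; Hadamard division needs the projection to
    keep the ball. *)
Let proj0_norm i : `|proj0 i| <= 1.
Proof.
apply: blin_norm_le => // -[s g]; rewrite mul1r proj0E !prod_normE /= ge_max.
rewrite [X in _ && X]le_max lexx orbT andbT le_max; apply/orP; left.
apply: rV_norm_le => // j; rewrite !mxE eqxx /=.
have [->|_] := eqVneq j i; first by rewrite mulr1 subrr normr0.
by rewrite mulr0 subr0 rV_coord_le.
Qed.

Let common_radius m (rr : 'I_m -> R) (r0 : R) : 0 < r0 -> (forall i, 0 < rr i) ->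
  exists r, [/\ 0 < r, r <= r0 & forall i, r <= rr i].
Proof.
move=> r00 rr0; elim: m rr rr0 => [|m IH] rr rr0; first by exists r0; split=> // -[].
have [r [r_gt0 rr0' rrr]] := IH (fun i => rr (lift ord0 i)) (fun i => rr0 _).
exists (Num.min r (rr ord0)); split; first by rewrite lt_min r_gt0 rr0.
  by rewrite ge_min rr0'.
move=> i; rewrite ge_min; case: (unliftP ord0 i) => [j|] ->; last by rewrite lexx orbT.
by rewrite rrr.
Qed.

(* Dividing the [i]-th kernel component of the equation by [s_i]. *)
Let reduction : exists r psi (G : P -> C),
  [/\ 0 < r, of_class k [set p : P | `|p| < r] psi, psi 0 = 0 /\ fder psi 0 0,
   of_class (smoothness_pred k) [set p | `|p| < r] G &
   [/\ G 0 = 0, forall D, fder G 0 D -> forall g, D (0, g) = g *m nu^T &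
   forall s g, `|(s, g)| < r -> G (s, g) = 0 ->
     F (combb x_ s + T (psi (s, g)), cs + g) = 0]].
Proof.
have [dF [d2F [FdF dFd2F dFC]]] := F_derivatives.
have [r0 [psi [r00 psiC psid0 psi0 [psiQ psilam]]]] := lyapunov_schmidt.
have psi00 : psi 0 = 0 by apply: psi0; rewrite -[(0, 0)]/(0 : P) normr0.
pose f i (p : P) : R^o := lam i (F (arg (p, psi p))).
have fC i : of_class k [set p : P | `|p| < r0] (f i).
  apply: class_post banach_R _; apply: (class_comp (V := setT)) => //.
  apply: (@class_comp _ _ _ _ _ _ setT (fun p => (p, psi p)) arg) => //.
  by apply: class_pair => //; exact: (class_blin _ _ (idb P)).
have f0 i h : `|h| < r0 -> f i (proj0 i h) = 0.
  case: h => s g hr; rewrite /f proj0E argE; apply: psilam; last exact: proj0_coord.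
  rewrite -proj0E; apply: le_lt_trans hr; apply: le_trans (blin_le _ _) _.
  by rewrite ler_piMl.
have hE i h : h = proj0 i h + ell i h *: dir i.
  by rewrite /proj0 blin_subE compbE linebE subrK.
have /choice[g_ /choice[r_ gP]] : forall i, exists g : P -> R^o, exists r, [/\ 0 < r, r <= r0,
    of_class (smoothness_pred k) [set h | `|h| < r] g & forall h,
      `|h| < r -> f i h = ell i h *: g h].
  by move=> i; apply: (class_hadamard banach_R r00 (at_least_C2_C1 k2) (proj0_norm i)
    (dir_norm i) (hE i) (fC i)); exact: f0.
have [r [r_gt0 rr0 rr_]] := common_radius r00 (fun i => let: And4 h _ _ _ := gP i in h).
have gC i : of_class (smoothness_pred k) [set h | `|h| < r] (g_ i).
  by have [_ _ H _] := gP i; apply: class_sub H => h /= hr; exact: lt_le_trans (rr_ i).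
have fg i h : `|h| < r -> f i h = ell i h *: g_ i h.
  by have [_ _ _ H] := gP i; move=> hr; apply: H; exact: lt_le_trans (rr_ i).
have oU := @eopen_ball0 R P r.
have k1' := at_least_C2_pred k2.
have U0 : [set h : P | `|h| < r] 0 by rewrite /= normr0.
have psiC2 : Ck 2 [set h : P | `|h| < r] psi.
  by apply: Ck_sub (class_Ck2 bY (@eopen_ball0 R P r0) k2 psiC) => h /= hr;
    exact: lt_le_trans rr0.
have [dpsi psidpsi /CkSP[d2psi dpsid2 _]] := (CkSP 1 _ _).1 psiC2.
have dpsi0 : dpsi 0 = 0 := fder_unique (psidpsi 0 U0) psid0.
have line_small i (t : R) : `|t| < r -> `|t *: dir i| < r.
  by move=> tr; rewrite normrZ; apply: le_lt_trans tr; rewrite ler_piMr.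
pose darg p : blin P (X * C)%type := compb shift0 (inlb P Y + compb (inrb P Y) (dpsi p)).
have argD p : `|p| < r -> fder (fun p => arg (p, psi p)) p (darg p).
  move=> pr; rewrite -[darg p]add0r.
  have -> : (fun p => arg (p, psi p)) = (fun p => (0, cs)
    + shift0 (inlb P Y p + inrb P Y (psi p))).
    by apply/funext => q; rewrite /arg -pairE.
  apply: fderD; first exact: fder_cst.
  by apply: fder_post; apply: fderD; [exact: fder_blin|apply: fder_post; exact: psidpsi].
have arg0 : arg (0, psi 0) = (0, cs).
  by rewrite /arg psi00 -[(0, 0)]/(0 : P * Y) blin0 addr0.
have dargE p q : darg p q = shift0 (q, dpsi p q) by rewrite [(q, _)]pairE.
have darg0 i : darg 0 (dir i) = (x_ i, 0).
  by rewrite dargE dpsi0 blin_zeroE shift0E combb_delta blin0 addr0.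
pose df i p : blin P R^o := compb (lam i) (compb (dF (arg (p, psi p))) (darg p)).
have fD i p : `|p| < r -> fder (f i) p (df i p).
  by move=> pr; apply: fder_post; apply: (fder_comp (argD p pr)).
have g_C1 i := class_Ck1 banach_R oU k1' (gC i).
have line_econt i (Z : normedModType R) (h : P -> Z) : econt h 0 -> econt (fun t : R^o =>
  h (lineb (dir i) t)) 0.
  move=> hC; apply: (@econt_comp _ _ _ _ h (lineb (dir i))).
    exact: fder_econt (fder_blin (lineb (dir i)) 0).
  by rewrite blin0.
(* g_i (0) is the derivative of f_i at 0 along [dir i], that is lam_i (L x_i) = 0. *)
have g_0 i : g_ i 0 = 0.
  have fd0 : fder (fun t : R^o => f i (lineb (dir i) t)) 0 (compb (df i 0) (lineb (dir i))).
    by apply: (fder_comp (fder_blin (lineb (dir i)) 0)); rewrite blin0; exact: fD.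
  have fE (t : R^o) : `|t| < r -> f i (lineb (dir i) t) = t *: g_ i (lineb (dir i) t).
    by move=> tr; rewrite fg ?ell_dir //; exact: line_small.
  have := fder_quotient r_gt0 (line_econt i _ _ (Ck_econt (g_C1 i) U0)) fd0 fE.
  have l0 : lineb (dir i) 0 = 0 by rewrite blin0.
  rewrite l0 => <-; rewrite -[LHS]/(lam i (dF (arg (0, psi 0)) (darg 0 (lineb (dir i) 1)))).
  by rewrite linebE scale1r darg0 arg0 (dF_pair FdF) lamL.
have /choice[dg /all_and2[dgD dgC]] : forall i, exists dg : P -> blin P R^o,
    (forall p, `|p| < r -> fder (g_ i) p (dg p)) /\ Ck 0 [set p | `|p| < r] dg.
  by move=> i; have [dg dgD dgC] := (CkSP 0 _ _).1 (g_C1 i); exists dg; split.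
(* For z = (0, g), [ell i z = 0], so differentiating f_i = s_i g_i in direction z at the point t e_i
   leaves t D g_i z. Its derivative in t at 0 equals D g_i (0) z by continuity of D g_i, and is also
   computed by the chain rule as lam_i of the mixed second derivative of F. *)
have dg_0 i (g : C) : dg i 0 (0, g) = (g *m nu^T) ord0 i.
  pose z : P := (0, g); pose l := lineb (dir i).
  have l0 : l 0 = 0 by rewrite blin0.
  pose A (t : R^o) := dF (arg (l t, psi (l t))).
  pose B (t : R^o) := shift0 (inlb P Y z + inrb P Y (evb Y z (dpsi (l t)))).
  pose A' := compb (d2F (0, cs)) (compb (darg 0) l).
  pose B' := compb shift0 (0 + compb (inrb P Y) (compb (evb Y z) (compb (d2psi 0) l))).
  have AD : fder A 0 A'.
    apply: (@fder_comp _ _ _ _ dF (fun t : R^o => arg (l t, psi (l t)))).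
      apply: (@fder_comp _ _ _ _ (fun p => arg (p, psi p)) l); first exact: fder_blin.
      by rewrite l0; exact: argD.
    by rewrite l0 arg0.
  have BD : fder B 0 B'.
    apply: fder_post; apply: fderD; first exact: fder_cst.
    apply: fder_post; apply: fder_post.
    apply: (@fder_comp _ _ _ _ dpsi l); first exact: fder_blin.
    by rewrite l0; exact: dpsid2.
  have hD := fder_post (lam i) (fder_eval AD BD).
  have ellz : ell i z = 0 by rewrite /ell compbE /= mxE.
  have elll t : ell i (l t) = t by rewrite /l linebE ell_dir.
  (* Multiplication by [ell i] as an operator-valued bounded linear map, so that the product f_i =
     s_i g_i falls under [fder_eval]. *)
  have [S SE] : exists S : blin P (blin R^o R^o), forall h (v : R^o), S h v = ell i h *: v.
    by exists (compb (lineb (idb R^o)) (ell i)) => h v; rewrite compbE linebE blin_scaleE.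
  have AE (t : R^o) : `|t| < r -> lam i (A t (B t)) = t *: dg i (l t) z.
    move=> tr; have ltr : `|l t| < r by exact: line_small.
    transitivity (df i (l t) z).
      by rewrite -[RHS]/(lam i (A t (darg (l t) z))) dargE [(z, _)]pairE.
    have prodD : fder (fun h => S h (g_ i h)) (l t) (flipb S (g_ i (l t))
      + compb (S (l t)) (dg i (l t))).
      by apply: fder_eval; [exact: fder_blin|exact: dgD].
    have [d d0 dU] := oU _ ltr.
    have fD' : fder (f i) (l t) (flipb S (g_ i (l t)) + compb (S (l t)) (dg i (l t))).
      by apply: (fder_ext d0) prodD => q qd; rewrite SE -fg //; exact: dU.
    rewrite (fder_unique (fD i _ ltr) fD') blin_addE flipbE compbE !SE ellz elll.
    by rewrite scale0r add0r.
  have gE : econt (fun t : R^o => dg i (l t) z) 0.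
    apply: (line_econt i _ (fun p => dg i p z)).
    apply: (@econt_comp _ _ _ _ (evb R^o z) (dg i)); first exact: Ck_econt (dgC i) U0.
    exact: fder_econt (fder_blin _ _).
  have := fder_quotient r_gt0 gE hD AE; rewrite l0 => <-.
  rewrite -[LHS]/(lam i ((flipb A' (B 0) + compb (A 0) B') 1)) blin_addE flipbE.
  rewrite -[X in _ + X]/(A 0 (B' 1)) blinD.
  have -> : A' 1 = d2F (0, cs) (x_ i, 0).
    by rewrite -[LHS]/(d2F (0, cs) (darg 0 (l 1))) /l linebE scale1r darg0.
  have -> : B 0 = (0, g).
    rewrite /B l0 dpsi0 (blin0 (evb Y z)) -pairE /z shift0E combbE big1 ?blin0 ?addr0 // => j _.
    by rewrite mxE scale0r.
  (* The second derivative of [psi] enters only through the range of L, which [lam i]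
     annihilates. *)
  have -> : A 0 (B' 1) = L (T (d2psi 0 (l 1) z)).
    have B'1 : B' 1 = shift0 ((0, 0), d2psi 0 (l 1) z).
      by rewrite -[LHS]/(shift0 ((0 : P, 0 : Y) + (0, d2psi 0 (l 1) z))) add0r.
    by rewrite B'1 /A l0 arg0 shift0E (dF_pair FdF) blinD L_combb add0r.
  by rewrite lamL addr0 (d2F_nu FdF dFd2F).
pose G p : C := \sum_j lineb (delta_mx 0 j : C) (g_ j p).
have GE p i : G p ord0 i = g_ i p.
  rewrite summxE (bigD1 i) //= !mxE !eqxx mulr1 big1 ?addr0 // => j ji.
  by rewrite !mxE eqxx /= eq_sym (negPf ji) mulr0.
exists r, psi, G; split=> //.
- by apply: class_sub psiC => h /= hr; exact: lt_le_trans rr0.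
- by apply: class_sum => j; apply: class_post (gC j); exact: banach_rV.
split.
- by apply/rowP => i; rewrite GE g_0 mxE.
- move=> D GD g; apply/rowP => i; rewrite -dg_0.
  have := fder_post (coordb i) GD.
  have -> : (fun p => coordb i (G p)) = g_ i by apply/funext => p; exact: GE.
  by move/(fder_unique (dgD i 0 U0)) => ->; rewrite compbE.
move=> s g sgr G0.
have sgr0 : `|(s, g)| < r0 by exact: lt_le_trans rr0.
rewrite [LHS](decomp _) -[L (T _)]/(Q _) psiQ // addr0 big1 // => i _.
have := fg i (s, g) sgr; rewrite /f argE => ->.
by rewrite -GE G0 mxE scaler0 scale0r.
Qed.

(** G (s, g) = 0 is solved as g = g - G (s, g) (nu^T)^-1, whose derivative in g at 0 vanishes. The
    expansion of x rests on [psi] having derivative 0 at 0: composed with s and g(s) it contributes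
    nothing to first order. Since g is of class k - 1, so are x and c. *)
Lemma reduced_solution : exists eps x c, [/\ 0 < eps,
  forall s : C, `|s| < eps -> F (x s, c s) = 0,
  of_class (smoothness_pred k) [set s : C | `|s| < eps] (fun s => (x s, c s)),
  fder x 0 (combb x_) /\ x 0 = 0 &
  exists D, fder c 0 D /\ c 0 = cs].
Proof.
have [r [psi [G [r0 psiC [psi00 psid0] GC [G0 GD GF]]]]] := reduction.
have k1' := at_least_C2_pred k2; have bC := banach_rV (n := n) : banach C.
have [dG GdG _] := (CkSP 0 _ _).1 (class_Ck1 bC (@eopen_ball0 R P r) k1' GC).
have {}GdG : fder G 0 (dG 0) by apply: GdG; rewrite /= normr0.
pose Mb := mulmxb (invmx nu^T).
pose N2 (q : P) : C := sndb C C q + (- Mb) (G q).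
have N2C : of_class (smoothness_pred k) [set q | `|q| < r] N2.
  by apply: classD; [exact: (class_blin _ _ (sndb C C))|exact: class_post].
have N2D : fder N2 0 (sndb C C + compb (- Mb) (dG 0)).
  by apply: fderD; [exact: (fder_blin (sndb C C))|exact: fder_post].
have N20 : N2 0 = 0 by rewrite /N2 G0 !blin0 addr0.
have D20 (g : C) : (sndb C C + compb (- Mb) (dG 0)) (0, g) = 0.
  rewrite blin_addE compbE (GD _ GdG) blin_oppE /= mulmxK ?subrr //.
  by rewrite unitmx_tr.
have [r2 [rho [ka [[r20 r2r] [rho0 rhor] kaC kaP]]]] :=
  class_ift bC r0 k1' N2C N20 N2D D20.
have ka0 : ka 0 = 0.
  by apply: (half_fix_zero k r20 rho0 N20 kaP); rewrite ?normr0.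
have [dka kadka _] := (CkSP 0 _ _).1 (class_Ck1 bC (@eopen_ball0 R C r2) k1' kaC).
have {}kadka : fder ka 0 (dka 0) by apply: kadka; rewrite /= normr0.
have small s : `|s| < r2 -> `|(s, ka s)| < r.
  move=> sr; have [kar _ _] := kaP s sr; rewrite norm_pair_lt (lt_le_trans sr) //=.
  by have := normr_ge0 (ka s); lra.
exists r2, (fun s => combb x_ s + T (psi (s, ka s))), (fun s => cs + ka s); split=> //.
- move=> s sr; apply: GF; first exact: small.
  have [_ kaE _] := kaP s sr; move: kaE.
  rewrite /N2 /= => /eqP; rewrite -subr_eq0 opprD addNKr opprK => /eqP MG0.
  by rewrite -[G _](mulmxKV (_ : nu^T \in unitmx)) ?unitmx_tr // [_ *m invmx _]MG0 mul0mx.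
- apply: class_pair => //; last by apply: classD => //; exact: class_cst.
  apply: classD; first exact: class_blin.
  apply: class_post => //; apply: (class_comp (V := [set p : P | `|p| < r])) => //.
    by apply: class_pair => //; exact: (class_blin _ _ (idb C)).
  exact: class_pred.
- split; last by rewrite ka0 -[(0, 0)]/(0 : P) psi00 !blin0 addr0.
  rewrite -[X in fder _ _ X]addr0; apply: fderD; first exact: fder_blin.
  have pairD : fder (fun s => inlb C C s + inrb C C (ka s)) 0 (inlb C C + compb (inrb C C)
    (dka 0)).
    by apply: fderD; [exact: fder_blin|exact: fder_post].
  have : fder (fun s => T (psi (inlb C C s + inrb C C (ka s)))) 0
     (compb T (compb 0 (inlb C C + compb (inrb C C) (dka 0)))).
    by apply: fder_post; apply: (fder_comp pairD); rewrite ka0 !blin0 addr0.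
  have -> : compb T (compb 0 (inlb C C + compb (inrb C C) (dka 0))) = 0.
    by apply: blin_ext => s; rewrite !compbE blin_zeroE blin0.
  by apply: (fder_ext r20) => s _; rewrite -pairE.
- exists (0 + dka 0); split; last by rewrite ka0 addr0.
  by apply: fderD => //; exact: fder_cst.
Qed.

End ReducedProblem.

(** * From the Fredholm hypotheses to a splitting *)

Section Splitting.
Context {R : realType}.

Lemma addS_set0 (V : normedModType R) (U : set V) : addS U [set 0] = U.
Proof.
apply/seteqP; split=> [v [u Uu [w -> <-]]|v Uv]; first by rewrite addr0.
by exists v => //; exists 0; rewrite ?addr0.
Qed.

Lemma addS_span (V : normedModType R) n (y : 'I_n -> V) (W : set V) :
  addS (span_of predT y) W =
  [set v | exists a : 'rV[R]_n, exists2 w, W w & v = \sum_i a ord0 i *: y i + w].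
Proof.
apply/seteqP; split=> [v [u [a ->] [w Ww <-]]|v [a [w Ww ->]]].
  by exists (\row_i a i), w => //; congr (_ + _); apply: eq_bigr => i _; rewrite mxE.
by exists (\sum_i a ord0 i *: y i); [exists (fun i => a ord0 i)|exists w].
Qed.

Lemma big_lift (V : nmodType) n (i : 'I_n) (f : 'I_n -> V) :
  \sum_(j | j != i) f j = \sum_j f (lift i j).
Proof.
rewrite (reindex_omap (lift i) (unlift i)) => [|j ji].
  by apply: eq_bigl => j; rewrite liftK eqxx andbT eq_sym neq_lift.
by rewrite eq_sym in ji; have [j' -> ->] := unlift_some ji.
Qed.

(** Reindexing by [lift i] turns a sum over j != i into one over a full family of n.-1 vectors, the
    shape required by [direct_sum]; for n = 1 the family is empty. *)
Lemma addS_hat (V : normedModType R) n (y : 'I_n -> V) (i : 'I_n) (W : set V) :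
  addS (hat y i) W =
  [set v | exists a : 'rV[R]_n.-1, exists2 w, W w & v = \sum_j a ord0 j *: y (lift i j) + w].
Proof.
apply/seteqP; split=> [v [u [a ->] [w Ww <-]]|v [a [w Ww ->]]].
  exists (\row_j a (lift i j)), w => //; congr (_ + _).
  by rewrite (big_lift i (fun j => a j *: y j)); apply: eq_bigr => j _; rewrite mxE.
exists (\sum_j a ord0 j *: y (lift i j)); last by exists w.
exists (fun l => if unlift i l is Some j then a ord0 j else 0).
by rewrite (big_lift i (fun l => _ *: y l)); apply: eq_bigr => j _; rewrite liftK.
Qed.

Lemma direct_sum_span (V : normedModType R) n (y : 'I_n -> V) (W W0 : set V) :
  is_subspace W -> is_subspace W0 -> W0 `<=` W -> direct_sum y W setT ->
  direct_sum y W0 (addS (span_of predT y) W0).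
Proof. by move=> sW sW0 W0W yW; rewrite addS_span; exact: (direct_sum_sub (f := id) _ sW). Qed.

Lemma direct_sum_hat (V : normedModType R) n (y : 'I_n -> V) i (W W0 : set V) :
  is_subspace W -> is_subspace W0 -> W0 `<=` W -> direct_sum y W setT ->
  direct_sum (y \o lift i) W0 (addS (hat y i) W0).
Proof.
move=> sW sW0 W0W yW; rewrite addS_hat.
by apply: (direct_sum_sub (@lift_inj _ i) sW).
Qed.

(* Index zero: the range has codimension [n] in [V0], and so does [W], which
   contains it. *)
Lemma fredholm_range (E V : normedModType R) n (U : set E) (V0 W : set V)
    (f : E -> V) (x : 'I_n -> E) (y : 'I_n -> V) :
  fredholm U V0 f 0 -> direct_sum x [set 0] (kernel_on U f) ->
  is_subspace W -> direct_sum y W V0 -> f @` U `<=` W -> W `<=` f @` U.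
Proof.
move=> [_ _ _ _ [d [d' [[e1 e1P] [e2 e2P] k0]]]] xP sW yP fW.
have nd := direct_sum_dim (@subspace_set0 _ _) xP e1P.
have dd' : d = d' by have := k0; lia.
by have [_] := direct_sum_exchange sW yP e2P fW; apply; rewrite nd.
Qed.

(** The operator sending (s, w) to the sum of s_i y_i plus L w is a bijection from R^n x Xt onto Y.
    The open mapping theorem bounds its inverse, whose components are [lam] and [T]. The last clause
    identifies them on explicit decompositions. *)
Lemma linear_splitting (X Y : completeNormedModType R) n (L : blin X Y)
    (x_ : 'I_n -> X) (y_ : 'I_n -> Y) (Xt : set X) (Yt : set Y) :
  closed_subspace Xt -> is_subspace Yt ->
  direct_sum x_ Xt setT -> direct_sum y_ Yt setT ->
  (forall i, L (x_ i) = 0) -> range L = Yt ->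
  (forall w, Xt w -> L w = 0 -> w = 0) ->
  exists (lam : 'I_n -> blin Y R^o) (T : blin Y X),
    [/\ forall y, y = \sum_i lam i y *: y_ i + L (T y),
        forall i x, lam i (L x) = 0 &
        forall (a : 'I_n -> R) w, Xt w ->
          (forall i, lam i (\sum_i a i *: y_ i + L w) = a i) /\
          T (\sum_i a i *: y_ i + L w) = w].
Proof.
move=> [sXt cXt] sYt X_sum Y_sum Lx Lrange Linj.
pose C := 'rV[R]_n; pose A := compb (combb y_) (fstb C X) + compb L (sndb C X).
have AE (s : C) x : A (s, x) = \sum_i s ord0 i *: y_ i + L x by rewrite blin_addE !compbE combbE.
pose W : set (C * X) := [set p | Xt p.2].
have YtL x : Yt (L x) by rewrite -Lrange; exists x.
have Adj p : W p -> A p = 0 -> p = 0.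
  case: p => s w Ww; rewrite AE => /(direct_sum_indep sYt Y_sum (YtL w)) [-> Lw0].
  by congr pair; exact: Linj.
have sW : closed_subspace W.
  split; last by apply: (closed_comp _ cXt) => p _; exact: cvg_snd.
  split; first by rewrite inE; exact: (subspace0 sXt : W 0).
  by move=> a u v; rewrite !inE; exact: (subspaceP _ sXt).
(* L depends only on the Xt-component, as the x_i lie in its kernel. *)
have LXt x : exists2 w, Xt w & L w = L x.
  have [a [w Ww xE]] := direct_sum_decomp X_sum (I : setT x); exists w => //.
  rewrite xE blinD blin_sum big1 ?add0r // => i _; by rewrite blinZ Lx scaler0.
have Asurj y : exists2 p, W p & A p = y.
  have [a [v Yv ->]] := direct_sum_decomp Y_sum (I : setT y).
  move: Yv; rewrite -Lrange => -[x _ <-]; have [w Ww <-] := LXt x.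
  by exists (a, w); rewrite ?AE.
have [K _ /choice[h hP]] := open_mapping (banach_prod (banach_rV (n :=
  n)) (@complete_banach _ X)) sW Asurj.
have hE p : W p -> h (A p) = p.
  move=> Wp; have [Wh Ah _] := hP (A p); apply/eqP; rewrite -subr_eq0; apply/eqP/Adj.
    exact: subspaceB sW.1 Wh Wp.
  by rewrite blinB Ah subrr.
have h_lin : linear h.
  move=> a u v; have [Wu Au _] := hP u; have [Wv Av _] := hP v.
  rewrite -[RHS]hE; last exact: subspaceP sW.1 Wu Wv.
  by rewrite blinD blinZ Au Av.
have h_bd y : `|h y| <= K * `|y| by have [] := hP y.
pose H := mkblin h_lin h_bd.
have uniq (a : 'I_n -> R) w : Xt w -> H (\sum_i a i *: y_ i + L w) = (\row_i a i, w).
  move=> Ww; rewrite -[RHS]hE // AE /=; congr (h (_ + _)).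
  by apply: eq_bigr => i _; rewrite mxE.
exists (fun i => compb (coordb i) (compb (fstb C X) H)), (compb (sndb C X) H); split.
- move=> y; have [_ Ay _] := hP y.
  by rewrite -{1}Ay -[LHS]/(A ((h y).1, (h y).2)) AE.
- move=> i x; have [w Ww <-] := LXt x; have := uniq (fun=> 0) w Ww.
  rewrite big1 ?add0r => [HE|j _]; last by rewrite scale0r.
  by rewrite !compbE HE /= mxE.
- move=> a w Ww; split=> [i|]; last by rewrite compbE uniq.
  by rewrite !compbE uniq //= mxE.
Qed.

End Splitting.

(* D1F_range is the Lyapunov-Schmidt convention that Yt is the range of
   D_1 F [0, cs]; without it the statement is false. *)
Theorem theoremA1 (R : realType) (n : nat) (n_ge1 : (1 <= n)%N)
    (X Y : completeNormedModType R)
    (x_ : 'I_n -> X) (y_ : 'I_n -> Y) (Xt : set X) (Yt : set Y)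
    (Xt_sub : closed_subspace Xt) (Yt_sub : closed_subspace Yt)
    (X_sum : direct_sum x_ Xt setT) (Y_sum : direct_sum y_ Yt setT)
    (P : 'I_n -> Y -> Y)
    (P_proj : forall i : 'I_n,
      projection_along (span_of (pred1 i) y_) (addS (hat y_ i) Yt) (P i))
    (k : smoothness) (k_ge2 : at_least_C2 k)
    (F : X * 'rV[R]_n -> Y)
    (F_Ck : of_class k setT F)
    (F_trivial : forall c : 'rV[R]_n, F (0, c) = 0)
    (cs : 'rV[R]_n)
    (D1F_fredholm : fredholm setT setT (D1 F 0 cs) 0)
    (D1F_range : range (D1 F 0 cs) `<=` Yt)
    (D1F_kernel_dim : has_dim (kernel_on setT (D1 F 0 cs)) n)
    (D1F_kernel : kernel_on setT (D1 F 0 cs) = span_of predT x_)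
    (nu : 'M[R]_n)
    (nuE : forall (i j : 'I_n) (c : 'rV[R]_n),
      P i (D1Dparam F j 0 cs (x_ i) (c ord0 j - cs ord0 j)) =
      (nu i j * (c ord0 j - cs ord0 j)) *: y_ i)
    (nu_inv : nu \in unitmx)
    (F_invariant : forall i : 'I_n, exists (Xti : set X) (Yti : set Y),
      [/\ closed_subspace Xti /\ Xti `<=` Xt,
          closed_subspace Yti /\ Yti `<=` Yt,
          (forall (u : X) (c : 'rV[R]_n),
            addS (hat x_ i) Xti u -> addS (hat y_ i) Yti (F (u, c))),
          fredholm (addS (hat x_ i) Xti) (addS (hat y_ i) Yti)
            (fun u => D1 F 0 cs u - P i (D1 F 0 cs u)) 0 &
          kernel_on (addS (hat x_ i) Xti)
            (fun u => D1 F 0 cs u - P i (D1 F 0 cs u)) = hat x_ i]) :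
  exists2 eps : R, 0 < eps &
    exists (x : 'rV[R]_n -> X) (c : 'rV[R]_n -> 'rV[R]_n),
      [/\ forall s, eucl_norm s < eps -> F (x s, c s) = 0,
          of_class (smoothness_pred k) [set s | eucl_norm s < eps]
            (fun s => (x s, c s)),
          (fun s => x s - \sum_i s ord0 i *: x_ i)
            =o_ (0 : 'rV[R]_n) (fun s => eucl_norm s : R^o) &
          (fun s => c s - cs)
            =O_ (0 : 'rV[R]_n) (fun s => eucl_norm s : R^o)].

Proof.
have bX := @complete_banach R X; have bY := @complete_banach R Y.
have [sXt _] := Xt_sub; have [sYt _] := Yt_sub.
pose C := 'rV[R]_n.
have [dF FdF _] := (CkSP 0 _ _).1 (class_Ck1 bY (@eopenT R _) (at_least_C2_C1 k_ge2) F_Ck).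
pose L := compb (dF (0, cs)) (inlb X C).
have FL : fder (fun x => F (x, cs)) 0 L.
  have H : fder (fun x => (0, cs) + inlb X C x) 0 (0 + inlb X C).
    by apply: fderD; [exact: fder_cst|exact: fder_blin].
  have := fder_comp H (FdF _ I); rewrite add0r.
  have -> : (0, cs) + inlb X C 0 = (0, cs) by rewrite blin0 addr0.
  apply: (fder_ext ltr01) => x _; congr F.
  by rewrite -[LHS]/(0 + _, cs + 0) !add0r addr0.
have D1E : D1 F 0 cs = L by have [_] := fder_diff FL.
have Lspan x : L x = 0 <-> span_of predT x_ x.
  by rewrite -D1F_kernel D1E; split=> [//|[]].
have x_span i : span_of predT x_ (x_ i).
  exists (fun j => (j == i)%:R); rewrite (bigD1 i) //= eqxx scale1r big1 ?addr0 // =>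
    j /negPf ->.
  by rewrite scale0r.
have Lx i : L (x_ i) = 0 by apply/Lspan.
have ker_sum : direct_sum x_ [set 0] (kernel_on setT (D1 F 0 cs)).
  rewrite D1F_kernel -[span_of _ _]addS_set0; apply: direct_sum_span X_sum => //.
    exact: subspace_set0.
  by move=> _ ->; exact: subspace0.
have Lrange : range L = Yt.
  rewrite -D1E; apply/seteqP; split=> //.
  exact: fredholm_range D1F_fredholm ker_sum sYt Y_sum D1F_range.
have Linj w : Xt w -> L w = 0 -> w = 0.
  move=> Ww /Lspan[a wE]; have Wnw : Xt (- w) by rewrite -scaleN1r; exact: subspaceZ.
  have [|_] := direct_sum_indep (a := \row_i a i) sXt X_sum Wnw.
    rewrite -[RHS](subrr w); congr (_ - _); rewrite [RHS]wE.
    by apply: eq_bigr => i _; rewrite mxE.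
  by move/eqP; rewrite oppr_eq0 => /eqP.
have [lam [T [decomp lamL lamTE]]] := linear_splitting Xt_sub sYt X_sum Y_sum Lx Lrange Linj.
(* [P i] is only given by its values on sums of the two summands; the decomposition through [lam]
   and [T] provides such a sum for every y. *)
have PE i y : P i y = lam i y *: y_ i.
  rewrite {1}(decomp y) (bigD1 i) //= -addrA; apply: P_proj.
    exists (fun j => lam j y); by rewrite big_pred1_eq.
  exists (\sum_(j | j != i) lam j y *: y_ j); first by exists (fun j => lam j y).
  by exists (L (T y)) => //; rewrite -Lrange; exists (T y).
have y_neq0 i : y_ i != 0.
  apply/eqP => yi0; have [|/rowP/(_ i)] := direct_sum_indep (a := delta_mx 0 i) (w :=
    0) sYt Y_sum (subspace0 sYt).
    rewrite addr0 (bigD1 i) //= yi0 scaler0 add0r big1 // => j /negPf ji.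
    by rewrite mxE ji andbF scale0r.
  by rewrite !mxE !eqxx => /eqP; rewrite oner_eq0.
(* Choosing c = cs + t e_j makes the increment an arbitrary scalar t; y_i != 0 permits comparison of
   coefficients. *)
have nuE' i j t : lam i (D1Dparam F j 0 cs (x_ i) t) = nu i j * t.
  have := nuE i j (cs + t *: delta_mx 0 j); rewrite !mxE !eqxx mulr1 addrAC subrr add0r PE.
  move/eqP; rewrite -subr_eq0 -scalerBl scaler_eq0 (negPf (y_neq0 i)) orbF subr_eq0.
  by move/eqP.
have invariant i : exists S : set Y, [/\ closed S, S 0 &
    forall (s c : C) y, s ord0 i = 0 -> S y ->
    S (L (T (y - F (combb x_ s + T y, c)))) /\ lam i (F (combb x_ s + T y, c)) = 0].
  have [Xti [Yti [[[sXti _] XtiS] [[sYti cYti] YtiS] Finv fred ker]]] := F_invariant i.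
  (* On the hatted sum the i-th coordinate is 0, and L T is the projection onto the component in
     Yti. *)
  have lam_hat y : addS (hat y_ i) Yti y -> lam i y = 0 /\ Yti (L (T y)).
    move=> [_ [a ->] [w Yw <-]]; have : range L w by rewrite Lrange; exact: YtiS.
    move=> [x _ Lxw]; have [b [v Vv xE]] := direct_sum_decomp X_sum (I : setT x).
    have {}Lxw : w = L v.
      by rewrite -Lxw xE blinD blin_sum big1 ?add0r // => j _; rewrite blinZ Lx scaler0.
    have -> : \sum_(j | j != i) a j *: y_ j = \sum_j (if j != i then a j else 0) *: y_ j.
      by rewrite big_mkcond; apply: eq_bigr => j _; case: ifP; rewrite ?scale0r.
    by rewrite Lxw; have [-> ->] := lamTE (fun j => if j != i then a j else 0) v Vv;
      rewrite eqxx -Lxw.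
  (* [P i] kills the range of L, so the restricted operator is L itself, with image inside Yti. Its
     kernel has dimension n - 1, which is also the codimension of Yti in the target; index 0 makes
     the image all of Yti, so T, the inverse of L on Xt, maps Yti into Xti. *)
  have YtiT y : Yti y -> Xti (T y).
    have LP u : D1 F 0 cs u - P i (D1 F 0 cs u) = L u by rewrite D1E PE lamL scale0r subr0.
    have ker_i : direct_sum (x_ \o lift i) [set 0] (kernel_on (addS (hat x_ i) Xti)
        (fun u => D1 F 0 cs u - P i (D1 F 0 cs u))).
      rewrite ker -[hat _ _]addS_set0; apply: direct_sum_hat X_sum => //.
        exact: subspace_set0.
      by move=> _ ->; exact: subspace0.
    have Yi_sum := direct_sum_hat i sYt sYti YtiS Y_sum.
    have sub : (fun u => D1 F 0 cs u - P i (D1 F 0 cs u)) @` addS (hat x_ i) Xti `<=` Yti.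
      move=> _ [u Uu <-]; have [_ _ im _ _] := fred.
      have := im _ (ex_intro2 _ _ u Uu erefl); rewrite LP => /lam_hat[_].
      have := decomp (L u); rewrite big1 ?add0r => [<-//|j _].
      by rewrite lamL scale0r.
    move=> Yy; have [_ [_ [a ->] [v Vv <-]]] := fredholm_range fred ker_i sYti Yi_sum sub Yy.
    rewrite LP blinD blin_sum big1 ?add0r => [<-|j _]; last by rewrite blinZ Lx scaler0.
    have [_] := lamTE (fun=> 0) v (XtiS _ Vv).
    by rewrite big1 ?add0r => [->|j _]; rewrite ?scale0r.
  exists Yti; split=> // [|s c y s0 Yy]; first exact: subspace0.
  have {}Finv : addS (hat y_ i) Yti (F (combb x_ s + T y, c)).
    apply: Finv; exists (combb x_ s); last by exists (T y) => //; exact: YtiT.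
    exists (fun j => s ord0 j); rewrite combbE (bigD1 i) //= s0 scale0r add0r.
    by [].
  have [lam0 YF] := lam_hat _ Finv; split=> //.
  rewrite !blinB; apply: subspaceB => //; apply: (lam_hat y _).2.
  exists 0; last by exists y => //; rewrite add0r.
  by exists (fun=> 0); rewrite big1 // => j _; rewrite scale0r.
have [eps [x [c [eps0 Fxc xcC [xD x0] [D [cD c0]]]]]] :=
  reduced_solution bX bY k_ge2 F_Ck F_trivial FL decomp lamL Lx invariant nuE' nu_inv.
(* The Euclidean ball lies in the sup-norm ball of the same radius, so eps is kept. *)
have small s : eucl_norm s < eps -> `|s| < eps by exact: le_lt_trans (rV_norm_le_eucl s).
exists eps => //; exists x, c; split.
- by move=> s /small; exact: Fxc.
- by apply: class_sub xcC => s; exact: small.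
- apply/eqoP => e e0. 
  apply: (near0P (E := 'rV[R]_n) _).2.
  have [d d0 xd] := xD e e0; exists d => // s sd.
  have := xd s sd; rewrite add0r x0 subr0 combbE => /le_trans; apply.
  by rewrite ler_wpM2l ?(ltW e0) // (le_trans (rV_norm_le_eucl s)) // ler_norm.
- have [d d0 cd] := fder_lip cD; have M0 : 0 < `|D| + 1 by rewrite ltr_wpDl.
  apply/eqO_exP; exists (`|D| + 1) => //; apply: (near0P (E := 'rV[R]_n) _).2;
    exists d => // s sd.
  have := cd s sd; rewrite add0r c0 => /le_trans; apply.
  by rewrite ler_wpM2l ?(ltW M0) // (le_trans (rV_norm_le_eucl s)) // ler_norm.
Qed.
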